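(* For each integer $N\neq0$, the Heisenberg–Fourier operator $R$ restricted to the invariant subspace $\mathcal{H}_N$ is a unitary operator $R_N$ which acts to permute the Hilbert spaces $\mathcal{H}_N(\chi;\mathfrak{f})$ of the coarse multiplicative decomposition of $\mathcal{H}_N$ ($\chi$ a primitive Dirichlet character modulo $\mathfrak{f}$, $\mathfrak{f}\mid N$). It satisfies $$R_N(\mathcal{H}_N(\chi;\mathfrak{f}))=\mathcal{H}_N(\bar\chi;\mathfrak{f}).$$
   Context: $H(\mathbb{R})$ is the real Heisenberg group of triples $[a,c,z]\in\mathbb{R}^3$ with law $[a,c,z]\circ[a',c',z']=[a+a',c+c',z+z'+ca']$; $H(\mathbb{Z})$ is the subgroup of integer triples. $\mathcal{H}_N$ is the Hilbert space of left $H(\mathbb{Z})$-invariant functions $F$ on $H(\mathbb{R})$, square-integrable over $[0,1]^3$ with respect to $da\,dc\,dz$, with $F(a,c,z)=e^{2\pi i Nz}F(a,c,0)$ a.e. The Heisenberg–Fourier operator is $R(F)(a,c,z)=F(-c,a,z-ac)$, acting on $L^2(H(\mathbb{Z})\backslash H(\mathbb{R}),da\,dc\,dz)$. For a (primitive or imprimitive) Dirichlet character $\chi$ mod $d$, $d\mid N$, $d\ge 1$, the map $\mathcal{W}_{N,d}(\chi):L^2(\mathbb{R},dx)\to\mathcal{H}_N$ is the isometric extension of $$\mathcal{W}_{N,d}(\chi)(f)(a,c,z)=\sqrt{C_{N,d}}\,e^{2\pi i Nz}\sum_{n\in\mathbb{Z}}\chi\Big(\frac{nd}{N}\Big)f(n+Nc)e^{2\pi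 i na},\quad C_{N,d}=\frac{N}{\phi(d)}$$ ($f$ Schwartz; $\chi(r)=0$ if $r\notin\mathbb{Z}$; principal square root when $N<0$), and $\mathcal{H}_{N,d}(\chi)$ is its closed image. For a primitive character $\chi$ mod $\mathfrak{f}$ and $\mathfrak{f}\mid d$, $\chi|_d$ is the character mod $d$ with $\chi|_d(n)=\chi(n)$ if $\gcd(n,d)=1$ and $0$ otherwise. For $\mathfrak{f}\mid N$, $\mathcal{H}_N(\chi;\mathfrak{f})=\bigoplus_{\mathfrak{f}\mid d\mid N}\mathcal{H}_{N,d}(\chi|_d)$; the coarse multiplicative decomposition is the orthogonal decomposition $\mathcal{H}_N=\bigoplus_{\chi,\mathfrak{f}}\mathcal{H}_N(\chi;\mathfrak{f})$ over all primitive $\chi$ mod $\mathfrak{f}$, $\mathfrak{f}\mid N$. *)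

(* Defs.v *)
From HB Require Import structures.
From mathcomp Require Import all_boot all_order all_algebra.
From mathcomp Require Import all_classical all_reals all_analysis.
From mathcomp Require Import complex.

Set Implicit Arguments.
Unset Strict Implicit.
Unset Printing Implicit Defensive.

Import Order.TTheory GRing.Theory Num.Theory.
Import numFieldNormedType.Exports.

Local Open Scope classical_set_scope.
Local Open Scope ring_scope.
Local Open Scope complex_scope.

(* Elements of L^2 spaces are represented by Borel measurable functions with
   values in R[i], taken up to equality almost everywhere; a subspace of an L^2
   space is a set of functions that is stable under a.e. equality of measurable
   functions. *)

Section ComplexAnalysis.
Context {R : realType}.

Definition cmodulus (z : R[i]) : R := ComplexField.Normc.normc z.

(* e^{2 pi i x} *)
Definition e2pi (x : R) : R[i] := cos (2 * pi * x) +i* sin (2 * pi * x).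

Definition cmeasurable d (T : measurableType d) (F : T -> R[i]) : Prop :=
  measurable_fun setT (fun x => complex.Re (F x)) /\
  measurable_fun setT (fun x => complex.Im (F x)).

Definition cintegral d (T : measurableType d)
    (mu : {measure set T -> \bar R}) (D : set T) (F : T -> R[i]) : R[i] :=
  Rintegral mu D (fun x => complex.Re (F x)) +i*
  Rintegral mu D (fun x => complex.Im (F x)).

(* the square of the L^2(D, mu) norm *)
Definition sqnorm d (T : measurableType d)
    (mu : {measure set T -> \bar R}) (D : set T) (F : T -> R[i]) : \bar R :=
  (\int[mu]_(x in D) (cmodulus (F x) ^+ 2)%:E)%E.

(* sum over Z, as the limit of the partial sums over -K <= n < K; it is only
   used for absolutely summable families *)
Definition rsumZ (u : int -> R) : R :=
  limn (fun K : nat =>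
    \sum_(0 <= k < K) u k%:Z + \sum_(0 <= k < K) u (- k.+1%:Z)).

Definition csumZ (u : int -> R[i]) : R[i] :=
  rsumZ (fun n => complex.Re (u n)) +i* rsumZ (fun n => complex.Im (u n)).

Definition real_schwartz (g : R -> R) : Prop :=
  (forall n (x : R), derivable (derive1n n g) x 1) /\
  (forall m n : nat, exists M : R,
     forall x : R, `|x ^+ m * derive1n n g x| <= M).

Definition schwartz (f : R -> R[i]) : Prop :=
  real_schwartz (fun x => complex.Re (f x)) /\
  real_schwartz (fun x => complex.Im (f x)).

Definition L2R : set (measurableTypeR R -> R[i]) :=
  [set f | cmeasurable f /\ (sqnorm lebesgue_measure setT f < +oo)%E].

End ComplexAnalysis.

Section Dirichlet.
Context {R : realType}.
Implicit Types chi psi : int -> R[i].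

(* chi 1 = 1 follows from multiplicativity and chi 1 != 0; for d = 1 the
   condition on the support says that chi never vanishes, so chi = 1 *)
Definition dirichlet_character (d : nat) chi : Prop :=
  [/\ (0 < d)%N,
      forall n : int, chi (n + d%:Z) = chi n,
      forall m n : int, chi (m * n) = chi m * chi n &
      forall n : int, (chi n != 0) = (gcdz n d%:Z == 1)].

(* chi|_d *)
Definition induced (d : nat) chi : int -> R[i] :=
  fun n => if gcdz n d%:Z == 1 then chi n else 0.

Definition primitive_character (f : nat) chi : Prop :=
  dirichlet_character f chi /\
  forall (d : nat) psi, (d %| f)%N -> dirichlet_character d psi ->
    chi =1 induced f psi -> d = f.

Definition conj_character chi : int -> R[i] := fun n => (chi n)^*.

(* extension of chi by 0 to the non-integral rationals *)
Definition ratchar chi (r : rat) : R[i] :=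
  if r \is a Num.int then chi (numq r) else 0.

End Dirichlet.

(* the points (a, c, z) of H(R), where each factor R carries the Borel
   sigma-algebra on which lebesgue_measure is defined *)
Notation heis R :=
  (measurableTypeR R * measurableTypeR R * measurableTypeR R)%type.

Section Heisenberg.
Context {R : realType}.

Definition heis_mul (g h : heis R) : heis R :=
  let: (a, c, z) := g in let: (a', c', z') := h in
  (a + a', c + c', z + z' + c * a').

Definition haar : {measure set (heis R) -> \bar R} :=
  ((@lebesgue_measure R \x @lebesgue_measure R) \x @lebesgue_measure R)%E.

Definition cube : set (heis R) :=
  `[0, 1] `*` `[0, 1] `*` `[0, 1].

Definition left_HZ_invariant (F : heis R -> R[i]) : Prop :=
  forall (p q r : int) (g : heis R),
    F (heis_mul (p%:~R, q%:~R, r%:~R) g) = F g.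

(* The value F(a,c,0) is meaningless for an a.e. class, hence the choice of a
   representative G. *)
Definition HN (N : int) : set (heis R -> R[i]) :=
  [set F | cmeasurable F /\ exists G : heis R -> R[i],
     [/\ cmeasurable G,
         F = G %[ae haar],
         left_HZ_invariant G,
         (sqnorm haar cube G < +oo)%E &
         G = (fun x => let: (a, c, z) := x in e2pi (N%:~R * z) * G (a, c, 0))
           %[ae haar]]].

Definition inner (F G : heis R -> R[i]) : R[i] :=
  cintegral haar cube (fun x => F x * (G x)^*).

Definition unitary_on (V : set (heis R -> R[i]))
    (T : (heis R -> R[i]) -> (heis R -> R[i])) : Prop :=
  [/\ (forall F G, V F -> V G -> F = G %[ae haar] -> T F = T G %[ae haar]),
      (forall (k : R[i]) F G, V F -> V G ->
         T (fun x => k * F x + G x) = (fun x => k * T F x + T G x)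
           %[ae haar]),
      (forall F, V F -> V (T F)),
      (forall G, V G -> exists2 F, V F & T F = G %[ae haar]) &
      forall F G, V F -> V G -> inner (T F) (T G) = inner F G].

Definition heis_fourier (F : heis R -> R[i]) : heis R -> R[i] :=
  fun x => let: (a, c, z) := x in F (- c, a, z - a * c).

(* N / phi(d), possibly negative; sqrtc is the principal square root *)
Definition CNd (N : int) (d : nat) : R[i] := N%:~R / (totient d)%:R.

Definition W_schwartz (N : int) (d : nat) (chi : int -> R[i]) (f : R -> R[i]) :
    heis R -> R[i] :=
  fun x => let: (a, c, z) := x in
  sqrtc (CNd N d) * e2pi (N%:~R * z) *
  csumZ (fun n : int =>
    ratchar chi (n%:~R * d%:R / N%:~R) * f (n%:~R + N%:~R * c) *
    e2pi (n%:~R * a)).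

(* W_extension N d chi f F: F is the value at f of the extension by continuity
   of W_schwartz N d chi to L^2(R) *)
Definition W_extension (N : int) (d : nat) (chi : int -> R[i])
    (f : R -> R[i]) (F : heis R -> R[i]) : Prop :=
  [/\ L2R f, HN N F &
      exists u : nat -> R -> R[i],
        [/\ forall k, schwartz (u k),
            sqnorm lebesgue_measure setT (fun x => u k x - f x)
              @[k --> \oo] --> 0%E &
            sqnorm haar cube (fun x => W_schwartz N d chi (u k) x - F x)
              @[k --> \oo] --> 0%E]].

(* the range of the isometric extension, which is closed because L^2(R) is
   complete *)
Definition HNd (N : int) (d : nat) (chi : int -> R[i]) :
    set (heis R -> R[i]) :=
  [set F | exists f, W_extension N d chi f F].

Definition HNchi (N : int) (chi : int -> R[i]) (f : nat) :
    set (heis R -> R[i]) :=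
  [set F | HN N F /\ exists G : nat -> heis R -> R[i],
     (forall d : nat, (f %| d)%N -> (d%:Z %| N)%Z ->
        HNd N d (induced d chi) (G d)) /\
     F = (fun x => \sum_(d <- divisors `|N|%N | (f %| d)%N) G d x)
       %[ae haar]].

Definition coarse_components (N : int) : set (set (heis R -> R[i])) :=
  [set V | exists f : nat, exists2 chi : int -> R[i],
     (f%:Z %| N)%Z /\ primitive_character f chi & V = HNchi N chi f].

End Heisenberg.

(* Main.v *)
(* On Schwartz functions, W(chi)(u) is a theta function attached to the sequence
   n |-> chi(n d / N) of period N, and by Poisson summation R maps the theta function of
   (w, u) to the one of (w^, u^): w^ is the finite Fourier transform of w on Z / N and u^ a
   rescaled Fourier transform of u.  Sequences w with w(v n) = chi(v) w(n) for all units v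
   mod N are exchanged by w |-> w^ with those for conj chi, and on each orbit
   {n : |N| / gcd(n, N) = d'} of the units such a sequence for conj chi, primitive mod f, is a
   multiple of n |-> conj chi|_d'(n d' / N), and zero unless f | d'.  The orbits are separated
   by bounded combinations of translations in a, which carry this splitting from theta
   functions to all of H_{N,d}(chi|_d) by density.  The reverse inclusion follows from
   R^4 = 1. *)
Require Import Defs.
From HB Require Import structures.
From mathcomp Require Import all_boot all_order all_algebra.
From mathcomp Require Import all_classical all_reals all_analysis.
From mathcomp Require Import cyclic measurable_realfun complex.
From mathcomp Require Import ring lra zify.

Set Implicit Arguments.
Unset Strict Implicit.
Unset Printing Implicit Defensive.

Import Order.TTheory GRing.Theory Num.Theory.
Import numFieldNormedType.Exports.

Local Open Scope classical_set_scope.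
Local Open Scope ring_scope.
Local Open Scope complex_scope.

(** Membership in [HNd] asks for Schwartz preimages that converge in L^2(R). Applying R and a
    multiplier to W(u k) gives W of explicit Schwartz functions v k; these images converge, because
    R preserves the norm and the multipliers are bounded, but the convergence of the v k themselves
    must be drawn from that. It comes from a lower bound for W: a Schwartz function can be read off
    its theta function as a Fourier coefficient in a, and Bessel's inequality on each slice,
    integrated over c, bounds the norm of the former by that of the latter. The slices {(a, c, 0)}
    are null sets, so elements of H_N are first replaced by representatives for which the invariance
    and the dependence on z hold everywhere ([automorphic]). Left translation by (k / |N|, 0, 0)
    keeps this class, since N k / |N| is an integer; finite Fourier multipliers in n thus become
    bounded operators on all of H_N, where no theta series need be at hand. *)

Section ComplexBasics.
Context {R : realType}.
Implicit Types z w : R[i].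

Local Notation Re := complex.Re.
Local Notation Im := complex.Im.

Lemma complex_eqP z w : Re z = Re w -> Im z = Im w -> z = w.
Proof. by move: z w => [a b] [c d] /= -> ->. Qed.

Lemma cReD z w : Re (z + w) = Re z + Re w. Proof. by move: z w => [? ?] [? ?]. Qed.
Lemma cImD z w : Im (z + w) = Im z + Im w. Proof. by move: z w => [? ?] [? ?]. Qed.
Lemma cReN z : Re (- z) = - Re z. Proof. by move: z => [? ?]. Qed.
Lemma cImN z : Im (- z) = - Im z. Proof. by move: z => [? ?]. Qed.
Lemma cReM z w : Re (z * w) = Re z * Re w - Im z * Im w.
Proof. by move: z w => [? ?] [? ?]. Qed.
Lemma cImM z w : Im (z * w) = Re z * Im w + Im z * Re w.
Proof. by move: z w => [? ?] [? ?]. Qed.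
Lemma cReC z : Re (conjc z) = Re z. Proof. by move: z => [? ?]. Qed.
Lemma cImC z : Im (conjc z) = - Im z. Proof. by move: z => [? ?]. Qed.

Lemma Re_sum I (r : seq I) (P : pred I) (F : I -> R[i]) :
  Re (\sum_(i <- r | P i) F i) = \sum_(i <- r | P i) Re (F i).
Proof. by elim: r => [|i r ih]; rewrite ?big_nil// !big_cons; case: ifP => // _; rewrite cReD ih. Qed.

Lemma Im_sum I (r : seq I) (P : pred I) (F : I -> R[i]) :
  Im (\sum_(i <- r | P i) F i) = \sum_(i <- r | P i) Im (F i).
Proof. by elim: r => [|i r ih]; rewrite ?big_nil// !big_cons; case: ifP => // _; rewrite cImD ih. Qed.

(** The squared modulus as a polynomial in the real and imaginary parts, without square root, so
    that [ring] and [nra] apply to it. *)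
Definition cnorm2 z : R := Re z ^+ 2 + Im z ^+ 2.

Lemma cmodulus2 z : cmodulus z ^+ 2 = cnorm2 z.
Proof.
by case: z => a b; rewrite /cmodulus /cnorm2 /= sqr_sqrtr// addr_ge0// sqr_ge0.
Qed.

Lemma cnorm2_ge0 z : 0 <= cnorm2 z.
Proof. by rewrite addr_ge0// sqr_ge0. Qed.

Lemma cnorm2M z w : cnorm2 (z * w) = cnorm2 z * cnorm2 w.
Proof. rewrite /cnorm2 cReM cImM; ring. Qed.

Lemma cnorm2N z : cnorm2 (- z) = cnorm2 z.
Proof. by rewrite /cnorm2 cReN cImN !sqrrN. Qed.

Lemma cnorm2D_le z w : cnorm2 (z + w) <= 2 * cnorm2 z + 2 * cnorm2 w.
Proof.
rewrite /cnorm2 cReD cImD.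
have := sqr_ge0 (Re z - Re w); have := sqr_ge0 (Im z - Im w); rewrite !expr2; nra.
Qed.

Lemma cnorm2_0 : cnorm2 0 = 0.
Proof. by rewrite /cnorm2 /= expr0n /= addr0. Qed.

Lemma cnorm2_eq0 z : (cnorm2 z == 0) = (z == 0).
Proof.
apply/eqP/eqP => [|->]; last exact: cnorm2_0.
move/eqP; rewrite /cnorm2 paddr_eq0 ?sqr_ge0// !sqrf_eq0 => /andP[/eqP a /eqP b].
by apply: complex_eqP.
Qed.

Lemma Re_sqr_le z : Re z ^+ 2 <= cnorm2 z.
Proof. by rewrite lerDl sqr_ge0. Qed.

Lemma Im_sqr_le z : Im z ^+ 2 <= cnorm2 z.
Proof. by rewrite lerDr sqr_ge0. Qed.

Lemma conjcM z w : conjc (z * w) = conjc z * conjc w.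
Proof. by case: z w => [a b] [c d]; apply: complex_eqP => /=; ring. Qed.

Lemma mulcJ z : z * conjc z = (cnorm2 z)%:C.
Proof. case: z => a b; apply: complex_eqP; rewrite /cnorm2 /=; ring. Qed.

Lemma e2piD (x y : R) : e2pi (x + y) = e2pi x * e2pi y.
Proof.
rewrite /e2pi mulrDr cosD sinD; apply: complex_eqP => //=; ring.
Qed.

Lemma e2pi0 : e2pi (0 : R) = 1.
Proof. by rewrite /e2pi mulr0 cos0 sin0. Qed.

Lemma e2piN (x : R) : e2pi (- x) = conjc (e2pi x).
Proof. by rewrite /e2pi mulrN cosN sinN. Qed.

Lemma cnorm2_e2pi (x : R) : cnorm2 (e2pi x) = 1.
Proof. exact: cos2Dsin2. Qed.

Lemma e2pi_nat (n : nat) : e2pi (n%:R : R) = 1.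
Proof.
elim: n => [|n ih]; first exact: e2pi0.
rewrite -natr1 e2piD ih mul1r /e2pi mulr1 mulr_natl cos2pi sin2pi.
by [].
Qed.

Lemma e2pi_int (n : int) : e2pi (n%:~R : R) = 1.
Proof.
case: n => n; first exact: e2pi_nat.
by rewrite NegzE mulrNz e2piN e2pi_nat; apply: complex_eqP => //=; rewrite oppr0.
Qed.

Lemma e2piDint (x : R) (n : int) : e2pi (x + n%:~R) = e2pi x.
Proof. by rewrite e2piD e2pi_int mulr1. Qed.

Lemma e2piNK (x : R) : e2pi (- x) * e2pi x = 1.
Proof. by rewrite -e2piD addNr e2pi0. Qed.

End ComplexBasics.

(** * Measurability of complex-valued functions *)

Section ComplexMeasurable.
Context {R : realType} d (T : measurableType d).
Implicit Types F G : T -> R[i].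

Lemma cmeasurable_cst (k : R[i]) : cmeasurable (fun _ : T => k).
Proof. by split; exact: measurable_cst. Qed.

Lemma cmeasurableD F G : cmeasurable F -> cmeasurable G ->
  cmeasurable (fun x => F x + G x).
Proof.
move=> [a b] [a' b']; split.
  by under eq_fun do rewrite cReD; exact: measurable_funD.
by under eq_fun do rewrite cImD; exact: measurable_funD.
Qed.

Lemma cmeasurableN F : cmeasurable F -> cmeasurable (fun x => - F x).
Proof.
move=> [a b]; split.
  by under eq_fun do rewrite cReN; exact: measurableT_comp.
by under eq_fun do rewrite cImN; exact: measurableT_comp.
Qed.

Lemma cmeasurableB F G : cmeasurable F -> cmeasurable G ->
  cmeasurable (fun x => F x - G x).
Proof. by move=> mF mG; apply: cmeasurableD => //; exact: cmeasurableN. Qed.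

Lemma cmeasurableM F G : cmeasurable F -> cmeasurable G ->
  cmeasurable (fun x => F x * G x).
Proof.
move=> [a b] [a' b']; split.
  by under eq_fun do rewrite cReM; apply: measurable_funB; exact: measurable_funM.
by under eq_fun do rewrite cImM; apply: measurable_funD; exact: measurable_funM.
Qed.

Lemma cmeasurableC F : cmeasurable F -> cmeasurable (fun x => conjc (F x)).
Proof.
move=> [a b]; split; first by under eq_fun do rewrite cReC.
by under eq_fun do rewrite cImC; exact: measurableT_comp.
Qed.

Lemma cmeasurable_sum I (r : seq I) (P : pred I) (F : I -> T -> R[i]) :
  (forall i, P i -> cmeasurable (F i)) ->
  cmeasurable (fun x => \sum_(i <- r | P i) F i x).
Proof.
move=> mF; elim: r => [|i r ih].
  under eq_fun do rewrite big_nil; exact: cmeasurable_cst.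
under eq_fun do rewrite big_cons.
have [Pi|Pi] := boolP (P i); last by [].
by apply: cmeasurableD => //; exact: mF.
Qed.

Lemma measurable_cnorm2 F : cmeasurable F ->
  measurable_fun setT (fun x => cnorm2 (F x)).
Proof.
by move=> [a b]; apply: measurable_funD; exact: measurable_funX.
Qed.

Lemma measurable_cnorm2E F : cmeasurable F ->
  measurable_fun setT (fun x => (cnorm2 (F x))%:E).
Proof. by move=> /measurable_cnorm2/measurable_EFinP. Qed.

Lemma cmeasurable_comp d' (U : measurableType d') (f : U -> T) F :
  measurable_fun setT f -> cmeasurable F -> cmeasurable (fun x => F (f x)).
Proof.
by move=> mf [a b]; split; [apply: (measurableT_comp a)|apply: (measurableT_comp b)].
Qed.

Lemma measurable_fun_e2pi : cmeasurable (e2pi : measurableTypeR R -> R[i]).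
Proof.
split; rewrite /e2pi /=.
  apply: (measurableT_comp (f := @cos R)); last exact: measurable_funM.
  by apply: continuous_measurable_fun; exact: continuous_cos.
apply: (measurableT_comp (f := @sin R)); last exact: measurable_funM.
by apply: continuous_measurable_fun; exact: continuous_sin.
Qed.

Lemma cmeasurable_e2pi (f : T -> measurableTypeR R) :
  measurable_fun setT f -> cmeasurable (fun x => e2pi (f x)).
Proof.
move=> mf; split.
  exact: (measurableT_comp (proj1 measurable_fun_e2pi) mf).
exact: (measurableT_comp (proj2 measurable_fun_e2pi) mf).
Qed.

Lemma sqnormE (mu : {measure set T -> \bar R}) D F :
  sqnorm mu D F = (\int[mu]_(x in D) (cnorm2 (F x))%:E)%E.
Proof. by apply: eq_integral => x _; rewrite cmodulus2. Qed.

End ComplexMeasurable.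

(** * Measure-preserving maps of the line, the plane and H(R) *)

Section MeasurePreserving.
Context {R : realType}.

Definition mpres d (T : measurableType d) (mu : {measure set T -> \bar R})
    (f : T -> T) : Prop :=
  measurable_fun setT f /\
  forall A, measurable A -> mu (f @^-1` A) = mu A.

Section Generic.
Context d (T : measurableType d) (mu : {measure set T -> \bar R}).

Lemma mpres_ae (f : T -> T) (P : T -> Prop) : mpres mu f ->
  {ae mu, forall x, P x} -> {ae mu, forall x, P (f x)}.
Proof.
move=> [mf pf] [A [mA A0 PA]]; exists (f @^-1` A); split.
- by rewrite -[_ @^-1` _]setTI; exact: mf.
- by rewrite pf.
- by move=> x /= nPx; apply: PA.
Qed.

Lemma mpres_ge0_integral (f : T -> T) (D : set T) (h : T -> \bar R) :
  mpres mu f -> measurable D -> measurable_fun setT h ->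
  (forall x, 0 <= h x)%E ->
  (\int[mu]_(x in f @^-1` D) h (f x) = \int[mu]_(x in D) h x)%E.
Proof.
move=> [mf pf] mD mh h0.
have := @ge0_integral_pushforward _ _ _ _ _ _ mf mu D h mD (measurable_funTS mh)
  (fun y _ => h0 y).
move=> <-; apply: eq_measure_integral => A mA _; exact: pf.
Qed.

Lemma mpres_integral (f : T -> T) (D : set T) (h : T -> \bar R) :
  mpres mu f -> measurable D -> measurable_fun setT h ->
  (\int[mu]_(x in f @^-1` D) h (f x) = \int[mu]_(x in D) h x)%E.
Proof.
move=> pf mD mh; rewrite integralE [RHS]integralE; congr (_ - _)%E.
  rewrite -(mpres_ge0_integral pf mD (measurable_funepos mh))//.
  by rewrite (funepos_comp h f).
rewrite -(mpres_ge0_integral pf mD (measurable_funeneg mh))//.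
by rewrite (funeneg_comp h f).
Qed.

Lemma mpres_comp (f g : T -> T) : mpres mu f -> mpres mu g ->
  mpres mu (f \o g).
Proof.
move=> [mf pf] [mg pg]; split; first exact: measurableT_comp.
move=> A mA; rewrite comp_preimage pg ?pf// -[_ @^-1` _]setTI; exact: mf.
Qed.

End Generic.

(** The section over x of the preimage of A is the preimage under [g x] of the section of A over
    [f x]; its measure is therefore that of the latter section, and integrating over x uses that [f]
    preserves [m1]. *)
Lemma mpres_skew d1 d2 (T1 : measurableType d1) (T2 : measurableType d2)
    (m1 : {measure set T1 -> \bar R})
    (m2 : {sigma_finite_measure set T2 -> \bar R})
    (f : T1 -> T1) (g : T1 -> T2 -> T2) :
  mpres m1 f -> (forall x, mpres m2 (g x)) ->
  measurable_fun setT (fun x : T1 * T2 => g x.1 x.2) ->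
  mpres (m1 \x m2)%E (fun x => (f x.1, g x.1 x.2)).
Proof.
move=> [mf pf] pg mg; split.
  by apply: measurable_fun_pair => //; exact: measurableT_comp.
move=> A mA; rewrite /product_measure1.
have mh : measurable_fun setT (m2 \o xsection A).
  exact: measurable_fun_xsection.
have := mpres_ge0_integral (conj mf pf) measurableT mh (fun=> measure_ge0 _ _).
rewrite preimage_setT => E; apply/esym; etransitivity; first exact/esym/E.
apply: eq_integral => x _ /=.
rewrite -(proj2 (pg x) (xsection A (f x))); last exact: measurable_xsection.
by congr (m2 _); rewrite !xsectionE.
Qed.

Local Notation mu := (@lebesgue_measure R).
Local Notation mR := (measurableTypeR R).

Lemma mpres_opp : mpres mu (-%R : mR -> mR).
Proof.
split; first exact: oppr_measurable.
by move=> A mA; exact: lebesgue_measureN.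
Qed.

Lemma measurable_shift (t : R) : measurable_fun setT ((fun x => x + t) : mR -> mR).
Proof. by apply: measurable_funD. Qed.

Lemma mpres_shift (t : R) : mpres mu ((fun x => x + t) : mR -> mR).
Proof.
split; first exact: measurable_shift.
move=> A mA; apply/esym.
pose f : mR -> mR := fun x => x + t.
pose nu : {measure set mR -> \bar R} := pushforward mu f.
suff : mu A = nu (measurable_shift t) A by [].
apply: (@lebesgue_measure_unique R (nu (measurable_shift t))) => // X [[a b]] _ <-.
rewrite /nu /pushforward /f /=.
transitivity (mu (`]a - t, b - t]%classic : set mR)).
  rewrite !lebesgue_measure_itv/= !lte_fin ltrD2r.
  by case: ifP => // _; rewrite -!EFinB; congr (_%:E); ring.
by congr (mu _); apply/seteqP; split => x /=; rewrite !in_itv/= => /andP[? ?]; lra.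
Qed.

(** The right-hand side is a measure in A, compared with Lebesgue measure on the half-open intervals
    that determine it. *)
Lemma lebesgue_measure_scale (k : R) (A : set mR) : k != 0 -> measurable A ->
  (mu A = `|k|%:E * mu (( *%R k : mR -> mR) @^-1` A))%E.
Proof.
move=> k0 mA.
have mk : measurable_fun setT ((fun x => k * x) : mR -> mR) by exact: measurable_funM.
pose f : mR -> mR := *%R k.
have k0' : 0 <= `|k| by [].
pose nu : {measure set mR -> \bar R} := mscale (NngNum k0') (pushforward mu f).
suff : mu A = nu mk A by [].
apply: (@lebesgue_measure_unique R (nu mk)) => // X [[a b]] _ <-.
rewrite /nu /mscale /= /pushforward /f /=.
have [kp|kn|ke] := ltgtP 0 k; last by rewrite -ke eqxx in k0.
- transitivity (k%:E * mu (`](a / k)%R, (b / k)%R]%classic : set mR))%E.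
    rewrite !lebesgue_measure_itv/= !lte_fin ltr_pM2r ?invr_gt0//.
    case: ifP => _; last by rewrite mule0.
    by rewrite -!EFinB -EFinM mulrBr !mulrA ![k * _]mulrC !mulfK ?gt_eqF.
  congr (_ * _)%E; first by rewrite /= gtr0_norm.
  congr (mu _); apply/seteqP; split => x /=; rewrite !in_itv/=.
    by rewrite ltr_pdivrMr// ler_pdivlMr// mulrC.
  by rewrite ltr_pdivrMr// ler_pdivlMr// mulrC.
(* For k < 0 the preimage of an interval open on the left is open on the right, which leaves its
   length unchanged. *)
- transitivity ((- k)%R%:E * mu (`[(b / k)%R, (a / k)%R[%classic : set mR))%E.
    rewrite !lebesgue_measure_itv/= !lte_fin ltr_nM2r ?invr_lt0//.
    case: ifP => _; last by rewrite mule0.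
    rewrite -!EFinB -EFinM; congr EFin.
    by field.
  congr (_ * _)%E; first by rewrite /= ltr0_norm.
  congr (mu _); apply/seteqP; split => x /=; rewrite !in_itv/=.
    by rewrite ltr_ndivlMr// ler_ndivrMr// mulrC andbC.
  by rewrite ltr_ndivlMr// ler_ndivrMr// mulrC andbC.
Qed.

Lemma ge0_integral_scale (k : R) (h : mR -> \bar R) : k != 0 ->
  measurable_fun setT h -> (forall x, 0 <= h x)%E ->
  (\int[mu]_x h x = `|k|%:E * \int[mu]_x h (k * x)%R)%E.
Proof.
move=> k0 mh h0.
have mk : measurable_fun setT ((fun x => k * x) : mR -> mR) by exact: measurable_funM.
have k0' : 0 <= `|k| by [].
pose f : mR -> mR := *%R k.
pose nu : {measure set mR -> \bar R} := mscale (NngNum k0') (pushforward mu f).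
have -> : (\int[mu]_x h x = \int[nu mk]_x h x)%E.
  apply: eq_measure_integral => A mA _.
  by rewrite /mscale /= /pushforward (lebesgue_measure_scale k0 mA).
rewrite ge0_integral_mscale//= ge0_integral_pushforward//=.
Qed.

Lemma mpres_swap :
  mpres (mu \x mu)%E (fun x : mR * mR => (x.2, x.1)).
Proof.
have ms : measurable_fun setT (fun x : mR * mR => (x.2, x.1)).
  exact: measurable_fun_pair.
split=> // A mA; apply/esym.
pose f (x : mR * mR) := (x.2, x.1).
pose nu : {measure set (mR * mR) -> \bar R} := pushforward (mu \x mu)%E f.
suff : (mu \x mu)%E A = nu ms A by [].
apply: (@product_measure_unique _ _ _ _ _ mu mu (nu ms)) => // X Y mX mY.
rewrite /nu /pushforward /f /=.
transitivity ((mu \x mu)%E (Y `*` X)); last by rewrite product_measure1E// muleC.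
by congr ((mu \x mu)%E _); apply/seteqP; split => -[x y] /= [].
Qed.

(** Left translations of the Heisenberg group and the map behind R all act on (a, c) by a planar map
    and shift z by a function of (a, c). *)
Lemma mpres_heis (A : mR * mR -> mR * mR) (s : mR * mR -> mR) :
  mpres (mu \x mu)%E A -> measurable_fun setT s ->
  mpres (@haar R) (fun x => (A x.1, x.2 + s x.1)).
Proof.
move=> mA ms; apply: (@mpres_skew _ _ _ _ (mu \x mu)%E mu A (fun x z => z + s x)) => //.
  by move=> x; exact: mpres_shift.
by apply: measurable_funD => //; exact: measurableT_comp.
Qed.

Lemma mpres_opp2 : mpres (mu \x mu)%E (fun x : mR * mR => (- x.1, x.2) : mR * mR).
Proof.
apply: (@mpres_skew _ _ _ _ mu mu -%R (fun x z => z)) => //.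
  exact: mpres_opp.
exact: measurable_snd.
Qed.

Lemma mpres_shift2 (p q : R) :
  mpres (mu \x mu)%E (fun x : mR * mR => (x.1 + p, x.2 + q) : mR * mR).
Proof.
apply: (@mpres_skew _ _ _ _ mu mu (fun x => x + p) (fun x z => z + q)) => //.
- exact: mpres_shift.
- by move=> x; exact: mpres_shift.
- exact: measurable_funD.
Qed.

Definition heis_rot (x : heis R) : heis R :=
  let: (a, c, z) := x in (- c, a, z - a * c).

Lemma mpres_heis_rot : mpres (@haar R) heis_rot.
Proof.
have := @mpres_heis _ (fun x => - (x.1 * x.2))
  (mpres_comp mpres_opp2 mpres_swap).
rewrite (_ : (fun _ => _) = heis_rot); last by apply/funext => -[[a c] z].
apply; apply: measurableT_comp => //; exact: measurable_funM.
Qed.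

(** [heis_rot] does not map the cube to itself. This rotation about the centre of the unit square
    does, and it differs from [heis_rot] by the left translation by (1, 0, 0) and a shift of z. *)
Lemma mpres_cube_rot :
  mpres (@haar R) (fun x => (1 - x.1.2, x.1.1, x.2) : heis R).
Proof.
have := @mpres_heis _ (fun x => 0)
  (mpres_comp (mpres_shift2 1 0) (mpres_comp mpres_opp2 mpres_swap)).
rewrite (_ : (fun _ => _) = (fun x => (1 - x.1.2, x.1.1, x.2))).
  by apply; exact: measurable_cst.
by apply/funext => -[[a c] z] /=; rewrite !addr0 addrC.
Qed.

Lemma mpres_heis_mul (g : heis R) : mpres (@haar R) (heis_mul g).
Proof.
case: g => [[p q] r].
have := @mpres_heis _ (fun x => r + q * x.1) (mpres_shift2 p q).
rewrite (_ : (fun _ => _) = heis_mul (p, q, r)).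
  by apply; apply: measurable_funD => //; exact: measurable_funM.
apply/funext => -[[a c] z] /=; congr (_, _, _); ring.
Qed.

End MeasurePreserving.

(** * Unitarity on H_N *)

Section Automorphic.
Context {R : realType}.
Local Notation mu := (@lebesgue_measure R).
Local Notation mR := (measurableTypeR R).
Implicit Types F G : heis R -> R[i].

(** The representatives of elements of [HN] for which both conditions hold at every point, so that
    restrictions to null sets such as z = 0 are meaningful. *)
Definition automorphic (N : int) G : Prop :=
  [/\ cmeasurable G, left_HZ_invariant G &
      forall a c z, G (a, c, z) = e2pi (N%:~R * z) * G (a, c, 0)].

Lemma measurable_cube : measurable (@cube R).
Proof. by apply: measurableX; first exact: measurableX. Qed.

Lemma measurable_fun_floor : measurable_fun setT ((fun x => (Num.floor x)%:~R) : mR -> mR).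
Proof.
by apply: nondecreasing_measurable => // x y xy; rewrite ler_int; exact: le_floor.
Qed.

Lemma ae_all_int2 (P : int -> int -> heis R -> Prop) :
  (forall p q, {ae @haar R, forall x, P p q x}) ->
  {ae @haar R, forall x, forall p q, P p q x}.
Proof.
move=> aeP.
have : {ae @haar R, forall x, forall n : nat,
    if unpickle n is Some (p, q) then P p q x else True}.
  apply: ae_foralln => n; case: (unpickle n) => [[p q]|]; first exact: aeP.
  exact/aeW.
by apply: filterS => x Px p q; have := Px (pickle (p, q)); rewrite pickleK.
Qed.

Lemma floorDint (p : int) (a : R) : Num.floor (p%:~R + a) = p + Num.floor a.
Proof. by rewrite floorDzr ?intr_int// intrKfloor. Qed.

(* Reducing (a, c) modulo H(Z) to the unit square turns a representative for
   which the dependence on z only holds almost everywhere into an exact one. *)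
Lemma HN_automorphic (N : int) F : HN N F ->
  exists G, [/\ automorphic N G, F = G %[ae haar] &
    (sqnorm haar cube G < +oo)%E].
Proof.
move=> [mF [G [mG FG invG finG Gz]]].
pose fl (x : R) : R := (Num.floor x)%:~R.
(* Left translation by (- floor a, - floor c, 0) sends (a, c, z) to the reduced point with last
   coordinate z - floor(c) a. *)
pose H : heis R -> R[i] := fun x => let: (a, c, z) := x in
  e2pi (N%:~R * (z - fl c * a)) * G (a - fl a, c - fl c, 0).
have mfl := measurable_fun_floor.
have mH : cmeasurable H.
  rewrite (_ : H = fun x => e2pi (N%:~R * (x.2 - fl x.1.2 * x.1.1)) *
      G (x.1.1 - fl x.1.1, x.1.2 - fl x.1.2, 0)); last by apply/funext => -[[]].
  have m1 : measurable_fun setT (fun x : heis R => x.1.1) by exact: measurableT_comp.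
  have m2 : measurable_fun setT (fun x : heis R => x.1.2) by exact: measurableT_comp.
  have mf1 := measurableT_comp mfl m1; have mf2 := measurableT_comp mfl m2.
  apply: cmeasurableM.
    apply: cmeasurable_e2pi; apply: measurable_funM => //; apply: measurable_funB => //.
    exact: measurable_funM.
  apply: (cmeasurable_comp (f := fun x : heis R => (x.1.1 - fl x.1.1, x.1.2 - fl x.1.2, 0) : heis R)) => //.
  by do 2 (apply: measurable_fun_pair => //); exact: measurable_funB.
have aG : automorphic N H.
  split=> //.
    move=> p q r [[a c] z]; rewrite /H /heis_mul /fl !floorDint.
    rewrite -[in RHS](e2piDint _ (N * (r - q * p - Num.floor c * p))).
    congr (e2pi _ * G (_, _, _)); rewrite !(rmorphM, rmorphB, rmorphD) /=; ring.
  move=> a c z; rewrite /H mulrA; congr (_ * _); rewrite -e2piD; congr e2pi; ring.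
have FH : F = H %[ae haar].
  (* The translation that reduces a point depends on the point, so the dependence of [G] on z is
     needed at all integral translates simultaneously, off a single null set. *)
  have : {ae @haar R, forall x, forall p q : int,
    G (heis_mul (p%:~R, q%:~R, 0) x) = e2pi (N%:~R * (heis_mul (p%:~R, q%:~R, 0) x).2) *
    G ((heis_mul (p%:~R, q%:~R, 0) x).1, 0)}.
    apply: ae_all_int2 => p q.
    apply: (mpres_ae (mpres_heis_mul _)
      (P := fun x => G x = e2pi (N%:~R * x.2) * G (x.1, 0))).
    by move: Gz; apply: filterS => -[[a c] z] /(_ I).
  move: FG; apply: filterS2 => -[[a c] z] FG' HG _.
  rewrite FG'// -(invG (- Num.floor a) (- Num.floor c) 0) HG /H /=.
  congr (e2pi (_ * _) * G (_, _, _)); rewrite /fl ?rmorphN /=; ring.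
exists H; split=> //.
rewrite sqnormE (@ae_eq_integral _ _ _ haar cube (fun x => (cnorm2 (G x))%:E)).
- by rewrite -sqnormE.
- exact: measurable_cube.
- exact: measurable_funTS (measurable_cnorm2E mH).
- exact: measurable_funTS (measurable_cnorm2E mG).
- by move: FH FG; apply: filterS2 => x -> // ->.
Qed.

Lemma HN_of_automorphic (N : int) F G : cmeasurable F -> automorphic N G ->
  F = G %[ae haar] -> (sqnorm haar cube G < +oo)%E -> HN N F.
Proof.
move=> mF [mG iG zG] FG finG; split=> //; exists G; split=> //.
by apply/aeW => -[[a c] z] _.
Qed.

Lemma sqnorm_ae d (T : measurableType d) (m : {measure set T -> \bar R}) D
    (F G : T -> R[i]) : measurable D ->
  cmeasurable F -> cmeasurable G -> F = G %[ae m] ->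
  sqnorm m D F = sqnorm m D G.
Proof.
move=> mD mF mG FG; rewrite !sqnormE; apply: ae_eq_integral => //.
- exact: measurable_funTS (measurable_cnorm2E mF).
- exact: measurable_funTS (measurable_cnorm2E mG).
- by move: FG; apply: filterS => x ->.
Qed.

Lemma heis_fourierE F x : heis_fourier F x = F (heis_rot x).
Proof. by move: x => [[a c] z]. Qed.

Lemma heis_fourier_ae F G : F = G %[ae haar] ->
  heis_fourier F = heis_fourier G %[ae haar].
Proof.
move=> FG.
have := mpres_ae (P := fun x => F x = G x) mpres_heis_rot.
move=> H; have {H} := H _; move: FG => /(filterS (fun x (h : setT x -> F x = G x) => h I)) FG /(_ FG).
by apply: filterS => x h _; rewrite !heis_fourierE.
Qed.

Lemma cmeasurable_heis_fourier F : cmeasurable F -> cmeasurable (heis_fourier F).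
Proof.
move=> mF; rewrite (_ : heis_fourier F = fun x => F (heis_rot x)).
  by apply: cmeasurable_comp mF; exact: (proj1 mpres_heis_rot).
by apply/funext => x; exact: heis_fourierE.
Qed.

Lemma automorphic_heis_fourier N G : automorphic N G ->
  automorphic N (heis_fourier G).
Proof.
move=> [mG iG zG]; split.
- exact: cmeasurable_heis_fourier.
- move=> p q r [[a c] z] /=.
  rewrite -[RHS](iG (- q) p (r - p * q)) /=; congr (G (_, _, _));
    rewrite !(rmorphN, rmorphB, rmorphM) /=; ring.
- move=> a c z /=; rewrite zG [in RHS]zG mulrA -e2piD; congr (e2pi _ * _); ring.
Qed.

Lemma cube_rot_cube :
  (fun x => (1 - x.1.2, x.1.1, x.2) : heis R) @^-1` cube = @cube R.
Proof.
apply/seteqP; split => -[[a c] z] [[/= ]]; rewrite !in_itv/=; move=> /andP[? ?] /andP[? ?] /andP[? ?];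
  (split; [split|]); rewrite /= in_itv /=; apply/andP; split; lra.
Qed.

(* Rotation moves the unit square to a translate of itself, and F conj(G)
   descends to a function on the torus. *)
Lemma automorphic_rot N F G a c z : automorphic N F -> automorphic N G ->
  heis_fourier F (a, c, z) * conjc (heis_fourier G (a, c, z)) =
  F (1 - c, a, z) * conjc (G (1 - c, a, z)).
Proof.
have E H : automorphic N H -> heis_fourier H (a, c, z) =
    e2pi (- (N%:~R * (a * c))) * H (1 - c, a, z).
  move=> [_ iH zH] /=; rewrite -(iH 1 0 0) /= zH [in RHS]zH mulrA -e2piD.
  rewrite mulr0z add0r mul0r addr0 mulr1z.
  rewrite add0r; congr (e2pi _ * _); ring.
move=> aF aG; rewrite (E F aF) (E G aG). rewrite conjcM -e2piN opprK.
by rewrite mulrACA e2piNK mul1r.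
Qed.

Lemma integral_cube_rot (h : heis R -> \bar R) : measurable_fun setT h ->
  (\int[haar]_(x in cube) h (1 - x.1.2, x.1.1, x.2)%R = \int[haar]_(x in cube) h x)%E.
Proof.
move=> mh; rewrite -(mpres_integral mpres_cube_rot measurable_cube mh).
by rewrite cube_rot_cube.
Qed.

Lemma sqnorm_heis_fourier N G : automorphic N G ->
  sqnorm haar cube (heis_fourier G) = sqnorm haar cube G.
Proof.
move=> aG; have [mG _ _] := aG.
rewrite !sqnormE -(integral_cube_rot (measurable_cnorm2E mG)).
apply: eq_integral => -[[a c] z] _; congr EFin.
have := automorphic_rot a c z aG aG; rewrite !mulcJ.
by move=> /(congr1 (@complex.Re R)) /= ->.
Qed.

Lemma inner_ae F G F' G' : cmeasurable F -> cmeasurable G -> cmeasurable F' ->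
  cmeasurable G' -> F = F' %[ae haar] -> G = G' %[ae haar] ->
  inner F G = inner F' G'.
Proof.
move=> mF mG mF' mG' FF GG; rewrite /inner /cintegral /Rintegral.
have [m1 m2] := cmeasurableM mF (cmeasurableC mG).
have [m1' m2'] := cmeasurableM mF' (cmeasurableC mG').
congr (fine _ +i* fine _); apply: ae_eq_integral; rewrite ?measurable_EFinP;
  try exact: measurable_cube; try exact: measurable_funTS.
- by move: FF GG; apply: filterS2 => x -> // ->.
- by move: FF GG; apply: filterS2 => x -> // ->.
Qed.

Lemma inner_heis_fourier N F G : automorphic N F -> automorphic N G ->
  inner (heis_fourier F) (heis_fourier G) = inner F G.
Proof.
move=> aF aG; rewrite /inner /cintegral /Rintegral.
have [mF _ _] := aF; have [mG _ _] := aG.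
have [m1 m2] := cmeasurableM mF (cmeasurableC mG).
congr (fine _ +i* fine _).
  rewrite -(integral_cube_rot (h := fun x => (complex.Re (F x * conjc (G x)))%:E));
    last exact/measurable_EFinP.
  by apply: eq_integral => -[[a c] z] _; rewrite (automorphic_rot a c z aF aG).
rewrite -(integral_cube_rot (h := fun x => (complex.Im (F x * conjc (G x)))%:E));
  last exact/measurable_EFinP.
by apply: eq_integral => -[[a c] z] _; rewrite (automorphic_rot a c z aF aG).
Qed.

Lemma HN_heis_fourier N F : HN N F -> HN N (heis_fourier F).
Proof.
move=> hF; have [G [aG FG finG]] := HN_automorphic hF.
have [mF _] := hF.
apply: (HN_of_automorphic _ (automorphic_heis_fourier aG)).
- exact: cmeasurable_heis_fourier.
- exact: heis_fourier_ae.
- by rewrite (sqnorm_heis_fourier aG).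
Qed.

Lemma heis_fourier4 F :
  heis_fourier (heis_fourier (heis_fourier (heis_fourier F))) = F.
Proof.
apply/funext => -[[a c] z] /=; congr (F (_, _, _)); ring.
Qed.

Lemma unitary_heis_fourier N : unitary_on (HN (R := R) N) heis_fourier.
Proof.
split.
- by move=> F G _ _; exact: heis_fourier_ae.
- by move=> k F G _ _; apply/aeW => -[[a c] z] _.
- by move=> F; exact: HN_heis_fourier.
- move=> G hG; exists (heis_fourier (heis_fourier (heis_fourier G))).
    by do 3 apply: HN_heis_fourier.
  by rewrite heis_fourier4; exact/aeW.
- move=> F G hF hG.
  have [mF _] := hF; have [mG _] := hG.
  have [F' [aF FF _]] := HN_automorphic hF.
  have [G' [aG GG _]] := HN_automorphic hG.
  have [mF' _ _] := aF; have [mG' _ _] := aG.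
  rewrite (@inner_ae F G F' G')// -(inner_heis_fourier aF aG).
  by apply: inner_ae; try exact: cmeasurable_heis_fourier; exact: heis_fourier_ae.
Qed.

End Automorphic.

(** * Sums over Z *)

Section SumsOverZ.
Context {R : realType}.
Implicit Types (u v : int -> R[i]) (s t : nat -> R[i]).

Local Notation Re := complex.Re.
Local Notation Im := complex.Im.

Lemma cmod_ge0 (z : R[i]) : 0 <= cmodulus z.
Proof. by rewrite /cmodulus; case: z => a b /=; rewrite sqrtr_ge0. Qed.

Lemma cmodM (z w : R[i]) : cmodulus (z * w) = cmodulus z * cmodulus w.
Proof. exact: ComplexField.Normc.normcM. Qed.

Lemma cmodD_le (z w : R[i]) : cmodulus (z + w) <= cmodulus z + cmodulus w.
Proof. exact: le_normcD. Qed.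

Lemma cmod_sqrt (z : R[i]) : cmodulus z = Num.sqrt (cnorm2 z).
Proof. by case: z. Qed.

Lemma cmod0 : cmodulus (0 : R[i]) = 0.
Proof. by rewrite cmod_sqrt cnorm2_0 sqrtr0. Qed.

Lemma cmod_e2pi (x : R) : cmodulus (e2pi x) = 1.
Proof. by rewrite cmod_sqrt cnorm2_e2pi sqrtr1. Qed.

Lemma Re_le_cmod (z : R[i]) : `|Re z| <= cmodulus z.
Proof. by rewrite cmod_sqrt -sqrtr_sqr ler_sqrt ?Re_sqr_le// cnorm2_ge0. Qed.

Lemma Im_le_cmod (z : R[i]) : `|Im z| <= cmodulus z.
Proof. by rewrite cmod_sqrt -sqrtr_sqr ler_sqrt ?Im_sqr_le// cnorm2_ge0. Qed.

Lemma cmod_le (z : R[i]) : cmodulus z <= `|Re z| + `|Im z|.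
Proof.
rewrite -(ler_pXn2r (n := 2))// ?nnegrE ?addr_ge0 ?cmod_ge0//.
rewrite cmodulus2 /cnorm2 sqrrD !real_normK ?num_real//.
by rewrite -addrA lerD2l lerDr mulrn_wge0// mulr_ge0.
Qed.

Lemma cmod_sum_le I (r : seq I) (P : pred I) (F : I -> R[i]) :
  cmodulus (\sum_(i <- r | P i) F i) <= \sum_(i <- r | P i) cmodulus (F i).
Proof.
elim: r => [|i r ih]; first by rewrite !big_nil cmod0.
rewrite !big_cons; case: ifP => // _.
by apply: (le_trans (cmodD_le _ _)); rewrite lerD2l.
Qed.

(** Convergence by components, in keeping with [csumZ], which is defined through real and imaginary
    parts. *)
Definition ccvg s (l : R[i]) : Prop :=
  (fun k => Re (s k)) @ \oo --> Re l /\ (fun k => Im (s k)) @ \oo --> Im l.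

Lemma ccvg_unique s l l' : ccvg s l -> ccvg s l' -> l = l'.
Proof.
by move=> [a b] [a' b']; apply: complex_eqP; [apply: cvg_unique a a'|apply: cvg_unique b b'].
Qed.

Lemma ccvg_ext s t l : s =1 t -> ccvg s l -> ccvg t l.
Proof. by move=> /funext ->. Qed.

Lemma ccvg_cst l : ccvg (fun=> l) l.
Proof. by split; exact: cvg_cst. Qed.

Lemma ccvgD s t l m : ccvg s l -> ccvg t m -> ccvg (fun k => s k + t k) (l + m).
Proof.
move=> [a b] [a' b']; split.
  by under eq_fun do rewrite cReD; rewrite cReD; exact: cvgD.
by under eq_fun do rewrite cImD; rewrite cImD; exact: cvgD.
Qed.

Lemma ccvgM s t l m : ccvg s l -> ccvg t m -> ccvg (fun k => s k * t k) (l * m).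
Proof.
move=> [a b] [a' b']; split.
  rewrite cReM (_ : (fun k => _) = (fun k => Re (s k) * Re (t k) - Im (s k) * Im (t k))).
    by apply: cvgB; apply: cvgM.
  by apply/funext => k; rewrite cReM.
rewrite cImM (_ : (fun k => _) = (fun k => Re (s k) * Im (t k) + Im (s k) * Re (t k))).
  by apply: cvgD; apply: cvgM.
by apply/funext => k; rewrite cImM.
Qed.

Lemma ccvgZ (c : R[i]) s l : ccvg s l -> ccvg (fun k => c * s k) (c * l).
Proof. by apply: ccvgM; exact: ccvg_cst. Qed.

Lemma ccvgB s t l m : ccvg s l -> ccvg t m -> ccvg (fun k => s k - t k) (l - m).
Proof.
move=> sl tm; apply: ccvgD => //.
by have := ccvgZ (-1) tm; rewrite mulN1r; apply: ccvg_ext => k; rewrite mulN1r.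
Qed.

Lemma ccvg_sum I (r : seq I) (P : pred I) (f : I -> nat -> R[i]) (l : I -> R[i]) :
  (forall i, P i -> ccvg (f i) (l i)) ->
  ccvg (fun k => \sum_(i <- r | P i) f i k) (\sum_(i <- r | P i) l i).
Proof.
move=> fl; elim: r => [|i r ih].
  by rewrite big_nil; apply: (ccvg_ext _ (ccvg_cst 0)) => k; rewrite big_nil.
rewrite big_cons; case: ifP => Pi.
  apply: (ccvg_ext _ (ccvgD (fl i Pi) ih)) => k; by rewrite big_cons Pi.
by apply: (ccvg_ext _ ih) => k; rewrite big_cons Pi.
Qed.

Lemma ccvg_subseq s l (f : nat -> nat) : (forall k, (k <= f k)%N) ->
  ccvg s l -> ccvg (s \o f) l.
Proof.
move=> kf [a b].
have foo : f @ \oo --> \oo.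
  move=> A [m _ mA]; exists m => // k /= mk; apply: mA => /=.
  exact: leq_trans mk (kf k).
by split; [apply: (cvg_comp _ _ foo a)|apply: (cvg_comp _ _ foo b)].
Qed.

Definition psumZ u (K : nat) : R[i] :=
  \sum_(0 <= k < K) u k%:Z + \sum_(0 <= k < K) u (- k.+1%:Z).

Lemma psumZ0 u : psumZ u 0 = 0.
Proof. by rewrite /psumZ !big_nil addr0. Qed.

Lemma psumZS u K : psumZ u K.+1 = psumZ u K + (u K%:Z + u (- K.+1%:Z)).
Proof. by rewrite /psumZ !big_nat_recr//= addrACA. Qed.

Lemma csumZ_ccvg u l : ccvg (psumZ u) l -> csumZ u = l.
Proof.
move=> [a b]; apply: complex_eqP; rewrite /csumZ /rsumZ /=.
  by apply/cvg_lim => //; move: a; under eq_fun do rewrite cReD !Re_sum.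
by apply/cvg_lim => //; move: b; under eq_fun do rewrite cImD !Im_sum.
Qed.

(** Quadratic decay with an explicit constant. The constant bounds all partial sums and the total,
    which gives the uniform estimates for dominated convergence and for Lipschitz continuity in a
    parameter. *)
Definition qbound (B : R) u : Prop :=
  forall n : int, cmodulus (u n) * (1 + n%:~R ^+ 2) <= B.

Definition qdecay u : Prop := exists B, qbound B u.

(** The right-hand side telescopes with increments 4 / ((k + 1) (k + 2)), and these dominate 1 / (1
    + k^2) because 4 (1 + k^2) - (k + 1) (k + 2) = 3 k^2 - 3 k + 2 is positive. *)
Lemma sum_inv_sqr_le (K : nat) :
  \sum_(0 <= k < K) (1 + (k%:R : R) ^+ 2)^-1 <= 4 - 4 / K.+1%:R.
Proof.
elim: K => [|K ih]; first by rewrite big_nil divr1 subrr.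
rewrite big_nat_recr//=; apply: (le_trans (lerD ih (lexx _))).
set k : R := K%:R; have k0 : 0 <= k by [].
rewrite -(natr1 K.+1) -(natr1 K) -/k -subr_ge0.
have -> : 4 - 4 / (k + 1 + 1) - (4 - 4 / (k + 1) + (1 + k ^+ 2)^-1) =
    (3 * k ^+ 2 - 3 * k + 2) / ((k + 1) * (k + 1 + 1) * (1 + k ^+ 2)).
  by field; rewrite !gt_eqF// ?expr2; nra.
apply: divr_ge0; first by rewrite expr2; nra.
by rewrite !mulr_ge0// ?addr_ge0// sqr_ge0.
Qed.

Lemma qbound_ge0 B u : qbound B u -> 0 <= B.
Proof. by move=> /(_ 0); apply: le_trans; rewrite mulr_ge0 ?cmod_ge0// addr_ge0// sqr_ge0. Qed.

Lemma qbound_term B u n : qbound B u -> cmodulus (u n) <= B * (1 + n%:~R ^+ 2)^-1.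
Proof. by move=> uB; rewrite ler_pdivlMr ?uB// ltr_pwDl// sqr_ge0. Qed.

Lemma qbound_sum B u K : qbound B u ->
  \sum_(0 <= k < K) (cmodulus (u k%:Z) + cmodulus (u (- k.+1%:Z))) <= 8 * B.
Proof.
move=> uB; have B0 := qbound_ge0 uB.
(* The terms at k and at -(k + 1) are both compared with B / (1 + k^2); two series, each of sum at
   most 4 B, give the constant 8. *)
apply: (@le_trans _ _ (\sum_(0 <= k < K) (2 * B) * (1 + (k%:R : R) ^+ 2)^-1)).
  apply: ler_sum => k _; rewrite -mulrA mulrDl mul1r.
  apply: lerD; first exact: (qbound_term k%:Z uB).
  apply: (le_trans (qbound_term (- k.+1%:Z) uB)); rewrite ler_wpM2l//.
  rewrite lef_pV2 ?posrE ?ltr_pwDl ?sqr_ge0// lerD2l rmorphN sqrrN /=.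
  by rewrite -!pmulrn ler_pXn2r ?nnegrE// ler_nat.
rewrite -mulr_sumr [8](_ : _ = 2 * 4); last by rewrite -natrM.
rewrite -mulrA -mulrA ler_pM2l// [4 * B]mulrC ler_wpM2l//.
by apply: (le_trans (sum_inv_sqr_le K)); rewrite gerBl divr_ge0.
Qed.

Lemma psumZE u K : psumZ u K = \sum_(0 <= k < K) (u k%:Z + u (- k.+1%:Z)).
Proof. by rewrite /psumZ big_split. Qed.

Lemma psumZ_bound B u K : qbound B u -> cmodulus (psumZ u K) <= 8 * B.
Proof.
move=> uB; apply: le_trans (qbound_sum K uB); rewrite psumZE.
apply: (le_trans (cmod_sum_le _ _ _)); apply: ler_sum => k _; exact: cmodD_le.
Qed.

Lemma bounded_sum_cvg (a : nat -> R) (C : R) :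
  (forall K, \sum_(0 <= k < K) `|a k| <= C) -> cvgn (series a).
Proof.
move=> aC; apply: normed_cvg.
apply: (nondecreasing_is_cvgn (u_ := fun K => \sum_(0 <= k < K) `|a k|)).
  by apply/nondecreasing_seqP => n; rewrite big_nat_recr//= lerDl.
by exists C => _ [n _ <-]; exact: aC.
Qed.

Lemma qdecay_ccvg u : qdecay u -> ccvg (psumZ u) (csumZ u).
Proof.
move=> [B uB].
have H (f : R[i] -> R) : (forall z w, f (z + w) = f z + f w) -> f 0 = 0 ->
    (forall z, `|f z| <= cmodulus z) -> cvgn (fun K => f (psumZ u K)).
  move=> fD f0 fle.
  have -> : (fun K => f (psumZ u K)) = series (fun k => f (u k%:Z + u (- k.+1%:Z))).
    by apply/funext => K; rewrite psumZE /series /= (big_morph f fD f0).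
  apply: (@bounded_sum_cvg _ (8 * B)) => K.
  apply: le_trans (qbound_sum K uB); apply: ler_sum => k _.
  by apply: (le_trans (fle _)); exact: cmodD_le.
have /cvg_ex[a ua] := H _ cReD erefl Re_le_cmod.
have /cvg_ex[b ub] := H _ cImD erefl Im_le_cmod.
have uab : ccvg (psumZ u) (a +i* b) by split.
by rewrite (csumZ_ccvg uab).
Qed.

Lemma ccvg_bound s l C : ccvg s l -> (forall k, cmodulus (s k) <= C) ->
  `|Re l| <= C /\ `|Im l| <= C.
Proof.
move=> [a b] sC; split.
- rewrite -(cvg_lim _ (cvg_norm a))//; apply: limr_le.
    by apply: is_cvg_norm; apply/cvg_ex; eexists; exact: a.
  by apply: nearW => k; exact: le_trans (Re_le_cmod _) (sC k).
- rewrite -(cvg_lim _ (cvg_norm b))//; apply: limr_le.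
    by apply: is_cvg_norm; apply/cvg_ex; eexists; exact: b.
  by apply: nearW => k; exact: le_trans (Im_le_cmod _) (sC k).
Qed.

(** The real and the imaginary part are each at most 8 B. *)
Lemma csumZ_bound B u : qbound B u -> cmodulus (csumZ u) <= 16 * B.
Proof.
move=> uB; have [a b] := ccvg_bound (qdecay_ccvg (ex_intro _ B uB)) (fun k => psumZ_bound k uB).
apply: (le_trans (cmod_le _)); apply: (le_trans (lerD a b)); lra.
Qed.

Lemma qbound_mul B C u (v : int -> R[i]) : qbound B u ->
  (forall n, cmodulus (v n) <= C) -> qbound (C * B) (fun n => v n * u n).
Proof.
move=> uB vC n; rewrite cmodM -mulrA; apply: ler_pM => //.
- exact: cmod_ge0.
- by rewrite mulr_ge0 ?cmod_ge0// addr_ge0// sqr_ge0.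
Qed.

Lemma qdecay_mul u (v : int -> R[i]) C : qdecay u ->
  (forall n, cmodulus (v n) <= C) -> qdecay (fun n => v n * u n).
Proof. by move=> [B uB] vC; exists (C * B); exact: qbound_mul. Qed.

Lemma qdecayZ (k : R[i]) u : qdecay u -> qdecay (fun n => k * u n).
Proof. by move=> du; apply: (qdecay_mul (v := fun=> k) (C := cmodulus k)). Qed.

Lemma qdecayD u v : qdecay u -> qdecay v -> qdecay (fun n => u n + v n).
Proof.
move=> [B uB] [C vC]; exists (B + C) => n.
apply: le_trans (lerD (uB n) (vC n)); rewrite -mulrDl ler_wpM2r ?cmodD_le//.
by rewrite addr_ge0// sqr_ge0.
Qed.

Lemma csumZZ (k : R[i]) u : qdecay u -> csumZ (fun n => k * u n) = k * csumZ u.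
Proof.
move=> du; apply: csumZ_ccvg; apply: ccvg_ext (ccvgZ k (qdecay_ccvg du)) => K.
by rewrite !psumZE mulr_sumr; apply: eq_bigr => i _; rewrite mulrDr.
Qed.

Lemma csumZD u v : qdecay u -> qdecay v ->
  csumZ (fun n => u n + v n) = csumZ u + csumZ v.
Proof.
move=> du dv; apply: csumZ_ccvg.
apply: ccvg_ext (ccvgD (qdecay_ccvg du) (qdecay_ccvg dv)) => K.
by rewrite !psumZE -big_split; apply: eq_bigr => i _; rewrite addrACA.
Qed.

Lemma csumZB u v : qdecay u -> qdecay v ->
  csumZ (fun n => u n - v n) = csumZ u - csumZ v.
Proof.
move=> du dv; have := csumZD du (qdecayZ (-1) dv); rewrite csumZZ// mulN1r => <-.
by congr csumZ; apply/funext => n; rewrite mulN1r.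
Qed.

Lemma qdecay_sum I (r : seq I) (u : I -> int -> R[i]) : (forall i, qdecay (u i)) ->
  qdecay (fun n => \sum_(i <- r) u i n).
Proof.
move=> du; elim: r => [|i r ih].
  by exists 0 => n; rewrite big_nil cmod0 mul0r.
rewrite (_ : (fun n => _) = fun n => u i n + \sum_(j <- r) u j n).
  exact: qdecayD.
by apply/funext => n; rewrite big_cons.
Qed.

Lemma csumZ0 : csumZ (fun=> 0 : R[i]) = 0.
Proof.
apply: csumZ_ccvg; apply: ccvg_ext (ccvg_cst 0) => K.
by rewrite psumZE big1// => i _; rewrite addr0.
Qed.

Lemma csumZ_sum I (r : seq I) (u : I -> int -> R[i]) : (forall i, qdecay (u i)) ->
  csumZ (fun n => \sum_(i <- r) u i n) = \sum_(i <- r) csumZ (u i).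
Proof.
move=> du; elim: r => [|i r ih].
  by rewrite big_nil; apply: etrans csumZ0; congr csumZ; apply/funext => n; rewrite big_nil.
rewrite big_cons -ih -csumZD//; last exact: qdecay_sum.
by congr csumZ; apply/funext => n; rewrite big_cons.
Qed.

Lemma cvg_pinv (B : R) : (fun K : nat => B * (1 + (K%:R : R) ^+ 2)^-1) @ \oo --> (0 : R).
Proof.
rewrite -[X in _ --> X](mulr0 B); apply: cvgMl_tmp.
apply/gtr0_cvgV0; first by apply: nearW => K; rewrite ltr_pwDl// sqr_ge0.
apply/cvgryPge => A; near=> K.
have KA : A <= K%:R by near: K; exact: nbhs_infty_ger.
have K1 : (1 : R) <= K%:R by rewrite ler1n; near: K; exact: nbhs_infty_gt.
by rewrite expr2; nra.
Unshelve. all: by end_near. Qed.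

Lemma cmod_ccvg0 s (a : nat -> R) : (forall k, cmodulus (s k) <= a k) ->
  a @ \oo --> (0 : R) -> ccvg s 0.
Proof.
move=> sa a0; split.
- apply: norm_cvg0; apply: (@squeeze_cvgr _ _ _ _ (cst 0) a) => //; last exact: cvg_cst.
  by apply: nearW => k; rewrite normr_ge0 /= (le_trans (Re_le_cmod _)).
- apply: norm_cvg0; apply: (@squeeze_cvgr _ _ _ _ (cst 0) a) => //; last exact: cvg_cst.
  by apply: nearW => k; rewrite normr_ge0 /= (le_trans (Im_le_cmod _)).
Qed.

Lemma qdecay_ccvg0 u (f : nat -> int) : qdecay u -> (forall K, (f K)%:~R ^+ 2 = K%:R ^+ 2 :> R) ->
  ccvg (fun K => u (f K)) 0.
Proof.
move=> [B uB] fK; apply: (cmod_ccvg0 _ (cvg_pinv B)) => K.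
by rewrite -fK; exact: qbound_term.
Qed.

Lemma qdecay_shift (p : int) u : qdecay u -> qdecay (fun n => u (n + p)).
Proof.
move=> [B uB]; have B0 := qbound_ge0 uB.
exists (B * (2 + 2 * p%:~R ^+ 2)) => n.
apply: (@le_trans _ _ (cmodulus (u (n + p)) * ((1 + (n + p)%:~R ^+ 2) * (2 + 2 * p%:~R ^+ 2)))).
  apply: ler_wpM2l; first exact: cmod_ge0.
  rewrite rmorphD /=; set x : R := n%:~R; set y : R := p%:~R.
  have := sqr_ge0 (x + 2 * y); have := sqr_ge0 (y * (x + y)); rewrite !expr2; nra.
rewrite mulrA; apply: ler_wpM2r; last exact: uB.
by rewrite addr_ge0// mulr_ge0// sqr_ge0.
Qed.

(** The partial sums run over the asymmetric window -K <= n < K. Reflecting it, like shifting it by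
    one, exchanges the end term u (- K) for u K, and both tend to 0. *)
Lemma csumZ_opp u : qdecay u -> csumZ (fun n => u (- n)) = csumZ u.
Proof.
move=> du; apply: csumZ_ccvg.
have c1 := qdecay_ccvg0 (f := fun K => K%:Z) du (fun K => erefl).
have c2 := qdecay_ccvg0 (f := fun K => - K%:Z) du (fun K => ltac:(by rewrite rmorphN sqrrN)).
have := ccvgD (qdecay_ccvg du) (ccvgB c1 c2); rewrite subr0 addr0; apply: ccvg_ext.
elim=> [|K ih]; first by rewrite !psumZ0 oppr0 subrr addr0.
rewrite !psumZS -ih opprK; ring.
Qed.

Lemma csumZ_shift1 u : qdecay u -> csumZ (fun n => u (n + 1)) = csumZ u.
Proof.
move=> du; apply: csumZ_ccvg.
have c1 := qdecay_ccvg0 (f := fun K => K%:Z) du (fun K => erefl).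
have c2 := qdecay_ccvg0 (f := fun K => - K%:Z) du (fun K => ltac:(by rewrite rmorphN sqrrN)).
have := ccvgD (qdecay_ccvg du) (ccvgB c1 c2); rewrite subr0 addr0; apply: ccvg_ext.
elim=> [|K ih]; first by rewrite !psumZ0 oppr0 subrr addr0.
rewrite !psumZS -ih.
have -> : K%:Z + 1 = K.+1%:Z by rewrite -addn1 PoszD.
have -> : - K.+1%:Z + 1 = - K%:Z by rewrite -addn1 PoszD opprD addrNK.
ring.
Qed.

Lemma csumZ_shift (p : int) u : qdecay u -> csumZ (fun n => u (n + p)) = csumZ u.
Proof.
have H (n : nat) v : qdecay v -> csumZ (fun k => v (k + n%:Z)) = csumZ v.
  elim: n v => [|n ih] v dv; first by congr csumZ; apply/funext => k; rewrite addr0.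
  rewrite -[RHS](csumZ_shift1 dv) -(ih _ (qdecay_shift 1 dv)); congr csumZ.
  by apply/funext => k; rewrite -addrA -addn1 PoszD.
move=> du; case: p => n; first exact: H.
rewrite NegzE -(H n.+1 _ (qdecay_shift (- n.+1%:Z) du)); congr csumZ.
by apply/funext => k; rewrite addrK.
Qed.

Lemma psumZ_add u (a b : nat) : psumZ u (a + b)%N =
  psumZ u a + \sum_(j < b) (u (a + j)%N%:Z + u (- (a + j)%N.+1%:Z)).
Proof.
elim: b => [|b ih]; first by rewrite addn0 big_ord0 addr0.
by rewrite addnS psumZS ih big_ord_recr /= !addrA.
Qed.

(** The window -M K <= n < M K is exactly the union of the windows -K <= m < K for the classes j + M
    m with 0 <= j < M. *)
Lemma psumZ_residue u (M K : nat) :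
  psumZ u (M * K)%N = \sum_(j < M) psumZ (fun m => u (j%:Z + M%:Z * m)) K.
Proof.
elim: K => [|K ih]; first by rewrite muln0 psumZ0 big1// => j _; rewrite psumZ0.
under eq_bigr do rewrite psumZS.
rewrite big_split /= -ih mulnS addnC psumZ_add !big_split /=; congr (_ + (_ + _)).
  by apply: eq_bigr => j _; congr u; rewrite PoszD PoszM addrC.
(* Negative indices are listed downwards, so they run through the residues in reverse order. *)
rewrite (reindex_inj rev_ord_inj) /=; apply: eq_bigr => j _; congr u.
rewrite mulrN -PoszM mulnS.
have -> : (M * K + (M - j.+1))%N.+1 = (M + M * K - j)%N by have := ltn_ord j; lia.
by rewrite -subzn ?opprB//; have := ltn_ord j; lia.
Qed.

Lemma qdecay_residue u (M j : int) : M != 0 -> qdecay u ->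
  qdecay (fun m => u (j + M * m)).
Proof.
move=> M0 du; have [B uB] := qdecay_shift j du; exists B => m.
rewrite addrC; apply: le_trans (uB (M * m)); rewrite ler_wpM2l ?cmod_ge0// lerD2l.
rewrite -!rmorphXn ler_int /=.
have : (1 <= M ^+ 2)%R by rewrite -gtz0_ge1 exprn_even_gt0.
rewrite exprMn => M1; apply: ler_peMl => //; exact: sqr_ge0.
Qed.

Lemma csumZ_residue u (N : int) : N != 0 -> qdecay u ->
  csumZ u = \sum_(j < `|N|%N) csumZ (fun m => u (j%:Z + N * m)).
Proof.
move=> N0 du; set M := `|N|%N.
have M0 : (0 < M)%N by rewrite absz_gt0.
have MZ0 : M%:Z != 0 by rewrite gt_eqF.
have -> : \sum_(j < M) csumZ (fun m => u (j%:Z + N * m)) =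
    \sum_(j < M) csumZ (fun m => u (j%:Z + M%:Z * m)).
  apply: eq_bigr => j _.
  (* For N < 0 the substitution of - m for m turns the step N into |N|. *)
  have [Np|Nn] := leP 0 N; first by rewrite /M gez0_abs.
  rewrite -csumZ_opp; last exact: qdecay_residue.
  by congr csumZ; apply/funext => m; rewrite /M ltz0_abs// mulrN mulNr.
have h1 := ccvg_subseq (f := fun K => (M * K)%N) (fun K => leq_pmull K M0) (qdecay_ccvg du).
apply: (ccvg_unique h1).
have h2 := ccvg_sum (index_enum 'I_M) (P := xpredT)
  (fun j _ => qdecay_ccvg (qdecay_residue j%:Z MZ0 du)).
by apply: ccvg_ext h2 => K; rewrite /= psumZ_residue.
Qed.

End SumsOverZ.

(** * Integration of complex-valued functions *)

Section ComplexIntegral.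
Context {R : realType} d (T : measurableType d).
Variables (mu : {measure set T -> \bar R}) (D : set T).
Hypothesis mD : measurable D.
Implicit Types F G : T -> R[i].

Local Notation Re := complex.Re.
Local Notation Im := complex.Im.

Definition cintegrable F : Prop :=
  mu.-integrable D (EFin \o (fun x => Re (F x))) /\
  mu.-integrable D (EFin \o (fun x => Im (F x))).

Lemma eq_cintegral F G : {in D, F =1 G} -> cintegral mu D F = cintegral mu D G.
Proof.
by move=> FG; rewrite /cintegral; congr (_ +i* _); apply: eq_Rintegral => x xD;
  rewrite FG.
Qed.

Lemma eq_cintegrable F G : {in D, F =1 G} -> cintegrable F -> cintegrable G.
Proof.
by move=> FG [a b]; split; [apply: eq_integrable a|apply: eq_integrable b] => // x xD;
  rewrite /= FG.
Qed.

Lemma cintegrableD F G : cintegrable F -> cintegrable G ->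
  cintegrable (fun x => F x + G x).
Proof.
move=> [a b] [a' b']; split.
  by apply: eq_integrable (integrableD mD a a') => // x _; rewrite /= cReD EFinD.
by apply: eq_integrable (integrableD mD b b') => // x _; rewrite /= cImD EFinD.
Qed.

Lemma cintegrableZ (k : R[i]) F : cintegrable F -> cintegrable (fun x => k * F x).
Proof.
move=> [a b]; split.
  apply: eq_integrable (integrableB mD (integrableZl mD (Re k) a) (integrableZl mD (Im k) b)) => // x _.
  by rewrite /= cReM EFinB !EFinM.
apply: eq_integrable (integrableD mD (integrableZl mD (Re k) b) (integrableZl mD (Im k) a)) => // x _.
by rewrite /= cImM EFinD !EFinM.
Qed.

Lemma cintegralD F G : cintegrable F -> cintegrable G ->
  cintegral mu D (fun x => F x + G x) = cintegral mu D F + cintegral mu D G.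
Proof.
move=> [a b] [a' b']; apply: complex_eqP; rewrite /cintegral ?cReD ?cImD /=.
  by rewrite -RintegralD//; apply: eq_Rintegral => x _; rewrite cReD.
by rewrite -RintegralD//; apply: eq_Rintegral => x _; rewrite cImD.
Qed.

Lemma cintegralZ (k : R[i]) F : cintegrable F ->
  cintegral mu D (fun x => k * F x) = k * cintegral mu D F.
Proof.
move=> [a b]; apply: complex_eqP; rewrite /cintegral ?cReM ?cImM /=.
  rewrite -!RintegralZl// -RintegralB//; last 2 first.
  - by apply: eq_integrable (integrableZl mD (Re k) a).
  - by apply: eq_integrable (integrableZl mD (Im k) b).
  by apply: eq_Rintegral => x _; rewrite cReM.
rewrite -!RintegralZl// -RintegralD//; last 2 first.
- by apply: eq_integrable (integrableZl mD (Re k) b).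
- by apply: eq_integrable (integrableZl mD (Im k) a).
by apply: eq_Rintegral => x _; rewrite cImM.
Qed.

Lemma cintegrableB F G : cintegrable F -> cintegrable G ->
  cintegrable (fun x => F x - G x).
Proof.
move=> iF iG; apply: eq_cintegrable (cintegrableD iF (cintegrableZ (-1) iG)) => x _.
by rewrite mulN1r.
Qed.

Lemma cintegralB F G : cintegrable F -> cintegrable G ->
  cintegral mu D (fun x => F x - G x) = cintegral mu D F - cintegral mu D G.
Proof.
move=> iF iG; rewrite -mulN1r -cintegralZ// -cintegralD//; last exact: cintegrableZ.
by apply: eq_cintegral => x _; rewrite mulN1r.
Qed.

Lemma cintegrable0 : cintegrable (fun=> 0).
Proof. by split; exact: integrable0. Qed.

Lemma cintegral0 : cintegral mu D (fun=> 0) = 0.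
Proof. by apply: complex_eqP => /=; rewrite /Rintegral integral0. Qed.

Lemma cintegrable_sum I (r : seq I) (F : I -> T -> R[i]) :
  (forall i, cintegrable (F i)) -> cintegrable (fun x => \sum_(i <- r) F i x).
Proof.
move=> iF; elim: r => [|i r ih].
  by apply: eq_cintegrable cintegrable0 => x _; rewrite big_nil.
by apply: eq_cintegrable (cintegrableD (iF i) ih) => x _; rewrite big_cons.
Qed.

Lemma cintegral_sum I (r : seq I) (F : I -> T -> R[i]) :
  (forall i, cintegrable (F i)) ->
  cintegral mu D (fun x => \sum_(i <- r) F i x) = \sum_(i <- r) cintegral mu D (F i).
Proof.
move=> iF; elim: r => [|i r ih].
  by rewrite big_nil -[RHS]cintegral0; apply: eq_cintegral => x _; rewrite big_nil.
rewrite big_cons -ih -cintegralD//; last exact: cintegrable_sum.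
by apply: eq_cintegral => x _; rewrite big_cons.
Qed.

Lemma cintegrable_le F (g : T -> R) : cmeasurable F ->
  mu.-integrable D (EFin \o g) -> (forall x, D x -> cmodulus (F x) <= g x) ->
  cintegrable F.
Proof.
move=> [mF1 mF2] ig Fg; split; apply: le_integrable ig => //;
  try (by apply/measurable_EFinP; exact: measurable_funTS) => x Dx.
  move=> x Dx; rewrite lee_fin (le_trans (Re_le_cmod _))// (le_trans (Fg _ Dx))//.
  exact: ler_norm.
move=> x Dx; rewrite lee_fin (le_trans (Im_le_cmod _))// (le_trans (Fg _ Dx))//.
exact: ler_norm.
Qed.

Lemma cintegrable_bounded F (B : R) : (mu D < +oo)%E -> cmeasurable F ->
  (forall x, D x -> cmodulus (F x) <= B) -> cintegrable F.
Proof.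
move=> finD mF FB; apply: (cintegrable_le (g := cst B)) => //.
apply: measurable_bounded_integrable => //.
by exists `|B|; split=> // M BM x _; exact: ltW.
Qed.

Lemma cintegrable_cmod F : cintegrable F ->
  mu.-integrable D (EFin \o (fun x => `|Re (F x)| + `|Im (F x)|)).
Proof.
move=> [a b].
by apply: eq_integrable (integrableD mD (integrable_norm a) (integrable_norm b)).
Qed.

Lemma cintegrableM_bounded F G (B : R) : cmeasurable F -> cmeasurable G ->
  cintegrable F -> (forall x, cmodulus (G x) <= B) ->
  cintegrable (fun x => F x * G x).
Proof.
move=> mF mG iF GB.
have iB := integrableZl mD B (cintegrable_cmod iF).
apply: (cintegrable_le (g := fun x => B * (`|Re (F x)| + `|Im (F x)|))).
- exact: cmeasurableM.
- by apply: eq_integrable iB.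
- move=> x Dx; rewrite cmodM mulrC; apply: ler_pM; rewrite ?cmod_ge0 ?cmod_le//.
Qed.

Lemma dominated_ccvg (F_ : nat -> T -> R[i]) F (g : T -> R) :
  (forall n, cmeasurable (F_ n)) -> cmeasurable F ->
  (forall x, D x -> ccvg (F_ ^~ x) (F x)) ->
  mu.-integrable D (EFin \o g) ->
  (forall n x, D x -> cmodulus (F_ n x) <= g x) ->
  cintegrable F /\ ccvg (fun n => cintegral mu D (F_ n)) (cintegral mu D F).
Proof.
move=> mF_ mF F_F ig F_g.
have H (f : R[i] -> R) : (forall G, cmeasurable G -> measurable_fun setT (fun x => f (G x))) ->
    (forall z, `|f z| <= cmodulus z) ->
    (forall x, D x -> (fun n => f (F_ n x)) @ \oo --> f (F x)) ->
    mu.-integrable D (EFin \o (fun x => f (F x))) /\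
    (fun n => Rintegral mu D (fun x => f (F_ n x))) @ \oo --> Rintegral mu D (fun x => f (F x)).
  move=> mf fle fcvg.
  have fc x : D x -> (fun n => (f (F_ n x))%:E) @ \oo --> (f (F x))%:E.
    by move=> Dx; apply: cvg_EFin; [exact: nearW|exact: fcvg].
  have [i1 _ c1] := @dominated_convergence _ _ _ mu D mD
    (fun n x => (f (F_ n x))%:E) (fun x => (f (F x))%:E) (EFin \o g)
    (fun n => measurable_funTS (proj2 (measurable_EFinP _ _) (mf _ (mF_ n))))
    (measurable_funTS (proj2 (measurable_EFinP _ _) (mf _ mF)))
    (aeW _ fc) ig
    (aeW _ (fun x n Dx => le_trans (fle (F_ n x)) (F_g n x Dx))).
  split=> //; apply: fine_cvg; apply: cvg_trans c1 _.
  by rewrite fineK// integrable_fin_num.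
have [a a'] := H _ (fun G mG => proj1 mG) Re_le_cmod (fun x Dx => proj1 (F_F x Dx)).
have [b b'] := H _ (fun G mG => proj2 mG) Im_le_cmod (fun x Dx => proj2 (F_F x Dx)).
by split.
Qed.

Lemma cmeasurable_lim (F_ : nat -> T -> R[i]) F : (forall n, cmeasurable (F_ n)) ->
  (forall x, ccvg (F_ ^~ x) (F x)) -> cmeasurable F.
Proof.
move=> mF_ F_F; split.
  by apply: (measurable_fun_cvg (h := fun n x => Re (F_ n x))) => [n|x _];
    [exact: (proj1 (mF_ n))|exact: (proj1 (F_F x))].
by apply: (measurable_fun_cvg (h := fun n x => Im (F_ n x))) => [n|x _];
    [exact: (proj2 (mF_ n))|exact: (proj2 (F_F x))].
Qed.

End ComplexIntegral.

(** * Fourier series *)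

Section Trigonometric.
Context {R : realType}.
Local Notation mu := (@lebesgue_measure R).
Local Notation mR := (measurableTypeR R).
Local Notation Re := complex.Re.
Local Notation Im := complex.Im.
Local Notation I01 := (`[0%R, 1%R]%classic : set mR).

Lemma FTC_Rintegral (F f : R -> R) (a b : R) : a < b ->
  (forall x : R, is_derive x (1 : R) F (f x)) -> continuous f ->
  Rintegral mu `[a, b] f = F b - F a.
Proof.
move=> ab dF cf.
have cF : continuous F.
  by move=> x; apply: differentiable_continuous; apply/derivable1_diffP; case: (dF x).
rewrite /Rintegral (@continuous_FTC2 _ f F)//.
- exact: continuous_subspaceT.
- split; first by move=> x _; case: (dF x).
    by apply: cvg_at_right_filter; exact: cF.
  by apply: cvg_at_left_filter; exact: cF.
- by move=> x _; rewrite derive1E; case: (dF x).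
Qed.

Lemma is_derive_sinM (k x : R) : is_derive x (1 : R) (fun t : R => sin (k * t)) (k * cos (k * x)).
Proof.
have dk : is_derive x (1 : R) (fun t : R => k * t) k.
  have := @is_deriveZ _ _ _ (id : R -> R) k x 1 1 _.
  by rewrite scaler1; apply; exact: is_derive_id.
have := @is_derive1_comp R (@sin R) (fun t => k * t) x _ _ (is_derive_sin _) dk.
by rewrite mulrC.
Qed.

Lemma is_derive_cosM (k x : R) : is_derive x (1 : R) (fun t : R => cos (k * t)) (- k * sin (k * x)).
Proof.
have dk : is_derive x (1 : R) (fun t : R => k * t) k.
  have := @is_deriveZ _ _ _ (id : R -> R) k x 1 1 _.
  by rewrite scaler1; apply; exact: is_derive_id.
have := @is_derive1_comp R (@cos R) (fun t => k * t) x _ _ (is_derive_cos _) dk.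
by rewrite mulrC mulNr mulrN.
Qed.

Lemma continuous_sinM (k : R) : continuous (fun t : R => sin (k * t)).
Proof.
move=> x; apply: differentiable_continuous; apply/derivable1_diffP.
by case: (is_derive_sinM k x).
Qed.

Lemma continuous_cosM (k : R) : continuous (fun t : R => cos (k * t)).
Proof.
move=> x; apply: differentiable_continuous; apply/derivable1_diffP.
by case: (is_derive_cosM k x).
Qed.

Lemma finite_I01 : (mu I01 < +oo)%E.
Proof. by rewrite lebesgue_measure_itv /= lte_fin ltr01 -EFinB ltry. Qed.

Lemma mI01 : measurable I01. Proof. by []. Qed.

Lemma cmeasurable_e2piM (k : R) : cmeasurable (fun x : mR => e2pi (k * x)).
Proof. by apply: cmeasurable_e2pi; exact: measurable_funM. Qed.

Lemma cintegral_e2pi (k : int) :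
  cintegral mu I01 (fun x => e2pi (k%:~R * x)) = (k == 0)%:R.
Proof.
have [->|k0] := eqVneq k 0.
  rewrite (_ : (fun x : mR => e2pi _) = fun=> 1); last first.
    by apply/funext => x; rewrite mul0r e2pi0.
  rewrite /cintegral /= !Rintegral_cst//= mul0r mul1r.
  by rewrite lebesgue_measure_itv /= lte_fin ltr01 -EFinB subr0.
set t : R := 2 * pi * k%:~R.
have t0 : t != 0.
  by rewrite /t mulf_neq0 ?intr_eq0// mulf_neq0 ?gt_eqF ?pi_gt0.
have := e2pi_int (R := R) k; rewrite /e2pi -/t => -[ck sk].
rewrite /cintegral /=; apply: complex_eqP => /=.
  rewrite (_ : (fun x => _) = (fun x => cos (t * x))); last first.
    by apply/funext => x; rewrite /t mulrA.
  have dF (x : R) : is_derive x (1 : R) (fun x => t^-1 * sin (t * x)) (cos (t * x)).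
    have := @is_deriveZ _ _ _ _ t^-1 x 1 _ (is_derive_sinM t x).
    by rewrite /GRing.scale /= mulKf.
  rewrite (FTC_Rintegral ltr01 dF (continuous_cosM (k := t))).
  by rewrite mulr1 mulr0 sin0 sk !mulr0 subrr.
rewrite (_ : (fun x => _) = (fun x => sin (t * x))); last first.
  by apply/funext => x; rewrite /t mulrA.
have dF (x : R) : is_derive x (1 : R) (fun x => - t^-1 * cos (t * x)) (sin (t * x)).
  have := @is_deriveZ _ _ _ _ (- t^-1) x 1 _ (is_derive_cosM t x).
  by rewrite /GRing.scale /= mulrA mulrNN mulVf// mul1r.
rewrite (FTC_Rintegral ltr01 dF (continuous_sinM (k := t))).
by rewrite mulr1 mulr0 cos0 ck subrr.
Qed.

Definition fourier_coef (h : mR -> R[i]) (n : int) : R[i] :=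
  cintegral mu I01 (fun x => h x * e2pi (- (n%:~R * x))).

Lemma cintegrable_fourier (h : mR -> R[i]) (k : R) : cmeasurable h ->
  cintegrable mu I01 h -> cintegrable mu I01 (fun x => h x * e2pi (k * x)).
Proof.
move=> mh ih; apply: (cintegrableM_bounded mI01 (B := 1)) => //.
  exact: cmeasurable_e2piM.
by move=> x; rewrite cmod_e2pi.
Qed.

Lemma cintegrable_fourierN (h : mR -> R[i]) (n : int) : cmeasurable h ->
  cintegrable mu I01 h -> cintegrable mu I01 (fun x => h x * e2pi (- (n%:~R * x))).
Proof.
move=> mh ih.
rewrite (_ : (fun x => _) = (fun x => h x * e2pi (- n%:~R * x))).
  exact: cintegrable_fourier.
by apply/funext => x; rewrite mulNr.
Qed.

Lemma L2_cintegrable (h : mR -> R[i]) : cmeasurable h ->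
  (\int[mu]_(x in I01) (cnorm2 (h x))%:E < +oo)%E ->
  mu.-integrable I01 (EFin \o (fun x => cnorm2 (h x))) /\ cintegrable mu I01 h.
Proof.
move=> mh hoo.
have i2 : mu.-integrable I01 (EFin \o (fun x => cnorm2 (h x))).
  apply/integrableP; split; first exact: measurable_funTS (measurable_cnorm2E mh).
  by under eq_integral do rewrite /= ger0_norm ?cnorm2_ge0//.
split=> //.
have i1 : mu.-integrable I01 (EFin \o (cst 1 : mR -> R)).
  apply: measurable_bounded_integrable => //; first exact: finite_I01.
  by exists 1; split=> // M M1 x _; rewrite /= normr1 ltW.
apply: (cintegrable_le mI01 (g := fun x => 1 + cnorm2 (h x))) => //.
  by apply: eq_integrable (integrableD mI01 i1 i2).
move=> x _; rewrite -cmodulus2; have := sqr_ge0 (1 - cmodulus (h x)).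
have := cmod_ge0 (h x); rewrite !expr2; nra.
Qed.

(** The integral of |h - P|^2 is nonnegative, where P is the partial Fourier sum of [h] over [r]; by
    orthogonality the cross terms and |P|^2 all integrate to the sum [S] of the squared
    coefficients. When [h] is not square-integrable the right-hand side is infinite. *)
Lemma bessel (h : mR -> R[i]) (r : seq int) : cmeasurable h -> uniq r ->
  ((\sum_(n <- r) cnorm2 (fourier_coef h n))%:E <=
    \int[mu]_(x in I01) (cnorm2 (h x))%:E)%E.
Proof.
move=> mh ur.
have [hoo|] := ltP (\int[mu]_(x in I01) (cnorm2 (h x))%:E)%E +oo%E; last first.
  by rewrite leye_eq => /eqP ->; rewrite leey.
have [i2 ih] := L2_cintegrable mh hoo.
set c := fourier_coef h; set S := \sum_(n <- r) _.
pose P x : R[i] := \sum_(n <- r) c n * e2pi (n%:~R * x).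
have mP : cmeasurable (P : mR -> R[i]).
  by apply: cmeasurable_sum => n _; apply: cmeasurableM;
    [exact: cmeasurable_cst|exact: cmeasurable_e2piM].
have iE (k : R) : cintegrable mu I01 (fun x => e2pi (k * x)).
  apply: (cintegrable_bounded mI01 (B := 1)) => //; first exact: finite_I01.
    exact: cmeasurable_e2piM.
  by move=> x _; rewrite cmod_e2pi.
have PcE x : conjc (P x) = \sum_(n <- r) conjc (c n) * e2pi (- (n%:~R * x)).
  rewrite /P (big_morph (@conjc R) (id1 := 0) (op1 := +%R)) => [|z w|]; last 2 first.
  - by apply: complex_eqP; rewrite ?cReC ?cImC ?cReD ?cImD ?cReC ?cImC ?opprD.
  - exact: conjc0.
  by apply: eq_bigr => n _; rewrite conjcM e2piN.
have E1 (g : mR -> R[i]) : cmeasurable g -> cintegrable mu I01 g ->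
    cintegrable mu I01 (fun x => g x * conjc (P x)) /\
    cintegral mu I01 (fun x => g x * conjc (P x)) =
    \sum_(n <- r) conjc (c n) * fourier_coef g n.
  move=> mg ig.
  have F x : g x * conjc (P x) = \sum_(n <- r) conjc (c n) * (g x * e2pi (- (n%:~R * x))).
    by rewrite PcE mulr_sumr; apply: eq_bigr => n _; rewrite mulrCA.
  have igE n := cintegrable_fourierN n mg ig.
  split.
    apply: (eq_cintegrable mI01 (F := fun x => \sum_(n <- r) conjc (c n) * (g x * e2pi (- (n%:~R * x))))).
      by move=> x _; rewrite F.
    by apply: (cintegrable_sum mI01) => n; exact: cintegrableZ.
  under eq_cintegral do rewrite F.
  rewrite cintegral_sum//; last by move=> n; exact: cintegrableZ.
  by apply: eq_bigr => n _; rewrite cintegralZ.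
have iP : cintegrable mu I01 P.
  by apply: cintegrable_sum => // n; exact: cintegrableZ.
have cP n : n \in r -> fourier_coef P n = c n.
  move=> nr; rewrite /fourier_coef.
  have F x : P x * e2pi (- (n%:~R * x)) = \sum_(m <- r) c m * e2pi ((m - n)%:~R * x).
    rewrite /P mulr_suml; apply: eq_bigr => m _; rewrite -mulrA -e2piD -mulrBl.
    by rewrite rmorphB.
  under eq_cintegral do rewrite F.
  rewrite cintegral_sum//; last by move=> m; exact: cintegrableZ.
  rewrite (bigD1_seq n)//= big1 ?addr0.
    by rewrite cintegralZ// cintegral_e2pi subrr mulr1.
  by move=> m mn; rewrite cintegralZ// cintegral_e2pi subr_eq0 (negbTE mn) mulr0.
have [ihP hP] := E1 h mh ih.
have [iPP PP] := E1 P mP iP.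
have ReE : \sum_(n <- r) conjc (c n) * c n = S%:C.
  rewrite (_ : S%:C = \sum_(n <- r) (cnorm2 (c n))%:C).
    by apply: eq_bigr => n _; rewrite mulrC mulcJ.
  by apply: complex_eqP; rewrite ?Re_sum ?Im_sum //= big1.
rewrite -/c ReE in hP.
have {}PP : cintegral mu I01 (fun x => P x * conjc (P x)) = S%:C.
  by rewrite PP -ReE; apply: eq_big_seq => n /cP ->.
pose g x := cnorm2 (h x) - 2 * Re (h x * conjc (P x)) + Re (P x * conjc (P x)).
have g0 x : 0 <= g x.
  rewrite (_ : g x = cnorm2 (h x - P x)) ?cnorm2_ge0//.
  rewrite /g /cnorm2 !(cReD, cImD, cReN, cImN, cReM, cImM, cReC, cImC); ring.
have [a1 _] := ihP; have [a2 _] := iPP.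
have a1' := integrableZl mI01 2 a1.
have a3 : mu.-integrable I01 (EFin \o (fun x => 2 * Re (h x * conjc (P x)))).
  by apply: eq_integrable a1'.
have a4 : mu.-integrable I01 (EFin \o (fun x => cnorm2 (h x) - 2 * Re (h x * conjc (P x)))).
  by apply: eq_integrable (integrableB mI01 i2 a3).
have : 0 <= Rintegral mu I01 g by apply: Rintegral_ge0 => x _; exact: g0.
rewrite /g RintegralD// RintegralB// RintegralZl//.
have -> : Rintegral mu I01 (fun x => Re (h x * conjc (P x))) = S.
  by move: hP => /(congr1 (@complex.Re R)).
have -> : Rintegral mu I01 (fun x => Re (P x * conjc (P x))) = S.
  by move: PP => /(congr1 (@complex.Re R)).
move=> H; rewrite -[leRHS]fineK; last by apply: integrable_fin_num i2.
by rewrite lee_fin; move: H; rewrite /Rintegral; lra.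
Qed.

End Trigonometric.

(** * Pointwise convergence of Fourier series *)

Section FourierInversion.
Context {R : realType}.
Local Notation mu := (@lebesgue_measure R).
Local Notation mR := (measurableTypeR R).
Local Notation I01 := (`[0%R, 1%R]%classic : set mR).

(** On [0, 1] the mean value theorem gives sin x >= x cos 1. Beyond 1 the sine keeps increasing up
    to pi / 2 < 2, which costs the factor 1 / 2. *)
Lemma sin_ge_linear (y : R) : 0 <= y <= pi / 2 -> cos 1 / 2 * y <= sin y.
Proof.
have c1 := @cos1_gt0 R; have p2 := @pihalf_lt2 R; have p1 := @pihalf_ge1 R.
have p0 := @pi_gt0 R.
have H (x : R) : 0 <= x <= 1 -> cos 1 * x <= sin x.
  case/andP; rewrite le_eqVlt => /predU1P[<- _|x0 x1].
    by rewrite mulr0 sin0.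
  have [c cx] := @MVT R (@sin R) (@cos R) 0 x x0 (fun t _ => is_derive_sin t)
    (continuous_subspaceT (@continuous_sin R)).
  rewrite sin0 !subr0 => ->; rewrite ler_pM2r//.
  move: cx; rewrite in_itv/= => /andP[c0 cx].
  by rewrite ltW// ltr_cos// ?in_itv/=; [lra|apply/andP; split; lra..].
case/andP => y0 yp; have [y1|y1] := leP y 1.
  apply: le_trans (H y _); last by rewrite y0.
  nra.
apply: (@le_trans _ _ (cos 1)); first nra.
apply: (@le_trans _ _ (sin 1)).
  by have := H 1; rewrite mulr1; apply; rewrite ler01 lexx.
by rewrite ltW// ltr_sin// in_itv/=; apply/andP; split; lra.
Qed.

(** |e(t) - 1|^2 = 4 sin(pi t)^2, and |pi t| <= pi / 2 allows the linear lower bound for the sine;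
    pi >= 2 absorbs its factor 1 / 2. *)
Lemma cnorm2_e2piB1_ge (t : R) : `|t| <= 2^-1 ->
  cos 1 ^+ 2 * t ^+ 2 <= cnorm2 (e2pi t - 1).
Proof.
move=> t2.
have -> : cnorm2 (e2pi t - 1) = 4 * sin (pi * `|t|) ^+ 2.
  have -> : sin (pi * `|t|) ^+ 2 = sin (pi * t) ^+ 2.
    by case: (ger0P t) => // _; rewrite mulrN sinN sqrrN.
  rewrite /cnorm2 /e2pi cReD cImD cReN cImN /=.
  have -> : 2 * pi * t = (pi * t) *+ 2 by rewrite mulr2n; ring.
  rewrite cos_mulr2n sin_mulr2n oppr0 addr0.
  have := cos2Dsin2 (pi * t); set c := cos _; set s := sin _.
  move=> cs; rewrite -[in LHS]cs; have -> : c ^+ 2 = 1 - s ^+ 2 by rewrite -cs addrK.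
  rewrite !expr2 in cs *; nra.
have c1 := @cos1_gt0 R; have p2 := @pi_ge2 R; have t0 := normr_ge0 t.
have p0 := @pi_gt0 R.
have /sin_ge_linear : 0 <= pi * `|t| <= pi / 2.
  by rewrite mulr_ge0 ?pi_ge0//= ler_pM2l.
have [n0 n1] : 0 <= cos 1 * `|t| /\ cos 1 * `|t| <= cos 1 / 2 * (pi * `|t|).
  have ct : 0 <= cos 1 * `|t| by rewrite mulr_ge0// ltW.
  by split=> //; nra.
move=> h; have {h n1}h := le_trans n1 h.
rewrite -[t ^+ 2]real_normK ?num_real// -exprMn.
have h2 : (cos 1 * `|t|) ^+ 2 <= sin (pi * `|t|) ^+ 2.
  by rewrite ler_pXn2r ?nnegrE// (le_trans n0).
apply: le_trans h2 _; have := sqr_ge0 (sin (pi * `|t|)); lra.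
Qed.

(** Written with a real power, so that measurability of an inverse reduces to that of [powR]; at z =
    0 both sides vanish. *)
Lemma complex_invE (z : R[i]) : z^-1 = (cnorm2 z `^ (-1))%:C * conjc z.
Proof.
rewrite powR_inv1 ?cnorm2_ge0//; have [->|z0] := eqVneq z 0.
  by rewrite invr0 conjc0 mulr0.
apply: (mulfI z0); rewrite divff// mulrCA mulcJ.
have c0 : cnorm2 z != 0 by rewrite cnorm2_eq0.
by rewrite -rmorphM /= mulVf.
Qed.

Lemma cmeasurableV d (T : measurableType d) (F : T -> R[i]) : cmeasurable F ->
  cmeasurable (fun x => (F x)^-1).
Proof.
move=> mF; rewrite (_ : (fun x => _) = fun x => (cnorm2 (F x) `^ (-1))%:C * conjc (F x)).
  apply: cmeasurableM; last exact: cmeasurableC.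
  split; last exact: measurable_cst.
  apply: (measurableT_comp (f := fun y : R => y `^ (-1))); first exact: measurable_powR.
  exact: measurable_cnorm2.
by apply/funext => x; rewrite complex_invE.
Qed.

(** A Riemann-Lebesgue statement for bounded [h]: Bessel's inequality makes the squared coefficients
    along distinct frequencies summable. *)
Lemma fourier_coef_cvg0 (h : mR -> R[i]) (B : R) (a : R) (f : nat -> int) :
  cmeasurable h -> (forall x, cmodulus (h x) <= B) -> injective f ->
  ccvg (fun k => e2pi ((f k)%:~R * a) * fourier_coef h (f k)) 0.
Proof.
move=> mh hB fi.
have B0 : 0 <= B := le_trans (cmod_ge0 _) (hB 0).
have bd K : \sum_(0 <= k < K) cnorm2 (fourier_coef h (f k)) <= B ^+ 2.
  rewrite -lee_fin.
  have := @bessel R h [seq f k | k <- index_iota 0 K] mh _.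
  rewrite big_map map_inj_uniq ?iota_uniq// => /(_ isT) /le_trans; apply.
  apply: (@le_trans _ _ (\int[mu]_(x in I01) (B ^+ 2)%:E)%E).
    apply: ge0_le_integral => //.
    - by move=> x _; rewrite lee_fin cnorm2_ge0.
    - exact: measurable_funTS (measurable_cnorm2E mh).
    - by move=> x _; rewrite lee_fin -cmodulus2 ler_pXn2r ?nnegrE ?cmod_ge0.
  by rewrite integral_cst//= lebesgue_measure_itv /= lte_fin ltr01 -EFinB subr0 mule1.
have c0 : (fun k => cnorm2 (fourier_coef h (f k))) @ \oo --> (0 : R).
  apply: cvg_series_cvg_0; apply: (@bounded_sum_cvg _ _ (B ^+ 2)) => K.
  by apply: le_trans (bd K); apply: ler_sum => k _; rewrite ger0_norm// cnorm2_ge0.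
apply: (@cmod_ccvg0 _ _ (fun k => Num.sqrt (cnorm2 (fourier_coef h (f k))))).
  by move=> k; rewrite cmodM cmod_e2pi mul1r cmod_sqrt.
rewrite -[X in _ --> X](@sqrtr0 R).
by apply: continuous_cvg => //; exact: sqrt_continuous.
Qed.

(* Chernoff's argument: V - V a is divisible by e(x - a) - 1 with a bounded
   quotient h, so the partial Fourier sums of V at a telescope, up to V a, to
   two Fourier coefficients of h, which tend to 0 by Bessel. *)
Lemma fourier_inversion (V : mR -> R[i]) (L a : R) : cmeasurable V ->
  (forall (k : int) x, V (x + k%:~R) = V x) ->
  (forall x y, `|x - y| <= 1 -> cmodulus (V x - V y) <= L * `|x - y|) ->
  ccvg (psumZ (fun l => fourier_coef V l * e2pi (l%:~R * a))) (V a).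
Proof.
move=> mV pV lV.
have c1 := @cos1_gt0 R.
have L0 : 0 <= L.
  by have := lV 1 0; rewrite subr0 normr1 mulr1 => /(_ (lexx _)); apply: le_trans (cmod_ge0 _).
pose C := L / cos 1; have C0 : 0 <= C by rewrite divr_ge0// ltW.
have VC x : cmodulus (V x - V a) <= C * cmodulus (e2pi (x - a) - 1).
  (* The integer nearest to x - a; by periodicity x may be moved to within 1 / 2 of a, where |e(t) -
     1| has a linear lower bound. *)
  pose k := Num.floor (x - a + 2^-1).
  have xk : `|x + (- k)%:~R - a| <= 2^-1.
    have := floor_itv (x - a + 2^-1); rewrite -/k rmorphN rmorphD /= => /andP[k1 k2].
    by rewrite ler_norml; apply/andP; split; lra.
  rewrite -(pV (- k) x).
  have -> : e2pi (x - a) = e2pi (x + (- k)%:~R - a).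
    by rewrite addrAC e2piDint.
  set t := x + _ - a in xk *.
  have h : cos 1 * `|t| <= cmodulus (e2pi t - 1).
    rewrite -(ler_pXn2r (n := 2))// ?nnegrE ?cmod_ge0 ?mulr_ge0 ?(ltW c1)//.
    rewrite cmodulus2 exprMn real_normK ?num_real//; exact: cnorm2_e2piB1_ge.
  apply: (le_trans (lV _ _ _)); first by rewrite -/t (le_trans xk)// invf_le1// ler1n.
  rewrite -/t /C -mulrA ler_wpM2l// mulrC ler_pdivlMr// mulrC; exact: h.
pose h x := (V x - V a) * (e2pi (x - a) - 1)^-1.
have mh : cmeasurable (h : mR -> R[i]).
  apply: cmeasurableM; first by apply: cmeasurableB => //; exact: cmeasurable_cst.
  apply: cmeasurableV; apply: cmeasurableB; last exact: cmeasurable_cst.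
  by apply: cmeasurable_e2pi; exact: measurable_funB.
have hC x : cmodulus (h x) <= C.
  rewrite /h cmodM {2}/cmodulus ComplexField.Normc.normcV -/(cmodulus _).
  have [->|e0] := eqVneq (cmodulus (e2pi (x - a) - 1)) 0; first by rewrite invr0 mulr0.
  by rewrite ler_pdivrMr ?VC// lt_neqAle eq_sym e0 cmod_ge0.
have Vh x : V x = V a + h x * (e2pi (x - a) - 1).
  have [e0|e0] := eqVneq (e2pi (x - a) - 1) 0; last by rewrite /h mulfVK// subrKC.
  have := VC x; rewrite e0 cmod0 mulr0 mulr0 addr0 => V0.
  apply/eqP; rewrite -subr_eq0 -cnorm2_eq0 -cmodulus2 sqrf_eq0.
  by rewrite eq_le V0 cmod_ge0.
have ih : cintegrable mu I01 h.
  by apply: (cintegrable_bounded mI01 (B := C)) => //; exact: finite_I01.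
pose t l := e2pi (l%:~R * a) * fourier_coef h l.
(* Multiplying [h] by e(x) replaces its l-th coefficient by the one of index l - 1, so each term is
   a difference of consecutive [t], plus the constant [V a] at l = 0. *)
have coefE l : fourier_coef V l * e2pi (l%:~R * a) =
    (if l == 0 then V a else 0) + t (l - 1) - t l.
  rewrite {1}/fourier_coef.
  have -> : (fun x => V x * e2pi (- (l%:~R * x))) =
    (fun x => V a * e2pi ((- l)%:~R * x) + (e2pi (- a) * (h x * e2pi (- ((l - 1)%:~R * x)))
        - h x * e2pi (- (l%:~R * x)))).
    apply/funext => x; rewrite {1}Vh rmorphN mulNr mulrDl; congr (_ + _).
    rewrite mulrBr mulr1 mulrBl; congr (_ - _).
    rewrite [RHS]mulrCA -[LHS]mulrA -!e2piD; congr (_ * e2pi _).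
    rewrite rmorphB /=; ring.
  have i1 := cintegrable_fourierN (l - 1) mh ih.
  have i2 := cintegrable_fourierN l mh ih.
  have i3 : cintegrable mu I01 (fun x => e2pi ((- l)%:~R * x)).
    apply: (cintegrable_bounded mI01 (B := 1)); first exact: finite_I01.
      exact: cmeasurable_e2piM.
    by move=> x _; rewrite cmod_e2pi.
  rewrite cintegralD//; last 2 first.
  - exact: cintegrableZ.
  - by apply: cintegrableB => //; exact: cintegrableZ.
  rewrite cintegralB//; last exact: cintegrableZ.
  rewrite !cintegralZ// cintegral_e2pi oppr_eq0 -!/(fourier_coef _ _).
  rewrite mulrDl mulrBl -addrA; congr (_ + (_ - _)).
  - by have [->|_] := eqVneq l 0; rewrite ?mul0r ?e2pi0 ?mulr1// mulr0 mul0r.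
  - rewrite /t mulrAC -e2piD; congr (e2pi _ * _).
    by rewrite rmorphB /=; ring.
  - by rewrite mulrC.
(* For K = 0 the window is empty and misses the term l = 0, hence the case distinction. *)
have psumE K : psumZ (fun l => fourier_coef V l * e2pi (l%:~R * a)) K =
    (if K == 0%N then 0 else V a) + t (- K.+1%:Z) - t (K%:Z - 1).
  elim: K => [|K ih']; first by rewrite psumZ0 add0r sub0r subrr.
  rewrite psumZS ih' !coefE eqz_nat.
  have -> : (- K.+1%:Z == 0) = false by rewrite oppr_eq0.
  have -> : - K.+1%:Z - 1 = - K.+2%:Z by rewrite -opprD -PoszD addn1.
  have -> : K.+1%:Z - 1 = K%:Z by rewrite -addn1 PoszD addrK.
  by case: (K == 0%N) => /=; ring.
have t1 : ccvg (fun K => t (- K.+1%:Z)) 0.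
  by apply: (@fourier_coef_cvg0 h C a (fun K => - K.+1%:Z)) => // i j /oppr_inj [].
have t2 : ccvg (fun K => t (K%:Z - 1)) 0.
  by apply: (@fourier_coef_cvg0 h C a (fun K => K%:Z - 1)) => // i j /addIr [].
have c3 : ccvg (fun K => if K == 0%N then 0 else V a) (V a).
  split.
    apply: (@cvg_trans _ (cst (complex.Re (V a)) @ \oo)); last exact: cvg_cst.
    by apply: near_eq_cvg; exists 1%N => // -[].
  apply: (@cvg_trans _ (cst (complex.Im (V a)) @ \oo)); last exact: cvg_cst.
  by apply: near_eq_cvg; exists 1%N => // -[].
have := ccvgB (ccvgD c3 t1) t2; rewrite addr0 subr0; apply: ccvg_ext => K.
by rewrite psumE.
Qed.

End FourierInversion.

(** * Schwartz functions *)

Section RealSchwartz.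
Context {R : realType}.
Local Notation mu := (@lebesgue_measure R).
Local Notation mR := (measurableTypeR R).
Implicit Types u v g : R -> R.

Lemma derivable_is_derive g (x : R) : derivable g x 1 -> is_derive x (1 : R) g ((derive1 g) x).
Proof. by move=> dg; apply: DeriveDef; rewrite ?derive1E. Qed.

Lemma is_derive_derive1 g (x l : R) : is_derive x (1 : R) g l -> (derive1 g) x = l.
Proof. by move=> [_ <-]; rewrite derive1E. Qed.

(** A coinduction principle: a class closed under differentiation whose members satisfy the bounds
    of order 0 consists of Schwartz functions. It replaces formulas for iterated derivatives by the
    choice of a suitable class. *)
Lemma real_schwartz_coind (S : (R -> R) -> Prop) :
  (forall g, S g -> exists2 g', S g' & forall x : R, is_derive x (1 : R) g (g' x)) ->
  (forall g m, S g -> exists M, forall x, `|x ^+ m * g x| <= M) ->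
  forall g, S g -> real_schwartz g.
Proof.
move=> Sd Sb g Sg.
have Sn n : S (derive1n n g).
  elim: n => [//|n ih]; have [g' Sg' dg] := Sd _ ih.
  rewrite derive1nS (_ : (derive1 (derive1n n g)) = g')//.
  by apply/funext => x; exact: is_derive_derive1.
split=> [n x|m n]; last exact: Sb.
by have [g' _ dg] := Sd _ (Sn n); case: (dg x).
Qed.

Lemma schwartz_is_derive u (x : R) : real_schwartz u -> is_derive x (1 : R) u ((derive1 u) x).
Proof. by move=> [du _]; apply: derivable_is_derive; exact: (du 0%N). Qed.

Lemma schwartz_derive1 u : real_schwartz u -> real_schwartz (derive1 u).
Proof.
move=> [du bu]; split=> [n x|m n]; rewrite -derive1Sn; [exact: du|exact: bu].
Qed.

Lemma schwartz_bound u m : real_schwartz u -> exists M, forall x, `|x ^+ m * u x| <= M.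
Proof. by move=> [_ bu]; exact: (bu m 0%N). Qed.

Lemma schwartz_continuous u : real_schwartz u -> continuous u.
Proof.
move=> su x; apply: differentiable_continuous; apply/derivable1_diffP.
by case: (schwartz_is_derive x su).
Qed.

Lemma schwartzD u v : real_schwartz u -> real_schwartz v ->
  real_schwartz (fun x => u x + v x).
Proof.
move=> su sv.
apply: (@real_schwartz_coind (fun g => exists u v, [/\ real_schwartz u,
  real_schwartz v & g = fun x => u x + v x])); last by exists u, v.
- move=> _ [{}u [{}v [{}su {}sv ->]]]; exists (fun x => (derive1 u) x + (derive1 v) x).
    by exists (derive1 u), (derive1 v); split=> //; exact: schwartz_derive1.
  by move=> x; apply: is_deriveD; exact: schwartz_is_derive.
- move=> _ m [{}u [{}v [{}su {}sv ->]]].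
  have [A uA] := schwartz_bound m su; have [B vB] := schwartz_bound m sv.
  exists (A + B) => x; rewrite mulrDr; apply: (le_trans (ler_normD _ _)); exact: lerD.
Qed.

Lemma schwartzZ (k : R) u : real_schwartz u -> real_schwartz (fun x => k * u x).
Proof.
move=> su; apply: (@real_schwartz_coind (fun g => exists2 u, real_schwartz u &
  g = fun x => k * u x)); last by exists u.
- move=> _ [{}u {}su ->]; exists (fun x => k * (derive1 u) x).
    by exists (derive1 u) => //; exact: schwartz_derive1.
  by move=> x; apply: is_deriveZ; exact: schwartz_is_derive.
- move=> _ m [{}u {}su ->]; have [A uA] := schwartz_bound m su.
  by exists (`|k| * A) => x; rewrite mulrCA normrM ler_wpM2l.
Qed.

Lemma schwartz0 : real_schwartz (fun=> 0 : R).
Proof.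
apply: (@real_schwartz_coind (fun g => g = fun=> 0)) => //.
- by move=> _ ->; exists (fun=> 0) => // x; exact: is_derive_cst.
- by move=> _ m ->; exists 0 => x; rewrite mulr0 normr0.
Qed.

Lemma schwartz_scale (k : R) u : k != 0 -> real_schwartz u ->
  real_schwartz (fun x => u (k * x)).
Proof.
move=> k0 su; apply: (@real_schwartz_coind (fun g => exists2 u, real_schwartz u &
  g = fun x => u (k * x))); last by exists u.
- move=> _ [{}u {}su ->]; exists (fun x => k * (derive1 u) (k * x)).
    by exists (fun x => k * (derive1 u) x) => //; apply: schwartzZ; exact: schwartz_derive1.
  move=> x.
  have dk : is_derive x (1 : R) (fun t : R => k * t) k.
    have := @is_deriveZ _ _ _ (id : R -> R) k x 1 1 _.
    by rewrite scaler1; apply; exact: is_derive_id.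
  have := @is_derive1_comp R u (fun t => k * t) x _ _ (schwartz_is_derive _ su) dk.
  by rewrite mulrC.
- move=> _ m [{}u {}su ->]; have [A uA] := schwartz_bound m su.
  exists (A / `|k| ^+ m) => x; rewrite ler_pdivlMr ?exprn_gt0 ?normr_gt0//.
  by rewrite -normrX -normrM mulrC mulrA -exprMn; exact: uA.
Qed.

(** The functions x u + v with [u] and [v] Schwartz form a class closed under differentiation,
    because (x u + v)' = x u' + (u + v'). *)
Lemma schwartzX u : real_schwartz u -> real_schwartz (fun x => x * u x).
Proof.
move=> su; apply: (@real_schwartz_coind (fun g => exists u v, [/\ real_schwartz u,
  real_schwartz v & g = fun x => x * u x + v x])); last first.
  exists u, (fun=> 0); split=> //; first exact: schwartz0.
  by apply/funext => x; rewrite addr0.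
- move=> _ m [{}u [v [{}su sv ->]]].
  have [A uA] := schwartz_bound m.+1 su; have [B vB] := schwartz_bound m sv.
  exists (A + B) => x; rewrite mulrDr; apply: (le_trans (ler_normD _ _)).
  by rewrite lerD// mulrA -exprSr.
- move=> _ [{}u [v [{}su sv ->]]]; exists (fun x => x * (derive1 u) x + (u x + (derive1 v) x)).
    exists (derive1 u), (fun x => u x + (derive1 v) x); split=> //; first exact: schwartz_derive1.
    by apply: schwartzD => //; exact: schwartz_derive1.
  move=> x; rewrite addrA.
  apply: is_deriveD; last exact: schwartz_is_derive.
  have := @is_deriveM R R (id : R -> R) u x 1 _ _ (is_derive_id _ _) (schwartz_is_derive x su).
  by rewrite /GRing.scale /= mulr1.
Qed.

Lemma schwartz_decay u : real_schwartz u -> exists B, forall x, `|u x| * (1 + x ^+ 2) <= B.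
Proof.
move=> su; have [A uA] := schwartz_bound 0 su; have [B uB] := schwartz_bound 2 su.
exists (A + B) => x; rewrite mulrDr mulr1 lerD//.
  by have := uA x; rewrite expr0 mul1r.
by rewrite mulrC -[x ^+ 2]ger0_norm ?sqr_ge0// -normrM.
Qed.

End RealSchwartz.

(** * The Fourier transform preserves Schwartz functions *)

Section SchwartzFourier.
Context {R : realType}.
Local Notation mu := (@lebesgue_measure R).
Local Notation mR := (measurableTypeR R).
Implicit Types u v g : R -> R.

Definition rdecay (B : R) g : Prop := forall x, `|g x| * (1 + x ^+ 2) <= B.

Lemma oneDsqrV_ge0 (x : R) : 0 <= (oneDsqr x)^-1.
Proof. by rewrite invr_ge0 (le_trans _ (oneDsqr_ge1 x)). Qed.

Lemma integrable_oneDsqrV (B : R) :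
  mu.-integrable setT (EFin \o (fun x : mR => B * (oneDsqr x)^-1)).
Proof.
have mo : measurable_fun setT (fun x : mR => (oneDsqr x)^-1).
  by apply: continuous_measurable_fun; exact: continuous_oneDsqrV.
have me : measurable_fun setT (fun x : mR => ((oneDsqr x)^-1)%:E) by exact/measurable_EFinP.
have o0 (x : R) : (0 <= ((oneDsqr x)^-1)%:E)%E by rewrite lee_fin oneDsqrV_ge0.
suff : mu.-integrable setT (fun x : mR => ((oneDsqr x)^-1)%:E).
  by move=> /(integrableZl measurableT B); apply: eq_integrable.
apply/integrableP; split=> //.
under eq_integral do rewrite /= ger0_norm ?oneDsqrV_ge0//.
have pos : (\int[mu]_(x in `[0%R, +oo[) ((oneDsqr x)^-1)%:E < +oo)%E.
  by rewrite integral0y_oneDsqr ltry.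
have neg : (\int[mu]_(x in `]-oo, 0%R]) ((oneDsqr x)^-1)%:E < +oo)%E.
  move: pos; rewrite ge0_integration_by_substitution0//.
  by under eq_integral do rewrite /oneDsqr sqrrN.
rewrite (_ : [set: mR] = `]-oo, 0%R] `|` `]0%R, +oo[); last first.
  by apply/seteqP; split=> // x _ /=; rewrite !in_itv/= andbT; by case: (leP x 0) => _; [left|right].
rewrite ge0_integral_setU//.
- apply: lte_add_pinfty => //; apply: le_lt_trans pos.
  apply: ge0_subset_integral => //; first exact: measurable_funTS.
  by move=> x /=; rewrite !in_itv/= !andbT; exact: ltW.
- exact: measurable_funTS.
- rewrite disj_set2E; apply/eqP; rewrite -subset0 => x [] /=; rewrite !in_itv/= andbT.
  by rewrite leNgt => /negP.
Qed.

Lemma rdecay_le (B : R) g x : rdecay B g -> `|g x| <= B * (oneDsqr x)^-1.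
Proof. by move=> gB; rewrite ler_pdivlMr ?gB// (lt_le_trans _ (oneDsqr_ge1 x)). Qed.

Lemma rdecay_integrable (B : R) g : measurable_fun setT (g : mR -> R) ->
  rdecay B g -> mu.-integrable setT (EFin \o (g : mR -> R)).
Proof.
move=> mg gB; apply: le_integrable (integrable_oneDsqrV B) => //.
  exact/measurable_EFinP.
by move=> x _; rewrite lee_fin (le_trans (rdecay_le x gB))// ler_norm.
Qed.

Lemma cintegral_mkcond d (T : measurableType d) (m : {measure set T -> \bar R})
    (D : set T) (F : T -> R[i]) :
  cintegral m D F = cintegral m setT (fun x => if x \in D then F x else 0).
Proof.
apply: complex_eqP; rewrite /= [LHS]Rintegral_mkcond.
  by apply: eq_Rintegral => x _; rewrite /patch; case: ifP.
by apply: eq_Rintegral => x _; rewrite /patch; case: ifP.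
Qed.

(** The windows are half-open so that they can be cut into integer translates of [0, 1[. *)
Lemma cintegral_exhaust (F : mR -> R[i]) : cmeasurable F -> cintegrable mu setT F ->
  ccvg (fun n : nat => cintegral mu `[- n%:R, n%:R[ F) (cintegral mu setT F).
Proof.
move=> mF iF.
pose F_ (n : nat) (x : mR) : R[i] := if x \in (`[- n%:R, n%:R[)%classic then F x else 0.
have F_F (x : mR) : ccvg (F_ ^~ x) (F x).
  have H : \forall n \near \oo, F_ n x = F x.
    near=> n; rewrite /F_ mem_set//= in_itv/=.
    have : `|x| < n%:R by near: n; exact: nbhs_infty_gtr.
    by rewrite ltr_norml => /andP[/ltW -> ->].
  split.
    apply: (@cvg_trans _ (cst (complex.Re (F x)) @ \oo)); last exact: cvg_cst.
    by apply: near_eq_cvg; move: H; apply: filterS => n ->.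
  apply: (@cvg_trans _ (cst (complex.Im (F x)) @ \oo)); last exact: cvg_cst.
  by apply: near_eq_cvg; move: H; apply: filterS => n ->.
have mF_ n : cmeasurable (F_ n).
  have mI : measurable_fun setT (fun x : mR => x \in (`[- n%:R, n%:R[)%classic : bool).
    apply: (measurable_fun_bool true) => /=.
    rewrite setTI (_ : _ @^-1` _ = (`[- n%:R, n%:R[)%classic)//.
    by apply/seteqP; split => y /=; [move=> /set_mem|move=> /mem_set].
  split; [rewrite (_ : (fun x => _) = (fun x : mR => if x \in (`[- n%:R, n%:R[)%classic then complex.Re (F x) else 0))|
    rewrite (_ : (fun x => _) = (fun x : mR => if x \in (`[- n%:R, n%:R[)%classic then complex.Im (F x) else 0))];
    try (by apply/funext => x; rewrite /F_; case: ifP);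
    by case: mF => ? ?; apply: measurable_fun_ifT.
have F_le n x : setT x -> cmodulus (F_ n x) <= `|complex.Re (F x)| + `|complex.Im (F x)|.
  move=> _; rewrite /F_; case: ifP => _; first exact: cmod_le.
  by rewrite cmod0 addr_ge0.
have [_] := dominated_ccvg measurableT mF_ mF (fun x _ => F_F x)
  (cintegrable_cmod measurableT iF) F_le.
by apply: ccvg_ext => n; rewrite [in RHS]cintegral_mkcond.
Unshelve. all: by end_near. Qed.

(** On [-n, n] the integral is G(n) - G(-n), which tends to 0 by the decay of [G]. *)
Lemma integral_derive0 (G g : R -> R) (B : R) :
  (forall x : R, is_derive x (1 : R) G (g x)) -> continuous g ->
  mu.-integrable setT (EFin \o (g : mR -> R)) -> rdecay B G ->
  Rintegral mu setT g = 0.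
Proof.
move=> dG cg ig GB.
have mg : measurable_fun setT (g : mR -> R) by exact: continuous_measurable_fun.
pose F (x : mR) : R[i] := (g x)%:C.
have mF : cmeasurable F by split=> //; exact: measurable_cst.
have iF : cintegrable mu setT F by split=> //; exact: integrable0.
have [c _] := cintegral_exhaust mF iF.
have z : (fun n : nat => G n%:R - G (- n%:R)) @ \oo --> (0 : R).
  rewrite -[X in _ --> X](subr0 0); apply: cvgB.
    apply: norm_cvg0; apply: (@squeeze_cvgr _ _ _ _ (cst 0) (fun K : nat => B * (1 + (K%:R : R) ^+ 2)^-1)).
    - by apply: nearW => n; rewrite normr_ge0 /=; exact: (rdecay_le n%:R GB).
    - exact: cvg_cst.
    - exact: cvg_pinv.
  apply: norm_cvg0; apply: (@squeeze_cvgr _ _ _ _ (cst 0) (fun K : nat => B * (1 + (K%:R : R) ^+ 2)^-1)).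
  - apply: nearW => n; rewrite normr_ge0 /=.
    by have := rdecay_le (- n%:R) GB; rewrite /oneDsqr sqrrN.
  - exact: cvg_cst.
  - exact: cvg_pinv.
have c2 : (fun n : nat => Rintegral mu `[- n%:R, n%:R[ g) @ \oo --> (0 : R).
  apply: cvg_trans z; apply: near_eq_cvg; exists 1%N => // n /= n1.
  rewrite Rintegral_itv_bndo_bndc; last first.
    by apply: (@integrableS _ _ _ mu setT _ (EFin \o (g : mR -> R))).
  rewrite (FTC_Rintegral _ dG cg)//.
  by rewrite ltrNl (@lt_trans _ _ 0)// ?oppr_lt0 ltr0n.
exact: (cvg_unique _ c c2).
Qed.

(** The Fourier transform is handled through real cosine and sine transforms, because [schwartz] is
    a condition on the real and imaginary parts. *)
Definition fcos v (x : R) : R := Rintegral mu setT (fun t : mR => v t * cos (2 * pi * t * x)).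
Definition fsin v (x : R) : R := Rintegral mu setT (fun t : mR => v t * sin (2 * pi * t * x)).

Lemma schwartz_integrable v : real_schwartz v -> mu.-integrable setT (EFin \o (v : mR -> R)).
Proof.
move=> sv; have [B vB] := schwartz_decay sv; apply: (rdecay_integrable (B := B)) => //.
by apply: continuous_measurable_fun; exact: schwartz_continuous.
Qed.

Lemma schwartz_trig_integrable v (c : R -> R) : real_schwartz v -> continuous c ->
  (forall x, `|c x| <= 1) -> mu.-integrable setT (EFin \o (fun t : mR => v t * c t)).
Proof.
move=> sv cc c1; have [B vB] := schwartz_decay sv.
apply: (rdecay_integrable (B := B)).
  apply: measurable_funM; apply: continuous_measurable_fun => //.
  exact: schwartz_continuous.
move=> x; apply: le_trans (vB x); rewrite ler_wpM2r// ?addr_ge0 ?sqr_ge0//.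
by rewrite normrM ler_piMr.
Qed.

Lemma fcos_integrable v x : real_schwartz v ->
  mu.-integrable setT (EFin \o (fun t : mR => v t * cos (2 * pi * t * x))).
Proof.
move=> sv; apply: (schwartz_trig_integrable (c := fun t => cos (2 * pi * t * x))) => //.
  by under eq_fun do rewrite mulrAC; exact: continuous_cosM.
by move=> t; exact: cos_max.
Qed.

Lemma fsin_integrable v x : real_schwartz v ->
  mu.-integrable setT (EFin \o (fun t : mR => v t * sin (2 * pi * t * x))).
Proof.
move=> sv; apply: (schwartz_trig_integrable (c := fun t => sin (2 * pi * t * x))) => //.
  by under eq_fun do rewrite mulrAC; exact: continuous_sinM.
by move=> t; exact: sin_max.
Qed.

(** Differentiation under the integral sign, dominated by |2 pi t v(t)|, which is integrable since t
    v(t) is again Schwartz. The pair [c], [c'] stands for cos and - sin, or for sin and cos. *)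
Lemma trig_transform_derive v (c c' : R -> R) (x : R) : real_schwartz v ->
  (forall k t : R, is_derive t (1 : R) (fun t => c (k * t)) (k * c' (k * t))) ->
  (forall x, mu.-integrable setT (EFin \o (fun t : mR => v t * c (2 * pi * t * x)))) ->
  (forall x, `|c' x| <= 1) ->
  is_derive x (1 : R) (fun x => Rintegral mu setT (fun t : mR => v t * c (2 * pi * t * x)))
    (Rintegral mu setT (fun t : mR => 2 * pi * (t * v t) * c' (2 * pi * t * x))).
Proof.
move=> sv dc ic c1.
pose f (x : R) (t : mR) := v t * c (2 * pi * t * x).
have df (y : R) (t : mR) : is_derive y (1 : R) (f ^~ t) (2 * pi * (t * v t) * c' (2 * pi * t * y)).
  have := @is_deriveZ _ _ _ _ (v t) y 1 _ (dc (2 * pi * t) y).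
  rewrite /GRing.scale /=; congr (is_derive _ _ _ _); ring.
pose G (t : mR) := `|2 * pi * (t * v t)|.
have sw : real_schwartz (fun t => 2 * pi * (t * v t)) by apply: schwartzZ; exact: schwartzX.
have iG : mu.-integrable setT (EFin \o G).
  exact: (integrable_norm (schwartz_integrable sw)).
have Ix : (`](x - 1), (x + 1)[%classic : set R) x.
  by rewrite /= in_itv/=; apply/andP; split; lra.
have H2 (y : R) (t : mR) : (`](x - 1), (x + 1)[%classic : set R) y -> setT t -> derivable (f ^~ t) y 1.
  by move=> _ _; case: (df y t).
have H4 (y : R) (t : mR) : (`](x - 1), (x + 1)[%classic : set R) y -> setT t ->
    `|partial1of2 f y t| <= G t.
  move=> _ _; rewrite /partial1of2 (is_derive_derive1 (df y t)) normrM.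
  by rewrite ler_piMr.
have d := @derivable_under_integral R _ mR mu f setT measurableT x (x - 1) (x + 1)
  Ix (fun y _ => ic y) H2 G (fun=> normr_ge0 _) iG H4.
have e := @differentiation_under_integral R _ mR mu f setT measurableT x (x - 1) (x + 1)
  Ix (fun y _ => ic y) H2 G (fun=> normr_ge0 _) iG H4.
have := derivable_is_derive d; rewrite e.
congr (is_derive _ _ _ _); apply: eq_Rintegral => t _.
by rewrite /partial1of2 (is_derive_derive1 (df x t)).
Qed.

Lemma fcos_derive v (x : R) : real_schwartz v ->
  is_derive x (1 : R) (fcos v) (fsin (fun t => - (2 * pi) * (t * v t)) x).
Proof.
move=> sv.
have := @trig_transform_derive v (@cos R) (fun t => - sin t) x sv _
  (fun x => fcos_integrable x sv) _.
rewrite /fsin.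
have -> : Rintegral mu setT (fun t : mR => 2 * pi * (t * v t) * - sin (2 * pi * t * x)) =
  Rintegral mu setT (fun t : mR => - (2 * pi) * (t * v t) * sin (2 * pi * t * x)).
  by apply: eq_Rintegral => t _; rewrite mulrN !mulNr.
apply; first by move=> k t; rewrite mulrN -mulNr; exact: is_derive_cosM.
by move=> t; rewrite normrN sin_max.
Qed.

Lemma fsin_derive v (x : R) : real_schwartz v ->
  is_derive x (1 : R) (fsin v) (fcos (fun t => 2 * pi * (t * v t)) x).
Proof.
move=> sv; apply: (@trig_transform_derive v (@sin R) (@cos R) x sv).
- by move=> k t; exact: is_derive_sinM.
- by move=> y; exact: fsin_integrable.
- by move=> t; exact: cos_max.
Qed.

Lemma fcos_bound v : real_schwartz v -> exists M, forall x, `|fcos v x| <= M.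
Proof.
move=> sv; exists (Rintegral mu setT (fun t : mR => `|v t|)) => x.
have i := fcos_integrable x sv.
apply: (le_trans (le_normr_Rintegral measurableT i)).
apply: le_Rintegral => //.
- exact: (integrable_norm i).
- exact: (integrable_norm (schwartz_integrable sv)).
- by move=> t _; rewrite normrM ler_piMr// cos_max.
Qed.

Lemma fsin_bound v : real_schwartz v -> exists M, forall x, `|fsin v x| <= M.
Proof.
move=> sv; exists (Rintegral mu setT (fun t : mR => `|v t|)) => x.
have i := fsin_integrable x sv.
apply: (le_trans (le_normr_Rintegral measurableT i)).
apply: le_Rintegral => //.
- exact: (integrable_norm i).
- exact: (integrable_norm (schwartz_integrable sv)).
- by move=> t _; rewrite normrM ler_piMr// sin_max.
Qed.

Lemma is_derive_prod (f g : R -> R) (x a b : R) : is_derive x (1 : R) f a ->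
  is_derive x (1 : R) g b -> is_derive x (1 : R) (fun t => f t * g t) (a * g x + f x * b).
Proof.
move=> df dg; have := @is_deriveM R R f g x 1 _ _ df dg.
by rewrite /GRing.scale /= addrC [g x * a]mulrC.
Qed.

Lemma trig_decay v (c : R -> R) : real_schwartz v -> (forall x, `|c x| <= 1) ->
  exists B, rdecay B (fun t => v t * c t).
Proof.
move=> sv c1; have [B vB] := schwartz_decay sv; exists B => x.
apply: le_trans (vB x); rewrite ler_wpM2r// ?addr_ge0 ?sqr_ge0//.
by rewrite normrM ler_piMr.
Qed.

(** Integration by parts: the derivative of t |-> v(t) sin(2 pi x t) has integral 0. *)
Lemma fcosX v (x : R) : real_schwartz v ->
  x * fcos v x = fsin (fun t => - (2 * pi)^-1 * derive1 v t) x.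
Proof.
move=> sv; have p0 : 2 * pi != 0 :> R by rewrite mulf_neq0// gt_eqF// pi_gt0.
have sv' := schwartz_derive1 sv.
have [B GB] := @trig_decay v (fun t => sin (2 * pi * x * t)) sv (fun t => sin_max _).
have i1 := fsin_integrable x sv'; have i2 := fcos_integrable x sv.
have i3 := integrableZl measurableT (2 * pi * x) i2.
have i4 : mu.-integrable setT (EFin \o (fun t : mR => (2 * pi * x) * (v t * cos (2 * pi * t * x)))).
  by apply: eq_integrable i3.
have i5 := integrableD measurableT i1 i4.
have E : (fun t : R => derive1 v t * sin (2 * pi * x * t) + v t * (2 * pi * x * cos (2 * pi * x * t)))
   = (fun t => derive1 v t * sin (2 * pi * t * x) + 2 * pi * x * (v t * cos (2 * pi * t * x))).
  by apply/funext => t; rewrite ![2 * pi * t * x]mulrAC; congr (_ + _); rewrite mulrCA.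
have := @integral_derive0 (fun t => v t * sin (2 * pi * x * t)) _ B
  (fun t => is_derive_prod (schwartz_is_derive t sv) (is_derive_sinM (2 * pi * x) t)).
rewrite E => /(_ _ _ GB).
have cs : continuous (fun t : R => derive1 v t * sin (2 * pi * t * x) + 2 * pi * x * (v t * cos (2 * pi * t * x))).
  rewrite -E => t; apply: cvgD; apply: cvgM.
  - exact: schwartz_continuous.
  - exact: continuous_sinM.
  - exact: schwartz_continuous.
  - by apply: cvgMl_tmp; exact: continuous_cosM.
move=> /(_ cs); have i5' : mu.-integrable setT (EFin \o (fun t : mR => derive1 v t * sin (2 * pi * t * x) + 2 * pi * x * (v t * cos (2 * pi * t * x)))).
  by apply: eq_integrable i5.
move=> /(_ i5'); rewrite RintegralD// RintegralZl// -/(fcos v x) => H.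
have -> : fsin (fun t => - (2 * pi)^-1 * derive1 v t) x = - (2 * pi)^-1 * fsin (derive1 v) x.
  by rewrite /fsin -RintegralZl//; apply: eq_Rintegral => t _; rewrite mulrA.
apply: (mulfI p0); rewrite mulrA.
by rewrite mulrA mulrN mulfV// mulN1r; move/eqP: H; rewrite addrC addr_eq0 => /eqP ->.
Qed.

(** Integration by parts, with v(t) cos(2 pi x t). *)
Lemma fsinX v (x : R) : real_schwartz v ->
  x * fsin v x = fcos (fun t => (2 * pi)^-1 * derive1 v t) x.
Proof.
move=> sv; have p0 : 2 * pi != 0 :> R by rewrite mulf_neq0// gt_eqF// pi_gt0.
have sv' := schwartz_derive1 sv.
have [B GB] := @trig_decay v (fun t => cos (2 * pi * x * t)) sv (fun t => cos_max _).
have i1 := fcos_integrable x sv'; have i2 := fsin_integrable x sv.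
have i3 := integrableZl measurableT (- (2 * pi * x)) i2.
have i4 : mu.-integrable setT (EFin \o (fun t : mR => (- (2 * pi * x)) * (v t * sin (2 * pi * t * x)))).
  by apply: eq_integrable i3.
have i5 := integrableD measurableT i1 i4.
have E : (fun t : R => derive1 v t * cos (2 * pi * x * t) + v t * (- (2 * pi * x) * sin (2 * pi * x * t)))
   = (fun t => derive1 v t * cos (2 * pi * t * x) + - (2 * pi * x) * (v t * sin (2 * pi * t * x))).
  by apply/funext => t; rewrite ![2 * pi * t * x]mulrAC; congr (_ + _); rewrite mulrCA.
have := @integral_derive0 (fun t => v t * cos (2 * pi * x * t)) _ B
  (fun t => is_derive_prod (schwartz_is_derive t sv) (is_derive_cosM (2 * pi * x) t)).
rewrite E => /(_ _ _ GB).
have cs : continuous (fun t : R => derive1 v t * cos (2 * pi * t * x) + - (2 * pi * x) * (v t * sin (2 * pi * t * x))).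
  rewrite -E => t; apply: cvgD; apply: cvgM.
  - exact: schwartz_continuous.
  - exact: continuous_cosM.
  - exact: schwartz_continuous.
  - by apply: cvgMl_tmp; exact: continuous_sinM.
move=> /(_ cs); have i5' : mu.-integrable setT (EFin \o (fun t : mR => derive1 v t * cos (2 * pi * t * x) + - (2 * pi * x) * (v t * sin (2 * pi * t * x)))).
  by apply: eq_integrable i5.
move=> /(_ i5'); rewrite RintegralD// RintegralZl// -/(fsin v x) => H.
have -> : fcos (fun t => (2 * pi)^-1 * derive1 v t) x = (2 * pi)^-1 * fcos (derive1 v) x.
  by rewrite /fcos -RintegralZl//; apply: eq_Rintegral => t _; rewrite mulrA.
apply: (mulfI p0); rewrite mulrA.
by rewrite mulrA mulfV// mul1r; move/eqP: H; rewrite mulNr subr_eq0 => /eqP H; rewrite -H.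
Qed.

(** Cosine and sine transforms of Schwartz functions, taken together, are closed under
    differentiation and under multiplication by x. The bound on x^m g therefore reduces by induction
    on m to the boundedness of a transform. *)
Lemma schwartz_fcos_fsin v : real_schwartz v ->
  real_schwartz (fcos v) /\ real_schwartz (fsin v).
Proof.
pose S g := exists2 v, real_schwartz v & g = fcos v \/ g = fsin v.
suff H g : S g -> real_schwartz g by move=> sv; split; apply: H; exists v => //; [left|right].
apply: real_schwartz_coind => {g}.
- move=> _ [{}v sv [->|->]].
    exists (fsin (fun t => - (2 * pi) * (t * v t))); last by move=> x; exact: fcos_derive.
    by exists (fun t => - (2 * pi) * (t * v t)); [apply: schwartzZ; exact: schwartzX|right].
  exists (fcos (fun t => 2 * pi * (t * v t))); last by move=> x; exact: fsin_derive.
  by exists (fun t => 2 * pi * (t * v t)); [apply: schwartzZ; exact: schwartzX|left].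
- move=> g m; elim: m g => [|m ih] _ [{}v sv [->|->]].
  + have [M b] := fcos_bound sv; exists M => x; by rewrite expr0 mul1r.
  + have [M b] := fsin_bound sv; exists M => x; by rewrite expr0 mul1r.
  + have sw := schwartzZ (- (2 * pi)^-1) (schwartz_derive1 sv).
    have [|M b] := ih (fsin (fun t => - (2 * pi)^-1 * derive1 v t)).
      by exists (fun t => - (2 * pi)^-1 * derive1 v t) => //; right.
    by exists M => x; rewrite exprSr -mulrA fcosX.
  + have sw := schwartzZ ((2 * pi)^-1) (schwartz_derive1 sv).
    have [|M b] := ih (fcos (fun t => (2 * pi)^-1 * derive1 v t)).
      by exists (fun t => (2 * pi)^-1 * derive1 v t) => //; left.
    by exists M => x; rewrite exprSr -mulrA fsinX.
Qed.

End SchwartzFourier.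

(** * Unfolding integrals over the line to the unit interval *)

Section Unfolding.
Context {R : realType}.
Local Notation mu := (@lebesgue_measure R).
Local Notation mR := (measurableTypeR R).
Local Notation I01 := (`[0%R, 1%R]%classic : set mR).
Local Notation I01o := (`[0%R, 1%R[%classic : set mR).

Definition cdecay (B : R) (F : R -> R[i]) : Prop :=
  forall x, cmodulus (F x) * (1 + x ^+ 2) <= B.

Lemma cdecay_ge0 B F : cdecay B F -> 0 <= B.
Proof. by move=> /(_ 0); apply: le_trans; rewrite mulr_ge0 ?cmod_ge0// addr_ge0// sqr_ge0. Qed.

Lemma cdecay_le B F x : cdecay B F -> cmodulus (F x) <= B * (oneDsqr x)^-1.
Proof. by move=> gB; rewrite ler_pdivlMr ?gB// (lt_le_trans _ (oneDsqr_ge1 x)). Qed.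

Lemma cdecay_cintegrable B F : cmeasurable (F : mR -> R[i]) -> cdecay B F ->
  cintegrable mu setT (F : mR -> R[i]).
Proof.
move=> mF FB; apply: (cintegrable_le measurableT mF (integrable_oneDsqrV B)).
by move=> x _; exact: cdecay_le.
Qed.

(** Quadratic decay at x + y is turned into decay at x, at a cost that depends on y only. *)
Lemma shift_sqr_le (x y : R) : 1 + x ^+ 2 <= (1 + (x + y) ^+ 2) * (2 + 2 * y ^+ 2).
Proof.
have := sqr_ge0 (x + 2 * y); have := sqr_ge0 (y * (x + y)); rewrite !expr2; nra.
Qed.

Lemma cdecay_qbound B F s : cdecay B F ->
  qbound (B * (2 + 2 * s ^+ 2)) (fun n : int => F (n%:~R + s)).
Proof.
move=> FB n.
apply: (@le_trans _ _ (cmodulus (F (n%:~R + s)) * ((1 + (n%:~R + s) ^+ 2) * (2 + 2 * s ^+ 2)))).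
  by apply: ler_wpM2l; [exact: cmod_ge0|exact: shift_sqr_le].
by rewrite mulrA ler_wpM2r// addr_ge0// mulr_ge0// sqr_ge0.
Qed.

Lemma cdecay_qdecay B F s : cdecay B F -> qdecay (fun n : int => F (n%:~R + s)).
Proof. by move=> FB; eexists; exact: cdecay_qbound FB. Qed.

Lemma mpres_cintegral d (T : measurableType d) (m : {measure set T -> \bar R})
  (f : T -> T) (D : set T) (F : T -> R[i]) :
  mpres m f -> measurable D -> cmeasurable F ->
  cintegral m (f @^-1` D) (fun x => F (f x)) = cintegral m D F.
Proof.
move=> pf mD [m1 m2]; rewrite /cintegral /Rintegral; congr (fine _ +i* fine _).
  exact: (mpres_integral (h := fun x => (complex.Re (F x))%:E) pf mD (proj2 (measurable_EFinP _ _) m1)).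
exact: (mpres_integral (h := fun x => (complex.Im (F x))%:E) pf mD (proj2 (measurable_EFinP _ _) m2)).
Qed.

Lemma cintegralS d (T : measurableType d) (m : {measure set T -> \bar R})
    (D E : set T) (F : T -> R[i]) :
  measurable D -> measurable E -> D `<=` E -> cintegrable m E F -> cintegrable m D F.
Proof. by move=> mD mE DE [a b]; split; [apply: integrableS a|apply: integrableS b]. Qed.

Lemma cintegral_setU d (T : measurableType d) (m : {measure set T -> \bar R})
    (D E : set T) (F : T -> R[i]) :
  measurable D -> measurable E -> [disjoint D & E] -> cintegrable m setT F ->
  cintegral m (D `|` E) F = cintegral m D F + cintegral m E F.
Proof.
move=> mD mE DE iF.
have [a b] : cintegrable m (D `|` E) F.
  by apply: cintegralS iF => //; exact: measurableU.
by apply: complex_eqP; rewrite ?cReD ?cImD /= Rintegral_setU.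
Qed.

Lemma itv_shift (m : R) : (fun x : mR => x + m) @^-1` (`[m, m + 1[%classic) = I01o.
Proof. by apply/seteqP; split => x /=; rewrite !in_itv/= => /andP[? ?]; apply/andP; split; lra. Qed.

Lemma cintegral_itv1 (F : mR -> R[i]) (m : R) : cmeasurable F ->
  cintegral mu `[m, m + 1[ F = cintegral mu I01o (fun x => F (x + m)).
Proof.
move=> mF; rewrite -(itv_shift m) (mpres_cintegral (mpres_shift m))//.
Qed.

Lemma cintegral_psumZ (F : mR -> R[i]) (K : nat) : cmeasurable F -> cintegrable mu setT F ->
  cintegral mu `[- K%:R, K%:R[ F =
  cintegral mu I01o (fun x => psumZ (fun m => F (m%:~R + x)) K).
Proof.
move=> mF iF.
have mFm (m : R) : cmeasurable (fun x : mR => F (x + m)).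
  exact: (cmeasurable_comp (proj1 (mpres_shift m))).
have iFm (m : R) : cintegrable mu I01o (fun x => F (x + m)).
  have : cintegrable mu `[m, m + 1[ F by apply: cintegralS iF.
  move=> [a b]; split.
    apply/integrableP; split; first by apply/measurable_EFinP/measurable_funTS; case: (mFm m).
    case/integrableP : a => ma; rewrite -(mpres_ge0_integral (f := (fun x => x + m : mR) : mR -> mR)
      (h := fun x => (`|complex.Re (F x)|)%:E) (mpres_shift m))//.
      by rewrite itv_shift.
    by case: mF => m1 _; apply/measurable_EFinP; apply: measurableT_comp m1.
  apply/integrableP; split; first by apply/measurable_EFinP/measurable_funTS; case: (mFm m).
  case/integrableP : b => mb; rewrite -(mpres_ge0_integral (f := (fun x => x + m : mR) : mR -> mR)
    (h := fun x => (`|complex.Im (F x)|)%:E) (mpres_shift m))//.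
    by rewrite itv_shift.
  by case: mF => _ m1; apply/measurable_EFinP; apply: measurableT_comp m1.
elim: K => [|K ih].
  rewrite oppr0 set_itvco0 (@eq_cintegral R _ _ mu _ _ (fun=> 0)).
    rewrite [RHS](@eq_cintegral R _ _ mu _ _ (fun=> 0)) ?cintegral0//.
    by move=> x _; rewrite psumZ0.
  by move=> x; rewrite inE.
have -> : (`[- K.+1%:R, K.+1%:R[%classic : set mR) =
    (`[- K.+1%:R, - K.+1%:R + 1[ `|` `[- K%:R, K%:R[) `|` `[K%:R, K%:R + 1[.
  have -> : - K.+1%:R + 1 = - K%:R :> R by rewrite -natr1 opprD addrNK.
  have k0 : (0 : R) <= K%:R by [].
  apply/seteqP; split => x /=; rewrite !in_itv/= -natr1.
    move=> /andP[x1 x2]; have [x3|x3] := ltP x (- K%:R); first by left; left; apply/andP; split.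
    by have [x4|x4] := ltP x K%:R; [left; right|right]; apply/andP; split.
  by move=> [[|]|] /andP[? ?]; apply/andP; split; lra.
have k0 : (0 : R) <= K%:R by [].
have d1 : [disjoint (`[- K.+1%:R, - K.+1%:R + 1[ `|` `[- K%:R, K%:R[)%classic &
    (`[K%:R, K%:R + 1[)%classic : set mR].
  clear -k0; rewrite disj_set2E; apply/eqP; rewrite -subset0 => x [] /=; rewrite !in_itv/=.
  by rewrite -natr1 => -[|] /andP[? ?] /andP[? ?]; lra.
have d2 : [disjoint (`[- K.+1%:R, - K.+1%:R + 1[)%classic & (`[- K%:R, K%:R[)%classic : set mR].
  clear -k0; rewrite disj_set2E; apply/eqP; rewrite -subset0 => x [] /=; rewrite !in_itv/=.
  by rewrite -natr1 => /andP[? ?] /andP[? ?]; lra.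
have mU : measurable (`[- K.+1%:R, - K.+1%:R + 1[ `|` `[- K%:R, K%:R[ : set mR).
  exact: measurableU.
transitivity (cintegral mu `[- K.+1%:R, - K.+1%:R + 1[ F + cintegral mu `[- K%:R, K%:R[ F
   + cintegral mu `[K%:R, K%:R + 1[ F).
  apply: (etrans (cintegral_setU mU _ d1 iF)) => //; congr (_ + _).
  refine (@cintegral_setU _ mR mu (`[- K.+1%:R, - K.+1%:R + 1[)%classic (`[- K%:R, K%:R[)%classic F (measurable_itv _) (measurable_itv _) d2 iF).
transitivity (cintegral mu I01o (fun x => F (x + - K.+1%:R)) +
    cintegral mu I01o (fun x => psumZ (fun m => F (m%:~R + x)) K) +
    cintegral mu I01o (fun x => F (x + K%:R))).
  by congr (_ + _ + _); [exact: cintegral_itv1|exact: ih|exact: cintegral_itv1].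
have ip : cintegrable mu I01o (fun x => psumZ (fun m => F (m%:~R + x)) K).
  have -> : (fun x : mR => psumZ (fun m => F (m%:~R + x)) K) =
      (fun x : mR => \sum_(0 <= k < K) (F (x + k%:Z%:~R) + F (x + (- k.+1%:Z)%:~R))).
    by apply/funext => x; rewrite psumZE; apply: eq_bigr => k _; rewrite ![x + _]addrC.
  by apply: cintegrable_sum => // k; exact: cintegrableD.
rewrite -[X in X + _]cintegralD// -cintegralD//; last exact: cintegrableD.
apply: eq_cintegral => x _; rewrite psumZS rmorphN /= [x + _]addrC [x + K%:R]addrC; ring.
Qed.

(** Both sides are limits of the integral of [F] over [-K, K[: the left one by dominated convergence
    of the partial sums on [0, 1], the right one by exhaustion. *)
Lemma cintegral_unfold (F : mR -> R[i]) (B : R) : cmeasurable F -> cdecay B F ->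
  cintegral mu I01 (fun x => csumZ (fun m => F (m%:~R + x))) = cintegral mu setT F.
Proof.
move=> mF FB; have iF := cdecay_cintegrable mF FB.
have B0 := cdecay_ge0 FB.
have mp K : cmeasurable (fun x : mR => psumZ (fun m => F (m%:~R + x)) K).
  have mFm (m : int) : cmeasurable (fun x : mR => F (m%:~R + x)).
    rewrite (_ : (fun x => _) = (fun x => F (x + m%:~R))); last by apply/funext => x; rewrite addrC.
    exact: (cmeasurable_comp (proj1 (mpres_shift _))).
  apply: cmeasurableD; apply: cmeasurable_sum => k _; exact: mFm.
have cp (x : mR) : ccvg (psumZ (fun m => F (m%:~R + x))) (csumZ (fun m => F (m%:~R + x))).
  by apply: qdecay_ccvg; exact: cdecay_qdecay FB.
have ms := cmeasurable_lim mp cp.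
have i1 : mu.-integrable I01 (EFin \o (cst (8 * (B * 4)) : mR -> R)).
  apply: measurable_bounded_integrable => //; first exact: finite_I01.
  by exists `|8 * (B * 4)|; split=> // M M1 x _; rewrite /= ltW.
(* The factor 4 bounds 2 + 2 x^2 on [0, 1], and 8 is the constant for partial sums. *)
have pb n x : I01 x -> cmodulus (psumZ (fun m => F (m%:~R + x)) n) <= 8 * (B * 4).
  rewrite /= in_itv/= => /andP[x0 x1].
  apply: (le_trans (psumZ_bound n (cdecay_qbound x FB))).
  rewrite ler_wpM2l// ler_wpM2l// expr2; nra.
have [_ c1] := dominated_ccvg (mI01 (R := R)) mp ms (fun x _ => cp x) i1 pb.
apply: (ccvg_unique c1).
apply: ccvg_ext (cintegral_exhaust mF iF) => K.
rewrite cintegral_psumZ//.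
have ibd : cintegrable mu I01 (fun x => psumZ (fun m => F (m%:~R + x)) K).
  by apply: (cintegrable_le (mI01 (R := R)) (mp K) i1) => x; exact: pb.
have [a b] := ibd.
apply: complex_eqP => /=; rewrite Rintegral_itv_bndo_bndc//.
  by apply: integrableS a => // x /=; rewrite !in_itv/= => /andP[-> /ltW].
by apply: integrableS b => // x /=; rewrite !in_itv/= => /andP[-> /ltW].
Qed.

End Unfolding.

(** * Theta functions and Poisson summation *)

Section Theta.
Context {R : realType}.
Local Notation mu := (@lebesgue_measure R).
Local Notation mR := (measurableTypeR R).
Local Notation I01 := (`[0%R, 1%R]%classic : set mR).
Local Notation Re := complex.Re.
Local Notation Im := complex.Im.
Implicit Types (u : R -> R[i]) (w : int -> R[i]).

Lemma schwartz_cmeasurable u : schwartz u -> cmeasurable (u : mR -> R[i]).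
Proof.
by move=> [a b]; split; apply: continuous_measurable_fun; exact: schwartz_continuous.
Qed.

Lemma schwartz_cdecay u : schwartz u -> exists B, cdecay B u.
Proof.
move=> [a b]; have [A uA] := schwartz_decay a; have [B uB] := schwartz_decay b.
exists (A + B) => x; apply: le_trans (lerD (uA x) (uB x)); rewrite -mulrDl.
by rewrite ler_wpM2r ?cmod_le// addr_ge0// sqr_ge0.
Qed.

Lemma cschwartzD u v : schwartz u -> schwartz v -> schwartz (fun x => u x + v x).
Proof.
move=> [a b] [a' b']; split.
  by under eq_fun do rewrite cReD; exact: schwartzD.
by under eq_fun do rewrite cImD; exact: schwartzD.
Qed.

Lemma cschwartzZ (k : R[i]) u : schwartz u -> schwartz (fun x => k * u x).
Proof.
move=> [a b]; split.
  rewrite (_ : (fun x => _) = (fun x => Re k * Re (u x) + - Im k * Im (u x))).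
    by apply: schwartzD; exact: schwartzZ.
  by apply/funext => x; rewrite cReM mulNr.
rewrite (_ : (fun x => _) = (fun x => Re k * Im (u x) + Im k * Re (u x))).
  by apply: schwartzD; exact: schwartzZ.
by apply/funext => x; rewrite cImM.
Qed.

(** By the mean value theorem the difference is governed by g' at a point within D of x, so the
    decay of g' there carries over to x up to the factor 2 + 2 D^2. *)
Lemma decay_lipschitz (g g' : R -> R) (B D : R) :
  (forall x : R, is_derive x (1 : R) g (g' x)) -> rdecay B g' ->
  forall x y, `|x - y| <= D ->
    `|g x - g y| * (1 + x ^+ 2) <= B * (2 + 2 * D ^+ 2) * `|x - y|.
Proof.
move=> dg gB.
have cg : continuous g.
  by move=> x; apply: differentiable_continuous; apply/derivable1_diffP; case: (dg x).
(* The weight is taken at a point s of [x, y], so that the estimate serves with either endpoint and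
   covers both orders of the arguments. *)
have H (x y s D' : R) : x < y -> x <= s <= y -> `|x - y| <= D' ->
    `|g x - g y| * (1 + s ^+ 2) <= B * (2 + 2 * D' ^+ 2) * `|x - y|.
  move=> xy sxy xyD.
  have [c cxy gE] := MVT xy (fun t _ => dg t) (continuous_subspaceT cg).
  move: cxy; rewrite in_itv/= => /andP[xc cy].
  rewrite distrC gE normrM [`|x - y|]distrC mulrAC ler_wpM2r//.
  apply: (@le_trans _ _ (`|g' c| * ((1 + c ^+ 2) * (2 + 2 * D' ^+ 2)))); last first.
    by rewrite mulrA ler_wpM2r// addr_ge0// mulr_ge0// sqr_ge0.
  rewrite ler_wpM2l//.
  have := shift_sqr_le s (c - s); rewrite subrKC => /le_trans; apply.
  rewrite ler_wpM2l// ?addr_ge0 ?sqr_ge0// lerD2l ler_wpM2l//.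
  have D0 : 0 <= D' := le_trans (normr_ge0 _) xyD.
  rewrite -real_normK ?num_real// ler_pXn2r ?nnegrE//.
  apply: le_trans xyD; rewrite [leRHS]ltr0_norm ?subr_lt0//.
  by case/andP: sxy => ? ?; rewrite ler_norml; apply/andP; split; lra.
move=> x y xyD; have [xy|yx|<-] := ltgtP x y.
- by apply: H => //; rewrite lexx (ltW xy).
- by rewrite distrC [`|x - y|]distrC; apply: H => //; [rewrite lexx (ltW yx)|rewrite distrC].
- by rewrite !subrr !normr0 mul0r mulr0.
Qed.

Lemma trig_lipschitz (v : R -> R) (k D : R) : real_schwartz v -> exists B,
  forall x y, `|x - y| <= D ->
    `|v x * cos (k * x) - v y * cos (k * y)| * (1 + x ^+ 2) <= B * `|x - y| /\
    `|v x * sin (k * x) - v y * sin (k * y)| * (1 + x ^+ 2) <= B * `|x - y|.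
Proof.
move=> sv; have [B1 vB1] := schwartz_decay sv.
have [B2 vB2] := schwartz_decay (schwartz_derive1 sv).
have dc (x : R) := is_derive_prod (schwartz_is_derive x sv) (is_derive_cosM k x).
have ds (x : R) := is_derive_prod (schwartz_is_derive x sv) (is_derive_sinM k x).
have H (p q : R -> R) : (forall x, `|p x| <= 1) -> (forall x, `|q x| <= 1) ->
    forall k', `|k'| = `|k| ->
    rdecay (B2 + `|k| * B1) (fun x => derive1 v x * p x + v x * (k' * q x)).
  move=> p1 q1 k' kk x.
  apply: (@le_trans _ _ ((`|derive1 v x| + `|k| * `|v x|) * (1 + x ^+ 2))).
    rewrite ler_wpM2r// ?addr_ge0 ?sqr_ge0// (le_trans (ler_normD _ _))// lerD//.
      by rewrite normrM ler_piMr.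
    by rewrite mulrCA !normrM kk ler_wpM2l// ler_piMr.
  by rewrite mulrDl lerD// -mulrA ler_wpM2l.
exists ((B2 + `|k| * B1) * (2 + 2 * D ^+ 2)) => x y xy; split.
  apply: (decay_lipschitz dc) => //.
  by apply: (H (fun x => cos (k * x)) (fun x => sin (k * x)) _ _ (- k)) => [t|t|];
    rewrite ?cos_max ?sin_max ?normrN.
apply: (decay_lipschitz ds) => //.
by apply: (H (fun x => sin (k * x)) (fun x => cos (k * x))) => // t;
    rewrite ?cos_max ?sin_max.
Qed.

(** With this twist, the theta series at (- c, a) times e(- N a c) is the sum of w(n) U(n + N a), a
    function of a of period 1. *)
Definition modulated (c : R) u (y : R) : R[i] := u y * e2pi (- (c * y)).

Lemma modulated_lipschitz u (c D : R) : schwartz u -> exists B,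
  forall x y, `|x - y| <= D ->
    cmodulus (modulated c u x - modulated c u y) * (1 + x ^+ 2) <= B * `|x - y|.
Proof.
move=> [su1 su2]; pose k := - (2 * pi * c).
have [A uA] := trig_lipschitz k D su1; have [B uB] := trig_lipschitz k D su2.
exists (A + B + (B + A)) => x y xy; have [a1 a2] := uA x y xy; have [b1 b2] := uB x y xy.
have kE t : 2 * pi * - (c * t) = k * t by rewrite /k; ring.
apply: (@le_trans _ _ ((`|Re (u x) * cos (k * x) - Re (u y) * cos (k * y)| +
   `|Im (u x) * sin (k * x) - Im (u y) * sin (k * y)| +
   (`|Im (u x) * cos (k * x) - Im (u y) * cos (k * y)| +
   `|Re (u x) * sin (k * x) - Re (u y) * sin (k * y)|)) * (1 + x ^+ 2))); last first.
  by rewrite !mulrDl !lerD.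
rewrite ler_wpM2r// ?addr_ge0 ?sqr_ge0//.
apply: (le_trans (cmod_le _)); rewrite /modulated /e2pi !kE.
rewrite cReD cImD cReN cImN !cReM !cImM /=; apply: lerD.
  rewrite (_ : _ - _ = (Re (u x) * cos (k * x) - Re (u y) * cos (k * y)) -
    (Im (u x) * sin (k * x) - Im (u y) * sin (k * y))); last by ring.
  exact: ler_normB.
rewrite (_ : _ - _ = (Im (u x) * cos (k * x) - Im (u y) * cos (k * y)) +
    (Re (u x) * sin (k * x) - Re (u y) * sin (k * y))); last by ring.
exact: ler_normD.
Qed.

Lemma modulated_cdecay u c B : cdecay B u -> cdecay B (modulated c u).
Proof. by move=> uB x; rewrite cmodM cmod_e2pi mulr1. Qed.

Lemma modulated_cmeasurable u c : schwartz u -> cmeasurable (modulated c u : mR -> R[i]).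
Proof.
move=> su; apply: cmeasurableM; first exact: schwartz_cmeasurable.
rewrite (_ : (fun x => _) = (fun x => e2pi (- c * x))); first exact: cmeasurable_e2piM.
by apply/funext => x; rewrite mulNr.
Qed.

Definition periodic_mod (N : int) w := forall n, w (n + N) = w n.

Lemma periodic_modM N w : periodic_mod N w -> forall n k, w (n + N * k) = w n.
Proof.
move=> pw; have H (j : nat) n : w (n + N * j%:Z) = w n.
  elim: j => [|j ih]; first by rewrite mulr0 addr0.
  by rewrite -addn1 PoszD mulrDr mulr1 addrA pw ih.
move=> n [j|j]; first exact: H.
by rewrite NegzE mulrN -[LHS](H j.+1) subrK.
Qed.

Lemma periodic_mod_bounded N w : N != 0 -> periodic_mod N w ->
  exists C, forall n, cmodulus (w n) <= C.
Proof.
move=> N0 pw; exists (\sum_(j < `|N|%N) cmodulus (w j%:Z)) => n.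
have nN : (n %% N)%Z = `|(n %% N)%Z|%N by rewrite gez0_abs// modz_ge0.
have lt : (`|(n %% N)%Z| < `|N|)%N by rewrite -ltz_nat -nN ltz_mod.
rewrite {1}(divz_eq n N) addrC mulrC (periodic_modM pw) nN.
rewrite (bigD1 (Ordinal lt))//= lerDl sumr_ge0// => i _; exact: cmod_ge0.
Qed.

Definition theta_term (N : int) w u (a c : R) (n : int) : R[i] :=
  w n * u (n%:~R + N%:~R * c) * e2pi (n%:~R * a).

Definition theta (N : int) w u : heis R -> R[i] := fun x =>
  let: (a, c, z) := x in e2pi (N%:~R * z) * csumZ (theta_term N w u a c).

Lemma theta_term_qbound N w u a c B C : cdecay B u -> (forall n, cmodulus (w n) <= C) ->
  qbound (C * (B * (2 + 2 * (N%:~R * c) ^+ 2))) (theta_term N w u a c).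
Proof.
move=> uB wC.
have := qbound_mul (v := fun n => w n * e2pi (n%:~R * a)) (cdecay_qbound (N%:~R * c) uB).
move=> /(_ C) H n; have := H _ n; rewrite /theta_term mulrAC; apply => m.
by rewrite cmodM cmod_e2pi mulr1.
Qed.

Lemma theta_term_qdecay N w u a c : N != 0 -> periodic_mod N w -> schwartz u ->
  qdecay (theta_term N w u a c).
Proof.
move=> N0 pw su; have [C wC] := periodic_mod_bounded N0 pw.
have [B uB] := schwartz_cdecay su; eexists; exact: theta_term_qbound uB wC.
Qed.

(** A translation of c by q is undone by shifting the summation index by N q, a multiple of the
    period of [w]; the phase this produces in a is the one that the group law adds to z. Integral
    translations of a and z only contribute e of integers. *)
Lemma theta_automorphic N w u : N != 0 -> periodic_mod N w -> schwartz u ->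
  automorphic N (theta N w u).
Proof.
move=> N0 pw su; split.
- have E : theta N w u = fun x => e2pi (N%:~R * x.2) * csumZ (theta_term N w u x.1.1 x.1.2).
    by apply/funext => -[[]].
  rewrite E; apply: cmeasurableM.
    by apply: cmeasurable_e2pi; exact: measurable_funM.
  apply: (cmeasurable_lim (F_ := fun (K : nat) (x : heis R) => psumZ (theta_term N w u x.1.1 x.1.2) K)); last first.
    by move=> x; apply: qdecay_ccvg; exact: theta_term_qdecay.
  have m1 : measurable_fun setT (fun x : heis R => x.1.1) by exact: measurableT_comp.
  have m2 : measurable_fun setT (fun x : heis R => x.1.2) by exact: measurableT_comp.
  have mt n : cmeasurable (fun x : heis R => theta_term N w u x.1.1 x.1.2 n).
    apply: cmeasurableM; first apply: cmeasurableM; first exact: cmeasurable_cst.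
      apply: (cmeasurable_comp (f := fun x : heis R => n%:~R + N%:~R * x.1.2 : mR)).
        by apply: measurable_funD => //; exact: measurable_funM.
      exact: schwartz_cmeasurable.
    by apply: cmeasurable_e2pi; exact: measurable_funM.
  by move=> K; apply: cmeasurableD; apply: cmeasurable_sum => k _; exact: mt.
- move=> p q r [[a c] z]; rewrite /heis_mul /theta.
  have -> : e2pi (N%:~R * (r%:~R + z + q%:~R * a)) =
      e2pi (N%:~R * z) * e2pi ((N * q)%:~R * a) :> R[i].
    rewrite -e2piD -[RHS](e2piDint _ (N * r)); congr e2pi; rewrite !rmorphM /=; ring.
  rewrite -mulrA; congr (_ * _).
  have sh := qdecay_shift (- (N * q)) (theta_term_qdecay a c N0 pw su).
  rewrite -[RHS](csumZ_shift (N * q))//; last exact: theta_term_qdecay.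
  rewrite -csumZZ; last exact: theta_term_qdecay.
  congr csumZ; apply/funext => n; rewrite /theta_term (periodic_modM pw) mulrCA -!mulrA.
  congr (_ * (_ * _)); first by congr u; rewrite rmorphD rmorphM /=; ring.
  rewrite -e2piD -[LHS](e2piDint _ (- (n * p))); congr e2pi.
  rewrite rmorphN rmorphD !rmorphM /=; ring.
- move=> a c z; rewrite /theta mulr0 e2pi0 mul1r//.
Qed.

(** The argument of [u] is scaled by N because the sum is unfolded along the classes j + N m, on
    which the weight is constant. *)
Definition schwartz_fourier (N : int) u (x : R) : R[i] :=
  cintegral mu setT (fun t => u (N%:~R * t) * e2pi (- (x * t))).

Lemma schwartz_fourierP N u : N != 0 -> schwartz u -> schwartz (schwartz_fourier N u).
Proof.
move=> N0 [su1 su2].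
have n0 : N%:~R != 0 :> R by rewrite intr_eq0.
have [c1 s1] := schwartz_fcos_fsin (schwartz_scale n0 su1).
have [c2 s2] := schwartz_fcos_fsin (schwartz_scale n0 su2).
have i1 := fun x => fcos_integrable x (schwartz_scale n0 su1).
have i2 := fun x => fcos_integrable x (schwartz_scale n0 su2).
have j1 := fun x => fsin_integrable x (schwartz_scale n0 su1).
have j2 := fun x => fsin_integrable x (schwartz_scale n0 su2).
have eE (x t : R) : e2pi (- (x * t)) = cos (2 * pi * t * x) -i* sin (2 * pi * t * x).
  rewrite /e2pi mulrN cosN sinN; have -> : 2 * pi * (x * t) = 2 * pi * t * x by ring.
  by [].
split.
  rewrite (_ : (fun x => _) = (fun x => fcos (fun t => Re (u (N%:~R * t))) x +
     fsin (fun t => Im (u (N%:~R * t))) x)); first exact: schwartzD.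
  apply/funext => x; rewrite /schwartz_fourier /= /fcos /fsin -RintegralD//.
  by apply: eq_Rintegral => t _; rewrite eE cReM /= mulrN opprK.
rewrite (_ : (fun x => _) = (fun x => fcos (fun t => Im (u (N%:~R * t))) x +
   - 1 * fsin (fun t => Re (u (N%:~R * t))) x)).
  by apply: schwartzD => //; exact: schwartzZ.
apply/funext => x; rewrite /schwartz_fourier /= /fcos /fsin mulN1r -RintegralB//.
by apply: eq_Rintegral => t _; rewrite eE cImM /= mulrN addrC.
Qed.

Definition finite_fourier (N : int) w (l : int) : R[i] :=
  \sum_(j < `|N|%N) w j%:Z * e2pi (l%:~R * j%:R / N%:~R).

Section Poisson.
Variables (N : int) (w : int -> R[i]) (u : R -> R[i]) (c : R).
Hypotheses (N0 : N != 0) (pw : periodic_mod N w) (su : schwartz u).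

Let n0 : N%:~R != 0 :> R. Proof. by rewrite intr_eq0. Qed.
Let U := modulated c u.
Let Phi (x : R) : R[i] := csumZ (fun n => w n * U (n%:~R + N%:~R * x)).

Let Phi_qdecay x : qdecay (fun n => w n * U (n%:~R + N%:~R * x)).
Proof.
have [C wC] := periodic_mod_bounded N0 pw; have [B uB] := schwartz_cdecay su.
by apply: qdecay_mul wC; apply: cdecay_qdecay; exact: modulated_cdecay uB.
Qed.

Let mU (k : R) : cmeasurable (fun x : mR => U (k + N%:~R * x)).
Proof.
apply: (cmeasurable_comp (f := fun x : mR => k + N%:~R * x : mR)).
  by apply: measurable_funD => //; exact: measurable_funM.
exact: modulated_cmeasurable.
Qed.

(** [Phi] is periodic and Lipschitz, as required for pointwise inversion: the terms of Phi x - Phi y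
    decay quadratically with a constant proportional to |x - y|. *)
Lemma Phi_inversion a : ccvg (psumZ (fun l => fourier_coef Phi l * e2pi (l%:~R * a))) (Phi a).
Proof.
have [C wC] := periodic_mod_bounded N0 pw.
have C0 : 0 <= C := le_trans (cmod_ge0 _) (wC 0).
have [B UB] := modulated_lipschitz c `|N%:~R| su.
apply: (@fourier_inversion R Phi (16 * (C * (B * `|N%:~R| * (2 + 2 * `|N%:~R|^+2))) ) a).
- apply: (cmeasurable_lim (F_ := fun (K : nat) (x : mR) => psumZ (fun n => w n * U (n%:~R + N%:~R * x)) K)).
    move=> K; apply: cmeasurableD; apply: cmeasurable_sum => k _;
      by apply: cmeasurableM; [exact: cmeasurable_cst|exact: mU].
  by move=> x; apply: qdecay_ccvg; exact: Phi_qdecay.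
- move=> k x; rewrite /Phi -[RHS](csumZ_shift (N * k))//; congr csumZ; apply/funext => n.
  rewrite (periodic_modM pw); congr (_ * U _); rewrite rmorphD rmorphM /=; ring.
(* The decay in n is uniform only for x in a bounded set, here one period; periodicity then moves
   any x there, and y along with it. *)
- have H (x y : R) : 0 <= x < 1 -> `|x - y| <= 1 ->
    cmodulus (Phi x - Phi y) <= 16 * (C * (B * `|N%:~R| * (2 + 2 * `|N%:~R|^+2))) * `|x - y|.
    move=> /andP[x0 x1] xy; rewrite /Phi -csumZB//.
    rewrite -mulrA; apply: csumZ_bound => n.
    rewrite -mulrBr cmodM -!mulrA; apply: ler_pM => //; first exact: cmod_ge0.
      by rewrite mulr_ge0 ?cmod_ge0// addr_ge0// sqr_ge0.
    set s := n%:~R + N%:~R * x; set t := n%:~R + N%:~R * y.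
    have st : s - t = N%:~R * (x - y) by rewrite /s /t; ring.
    have st1 : `|s - t| <= `|N%:~R : R| by rewrite st normrM ler_piMr.
    have := UB s t st1; rewrite st normrM => h.
    apply: (@le_trans _ _ (cmodulus (U s - U t) * ((1 + s ^+ 2) * (2 + 2 * `|N%:~R| ^+ 2)))).
      rewrite ler_wpM2l ?cmod_ge0//; apply: (le_trans (shift_sqr_le _ (N%:~R * x))).
      rewrite -/s ler_wpM2l// ?addr_ge0 ?sqr_ge0// lerD2l ler_wpM2l//.
      rewrite exprMn real_normK ?num_real// ler_piMr ?sqr_ge0// expr2; nra.
    apply: (@le_trans _ _ (B * (`|N%:~R| * `|x - y|) * (2 + 2 * `|N%:~R| ^+ 2))).
      by rewrite [leLHS]mulrA ler_wpM2r// addr_ge0// mulr_ge0// exprn_ge0.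
    rewrite le_eqVlt; apply/orP; left; apply/eqP; ring.
  move=> x y xy; pose k := Num.floor x.
  have P z : Phi (z + (- k)%:~R) = Phi z.
    rewrite /Phi -[RHS](csumZ_shift (N * - k))//; congr csumZ; apply/funext => n.
    rewrite (periodic_modM pw); congr (_ * U _); rewrite rmorphD rmorphM /=; ring.
  have xyE : x - y = (x + (- k)%:~R) - (y + (- k)%:~R) by ring.
  rewrite -(P x) -(P y) xyE; apply: H; last by rewrite -xyE.
  have := floor_itv x; rewrite -/k rmorphN rmorphD /= => /andP[k1 k2].
  by apply/andP; split; lra.
Qed.

(** The sum over n is split into residue classes mod N. On each of them [w] is constant and the sum
    over m unfolds the integral over [0, 1] to the whole line. *)
Lemma Phi_coef l : fourier_coef Phi l =
  finite_fourier N w l * schwartz_fourier N u (l%:~R + N%:~R * c).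
Proof.
have [B uB] := schwartz_cdecay su; have UB := modulated_cdecay c uB.
have B0 := cdecay_ge0 uB.
have n1 : 1 <= (N%:~R : R) ^+ 2.
  by rewrite -rmorphXn /= ler1z -gtz0_ge1 exprn_even_gt0.
pose v (j : R) (t : mR) : R[i] := U (j + N%:~R * t) * e2pi (- (l%:~R * t)).
have mv j : cmeasurable (v j).
  apply: cmeasurableM; first exact: mU.
  rewrite (_ : (fun x => _) = (fun x => e2pi (- l%:~R * x))); first exact: cmeasurable_e2piM.
  by apply/funext => x; rewrite mulNr.
have vB j : cdecay (B * (2 + 2 * j ^+ 2)) (v j).
  move=> t; rewrite cmodM cmod_e2pi mulr1.
  apply: (@le_trans _ _ (cmodulus (U (j + N%:~R * t)) * ((1 + (j + N%:~R * t) ^+ 2) * (2 + 2 * j ^+ 2)))).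
    apply: ler_wpM2l; first exact: cmod_ge0.
    rewrite [j + _]addrC; apply: le_trans (shift_sqr_le (N%:~R * t) j).
    by rewrite lerD2l exprMn ler_peMl// sqr_ge0.
  by rewrite mulrA ler_wpM2r// ?UB// addr_ge0// mulr_ge0// sqr_ge0.
have E x : Phi x * e2pi (- (l%:~R * x)) =
    \sum_(j < `|N|%N) w j%:Z * csumZ (fun m => v j%:R (m%:~R + x)).
  rewrite /Phi (csumZ_residue N0)// mulr_suml; apply: eq_bigr => j _.
  rewrite -csumZZ; last by eexists; exact: cdecay_qbound (vB _).
  rewrite mulrC -csumZZ; last exact: (qdecay_residue j%:Z N0 (Phi_qdecay x)).
  congr csumZ; apply/funext => m; rewrite (periodic_modM pw) mulrCA; congr (_ * _).
  rewrite mulrC /v; congr (U _ * _).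
    rewrite rmorphD rmorphM /=; ring.
  rewrite -[LHS](e2piDint _ (- (l * m))); congr e2pi; rewrite rmorphN rmorphM /=; ring.
rewrite /fourier_coef; under eq_cintegral do rewrite E.
have ms j : cmeasurable (fun x : mR => csumZ (fun m => v j (m%:~R + x))).
  apply: (cmeasurable_lim (F_ := fun (K : nat) (x : mR) => psumZ (fun m => v j (m%:~R + x)) K)).
    move=> K; have mFm (m : int) : cmeasurable (fun x : mR => v j (m%:~R + x)).
      rewrite (_ : (fun x => _) = (fun x => v j (x + m%:~R))); last by apply/funext => x; rewrite addrC.
      exact: (cmeasurable_comp (proj1 (mpres_shift _))).
    by apply: cmeasurableD; apply: cmeasurable_sum => k _; exact: mFm.
  by move=> x; apply: qdecay_ccvg; exact: cdecay_qdecay (vB j).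
have iv j : cintegrable mu I01 (fun x : mR => csumZ (fun m => v j (m%:~R + x))).
  apply: (cintegrable_bounded (mI01 (R := R)) (B := 16 * (B * (2 + 2 * j ^+ 2) * 4))) => //.
    exact: finite_I01.
  move=> x; rewrite /= in_itv/= => /andP[x0 x1].
  apply: (le_trans (csumZ_bound (cdecay_qbound x (vB j)))).
  rewrite ler_wpM2l// ler_wpM2l//; last by rewrite expr2; nra.
  by rewrite mulr_ge0// addr_ge0// mulr_ge0// sqr_ge0.
rewrite cintegral_sum//; last by move=> j; exact: cintegrableZ.
rewrite /finite_fourier mulr_suml; apply: eq_bigr => j _.
rewrite cintegralZ// (cintegral_unfold (mv _) (vB _)) -mulrA; congr (_ * _).
pose v0 (t : mR) : R[i] := e2pi (l%:~R * j%:R / N%:~R) * (u (N%:~R * t) * e2pi (- ((l%:~R + N%:~R * c) * t))).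
have sE : (fun t => u (N%:~R * t) * e2pi (- ((l%:~R + N%:~R * c) * t))) = v 0.
  apply/funext => t; rewrite /v /U /modulated add0r -mulrA -e2piD; congr (_ * e2pi _); ring.
have i0 : cintegrable mu setT (v 0) by exact: cdecay_cintegrable (vB 0).
rewrite /schwartz_fourier sE -cintegralZ//.
(* Substituting t + j / N for t puts the residue j into the argument of [u] and balances the factor
   e(l j / N) of the finite Fourier transform. *)
rewrite -[RHS](mpres_cintegral (mpres_shift (j%:R / N%:~R)))//; last first.
  by apply: cmeasurableM => //; exact: cmeasurable_cst.
rewrite preimage_setT; apply: eq_cintegral => t _.
rewrite -sE mulrCA -e2piD /v /U /modulated -mulrA -e2piD.
congr (u _ * e2pi _); by field.
Qed.

Lemma poisson a : csumZ (theta_term N w u (- c) a) * e2pi (- (N%:~R * a * c)) =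
  csumZ (theta_term N (finite_fourier N w) (schwartz_fourier N u) a c).
Proof.
transitivity (Phi a).
  rewrite mulrC -csumZZ; last exact: theta_term_qdecay.
  congr csumZ; apply/funext => n; rewrite /theta_term /U /modulated mulrC -!mulrA -e2piD.
  congr (_ * (_ * e2pi _)); ring.
apply/esym/csumZ_ccvg; apply: ccvg_ext (Phi_inversion a) => K.
by rewrite !psumZE; apply: eq_bigr => k _; rewrite !Phi_coef.
Qed.

End Poisson.

Lemma heis_fourier_theta N w u : N != 0 -> periodic_mod N w -> schwartz u ->
  heis_fourier (theta N w u) = theta N (finite_fourier N w) (schwartz_fourier N u).
Proof.
move=> N0 pw su; apply/funext => -[[a c] z] /=; rewrite -(poisson c N0 pw su).
rewrite [RHS]mulrA [RHS]mulrAC -e2piD; congr (e2pi _ * _); ring.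
Qed.

End Theta.

(** * Closedness of the image of W *)

Section Coefficients.
Context {R : realType}.
Local Notation mu := (@lebesgue_measure R).
Local Notation mR := (measurableTypeR R).
Local Notation I01 := (`[0%R, 1%R]%classic : set mR).
Local Notation I01o := (`[0%R, 1%R[%classic : set mR).
Local Notation Re := complex.Re.
Local Notation Im := complex.Im.

(** The window of [psumZ] as a list without repetition, the form in which [bessel] takes its
    frequencies. *)
Definition zrange (K : nat) : seq int :=
  [seq Posz k | k <- iota 0 K] ++ [seq Negz k | k <- iota 0 K].

Lemma uniq_zrange K : uniq (zrange K).
Proof.
rewrite cat_uniq !map_inj_uniq ?iota_uniq//=; last 2 first.
- by move=> i j [].
- by move=> i j [].
by rewrite andbT; apply/hasPn => _ /mapP[j _ ->]; apply/negP => /mapP[i _].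
Qed.

Lemma sum_zrangeS (V : nmodType) (F : int -> V) K :
  \sum_(n <- zrange K.+1) F n = \sum_(n <- zrange K) F n + (F K%:Z + F (- K.+1%:Z)).
Proof.
have E L : \sum_(n <- zrange L) F n =
    \sum_(0 <= k < L) F k%:Z + \sum_(0 <= k < L) F (- k.+1%:Z).
  rewrite /zrange big_cat /= !big_map /index_iota !subn0.
  by congr (_ + _); under [RHS]eq_bigr do rewrite -NegzE.
by rewrite !E !big_nat_recr//= addrACA.
Qed.

Lemma ge0_integral_itv1 (phi : mR -> \bar R) (m : R) : measurable_fun setT phi ->
  (forall x, 0 <= phi x)%E ->
  (\int[mu]_(x in `[m, (m + 1)%R[) phi x = \int[mu]_(x in I01o) phi (x + m)%R)%E.
Proof.
move=> mphi phi0.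
by rewrite -(itv_shift m) (mpres_ge0_integral (f := (fun x => x + m : mR) : mR -> mR) (mpres_shift m)).
Qed.

Lemma ge0_integral_zrange (phi : mR -> \bar R) (K : nat) : measurable_fun setT phi ->
  (forall x, 0 <= phi x)%E ->
  (\int[mu]_(x in `[(- K%:R)%R, K%:R[) phi x =
   \int[mu]_(x in I01o) \sum_(m <- zrange K) phi (x + m%:~R)%R)%E.
Proof.
move=> mphi phi0.
have mphim (m : R) : measurable_fun setT (fun x : mR => phi (x + m)).
  by apply: (measurableT_comp mphi); exact: measurable_shift.
have msum (K' : nat) : measurable_fun setT (fun x : mR => \sum_(m <- zrange K') phi (x + m%:~R)%R)%E.
  by apply: emeasurable_sum => m; exact: mphim.
elim: K => [|K ih].
  rewrite oppr0 set_itvco0 integral_set0 integral0_eq// => x _.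
  by rewrite /zrange big_nil.
have k0 : (0 : R) <= K%:R by [].
have kE : - K.+1%:R + 1 = - K%:R :> R by rewrite -natr1 opprD addrNK.
have -> : (`[- K.+1%:R, K.+1%:R[%classic : set mR) =
    (`[- K.+1%:R, - K.+1%:R + 1[ `|` `[- K%:R, K%:R[) `|` `[K%:R, K%:R + 1[.
  rewrite kE; apply/seteqP; split => x /=; rewrite !in_itv/= -natr1.
    move=> /andP[x1 x2]; have [x3|x3] := ltP x (- K%:R); first by left; left; apply/andP; split.
    by have [x4|x4] := ltP x K%:R; [left; right|right]; apply/andP; split.
  by move=> [[|]|] /andP[? ?]; apply/andP; split; lra.
have d1 : [disjoint (`[- K.+1%:R, - K.+1%:R + 1[ `|` `[- K%:R, K%:R[)%classic &
    (`[K%:R, K%:R + 1[)%classic : set mR].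
  clear -k0; rewrite disj_set2E; apply/eqP; rewrite -subset0 => x [] /=; rewrite !in_itv/=.
  by rewrite -natr1 => -[|] /andP[? ?] /andP[? ?]; lra.
have d2 : [disjoint (`[- K.+1%:R, - K.+1%:R + 1[)%classic & (`[- K%:R, K%:R[)%classic : set mR].
  clear -k0; rewrite disj_set2E; apply/eqP; rewrite -subset0 => x [] /=; rewrite !in_itv/=.
  by rewrite -natr1 => /andP[? ?] /andP[? ?]; lra.
have mU : measurable (`[- K.+1%:R, - K.+1%:R + 1[ `|` `[- K%:R, K%:R[ : set mR).
  exact: measurableU.
refine (etrans (ge0_integral_setU mu mU (measurable_itv _) (measurable_funTS mphi) (fun x _ => phi0 x) d1) _).
refine (etrans (congr1 (fun a => a + _)%E (ge0_integral_setU mu (measurable_itv _) (measurable_itv _) (measurable_funTS mphi) (fun x _ => phi0 x) d2)) _).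
have e1 := ge0_integral_itv1 (- K.+1%:R) mphi phi0.
have e2 := ge0_integral_itv1 (K%:R) mphi phi0.
refine (etrans (congr2 (fun a b => a + b)%E (congr2 (fun a b => a + b)%E e1 ih) e2) _).
have gS (x : mR) : (0 <= \sum_(m <- zrange K) phi (x + m%:~R)%R)%E.
  by apply: sume_ge0 => m _; exact: phi0.
rewrite -ge0_integralD//; try exact: measurable_funTS.
rewrite -ge0_integralD//; try exact: measurable_funTS; last 2 first.
- by move=> x _; rewrite adde_ge0.
- by apply: emeasurable_funD; exact: measurable_funTS.
apply: eq_integral => x _; rewrite sum_zrangeS rmorphN /= addeAC [RHS]addeC.
by congr (_ + _)%E; rewrite addeC.
Qed.

(** The integral over [-K, K[ is the integral over [0, 1[ of a finite sum of translates, at most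
    that of [psi]; these windows exhaust the line. *)
Lemma ge0_unfold_le (phi psi : mR -> \bar R) : measurable_fun setT phi ->
  (forall x, 0 <= phi x)%E -> measurable_fun setT psi -> (forall x, 0 <= psi x)%E ->
  (forall (K : nat) x, (\sum_(m <- zrange K) phi (x + m%:~R)%R <= psi x)%E) ->
  (\int[mu]_x phi x <= \int[mu]_(x in I01) psi x)%E.
Proof.
move=> mphi phi0 mpsi psi0 le.
pose F (K : nat) : set mR := `[(- K%:R)%R, K%:R[%classic.
have ndF : nondecreasing_seq F.
  move=> i j ij; apply/subsetPset => x; rewrite /F /= !in_itv/= => /andP[xi xj].
  have ij' : (i%:R : R) <= j%:R by rewrite ler_nat.
  by apply/andP; split; lra.
have c := @ge0_nondecreasing_set_cvg_integral _ mR R F phi mu ndF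
  (fun=> measurable_itv _) (fun=> measurable_funTS mphi) (fun _ x _ => phi0 x).
have -> : [set: mR] = \bigcup_(K : nat) F K.
  apply/seteqP; split=> // x _; exists (Num.bound `|x|) => //.
  by rewrite /F /= in_itv/=; have := archi_boundP (normr_ge0 x); rewrite ltr_norml => /andP[/ltW -> ->].
rewrite -(cvg_lim _ c)//; apply: lime_le; first by apply/cvg_ex; eexists; exact: c.
apply: nearW => K; rewrite /F ge0_integral_zrange//.
apply: (@le_trans _ _ (\int[mu]_(x in I01o) psi x)%E).
  apply: ge0_le_integral => //.
  - by move=> x _; apply: sume_ge0 => m _; exact: phi0.
  - apply: emeasurable_sum => m; apply: measurable_funTS.
    by apply: (measurableT_comp mphi); exact: measurable_shift.
  - exact: measurable_funTS.
apply: ge0_subset_integral => //; first exact: measurable_funTS.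
by move=> x /=; rewrite !in_itv/= => /andP[-> /ltW].
Qed.

Definition acoef (G : heis R -> R[i]) (n : int) (c : R) : R[i] :=
  fourier_coef (fun a => G (a, c, 0)) n.

Lemma measurable_slice (c z : R) : measurable_fun setT (fun a : mR => (a, c, z) : heis R).
Proof. by do 2 (apply: measurable_fun_pair => //). Qed.

(** Invariance under (0, - m, 0) trades the translation of c by m for the phase e(- N m a). Hence
    the coefficients of index n + N m on one period of c are pieces of a single function of c on the
    line. *)
Lemma acoef_shift N G n (m : int) c : automorphic N G ->
  acoef G n (c + m%:~R) = acoef G (n + N * m) c.
Proof.
move=> [_ iG zG]; apply: eq_cintegral => a _.
have -> : G (a, c + m%:~R, 0) = e2pi (N%:~R * - (m%:~R * a)) * G (a, c, 0).
  rewrite -(iG 0 (- m) 0) /heis_mul -zG; congr (G (_, _, _)); rewrite ?rmorphN /=; ring.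
rewrite mulrAC mulrC -e2piD; congr (_ * e2pi _).
rewrite rmorphD rmorphM /=; ring.
Qed.

(** Tonelli's theorem gives measurability for nonnegative integrands, so [h], cut off to a in
    [0, 1], is split into its positive and negative parts. *)
Lemma measurable_Rintegral_slice (h : mR * mR -> R) : measurable_fun setT h ->
  measurable_fun setT (fun c : mR => Rintegral mu I01 (fun a => h (a, c))).
Proof.
move=> mh.
have mI : measurable (I01 `*` [set: mR]) by apply: measurableX.
have mhI : measurable_fun setT (fun x : mR * mR => (\1_(I01 `*` [set: mR]) x * h x)%:E).
  apply/measurable_EFinP; apply: measurable_funM => //; exact: measurable_indic.
apply: (measurableT_comp (f := @fine R)); first exact: fine_measurable.
pose H (x : mR * mR) : \bar R := (\1_(I01 `*` [set: mR]) x * h x)%:E.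
have mp := measurable_fun_fubini_tonelli_G (m1 := mu) _ (measurable_funepos mhI)
  (fun x => funepos_ge0 _ x).
have mn := measurable_fun_fubini_tonelli_G (m1 := mu) _ (measurable_funeneg mhI)
  (fun x => funeneg_ge0 _ x).
rewrite (_ : (fun c => _) = (fun c =>
  (fubini_G mu H^\+ c - fubini_G mu H^\- c)%E)).
  exact: emeasurable_funB.
apply/funext => c; rewrite integral_mkcond integralE; congr (_ - _)%E.
  apply: eq_integral => a _; rewrite !funeposE /patch /H indicE; congr (maxe _ _).
  case: ifPn => aI; [rewrite mem_set ?mul1r//|rewrite memNset ?mul0r//].
    by split=> //=; rewrite inE in aI.
  by move=> [/= aI' _]; move: aI; rewrite notin_setE.
apply: eq_integral => a _; rewrite !funenegE /patch /H indicE; congr (maxe (- _) _)%E.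
case: ifPn => aI; [rewrite mem_set ?mul1r//|rewrite memNset ?mul0r//].
  by split=> //=; rewrite inE in aI.
by move=> [/= aI' _]; move: aI; rewrite notin_setE.
Qed.

Lemma measurable_pair0 : measurable_fun setT (fun x : mR * mR => (x, 0) : heis R).
Proof. by apply: measurable_fun_pair. Qed.

Lemma acoef_cmeasurable G n : cmeasurable G -> cmeasurable (acoef G n : mR -> R[i]).
Proof.
move=> mG.
have [m1 m2] : cmeasurable (fun x : mR * mR => G (x, 0) * e2pi (- (n%:~R * x.1))).
  apply: cmeasurableM; first exact: (cmeasurable_comp measurable_pair0).
  by apply: cmeasurable_e2pi; apply: measurableT_comp => //; exact: measurable_funM.
split; first exact: (measurable_Rintegral_slice m1).
exact: (measurable_Rintegral_slice m2).
Qed.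

Lemma ccvg_delta (n : int) (x : R[i]) : ccvg (psumZ (fun m => if m == n then x else 0)) x.
Proof.
have H K : (`|n| < K)%N -> psumZ (fun m => if m == n then x else 0) K = x.
  move=> nK; have E : \sum_(m <- zrange K) (if m == n then x else 0) =
      psumZ (fun m => if m == n then x else 0) K.
    elim: K {nK} => [|K ih]; first by rewrite psumZ0 /zrange big_nil.
    by rewrite sum_zrangeS ih psumZS.
  rewrite -E (bigD1_seq n) ?uniq_zrange//=; last first.
    rewrite mem_cat; case: n nK {E} => n nK.
      by apply/orP; left; apply: map_f; rewrite mem_iota.
    apply/orP; right; apply: map_f; rewrite mem_iota /= add0n.
    by apply: leq_trans nK; rewrite /= .
  by rewrite eqxx big1 ?addr0// => m /negbTE ->.
split.
  apply: (@cvg_trans _ (cst (complex.Re x) @ \oo)); last exact: cvg_cst.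
  by apply: near_eq_cvg; exists `|n|%N.+1 => // K /= nK; rewrite H.
apply: (@cvg_trans _ (cst (complex.Im x) @ \oo)); last exact: cvg_cst.
by apply: near_eq_cvg; exists `|n|%N.+1 => // K /= nK; rewrite H.
Qed.

Lemma theta_slice_cintegrable N w u c : N != 0 -> periodic_mod N w -> schwartz u ->
  cintegrable mu I01 (fun a => theta N w u (a, c, 0)).
Proof.
move=> N0 pw su; have [mt _ _] := theta_automorphic N0 pw su.
have [C wC] := periodic_mod_bounded N0 pw; have [B uB] := schwartz_cdecay su.
apply: (cintegrable_bounded (mI01 (R := R))
  (B := 16 * (C * (B * (2 + 2 * (N%:~R * c) ^+ 2))))); first exact: finite_I01.
  exact: (cmeasurable_comp (measurable_slice c 0)).
move=> a _; rewrite /theta mulr0 e2pi0 mul1r.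
by apply: csumZ_bound; exact: theta_term_qbound.
Qed.

(** The theta series is dominated uniformly in a, so it can be integrated term by term, and
    orthogonality leaves the n-th term. *)
Lemma acoef_theta N w u n c : N != 0 -> periodic_mod N w -> schwartz u ->
  acoef (theta N w u) n c = w n * u (n%:~R + N%:~R * c).
Proof.
move=> N0 pw su.
have [C wC] := periodic_mod_bounded N0 pw; have [B uB] := schwartz_cdecay su.
pose F_ (K : nat) (a : mR) : R[i] := psumZ (theta_term N w u a c) K * e2pi (- (n%:~R * a)).
pose F (a : mR) : R[i] := theta N w u (a, c, 0) * e2pi (- (n%:~R * a)).
have [mt _ _] := theta_automorphic N0 pw su.
have mE : cmeasurable (fun a : mR => e2pi (- (n%:~R * a))).
  by apply: cmeasurable_e2pi; apply: measurableT_comp => //; exact: measurable_funM.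
have mtt m : cmeasurable (fun a : mR => theta_term N w u a c m).
  by apply: cmeasurableM; [exact: cmeasurable_cst|exact: cmeasurable_e2piM].
have mF_ K : cmeasurable (F_ K).
  by apply: cmeasurableM => //; apply: cmeasurableD; apply: cmeasurable_sum => k _; exact: mtt.
have mF : cmeasurable F.
  by apply: cmeasurableM => //; exact: (cmeasurable_comp (measurable_slice c 0)).
have qd a := theta_term_qdecay a c N0 pw su.
have F_F a : I01 a -> ccvg (F_ ^~ a) (F a).
  move=> _; apply: ccvgM; last exact: ccvg_cst.
  by rewrite /theta mulr0 e2pi0 mul1r; exact: qdecay_ccvg.
set M := 8 * (C * (B * (2 + 2 * (N%:~R * c) ^+ 2))).
have iM : mu.-integrable I01 (EFin \o (cst M : mR -> R)).
  apply: measurable_bounded_integrable => //; first exact: finite_I01.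
  by exists `|M|; split=> // M' M1 x _; rewrite /= ltW.
have F_M K a : I01 a -> cmodulus (F_ K a) <= M.
  move=> _; rewrite cmodM cmod_e2pi mulr1; apply: psumZ_bound.
  exact: theta_term_qbound.
have [_ c1] := dominated_ccvg (mI01 (R := R)) mF_ mF F_F iM F_M.
apply: (ccvg_unique c1).
apply: ccvg_ext (ccvg_delta n (w n * u (n%:~R + N%:~R * c))) => K.
have it (m : int) : cintegrable mu I01 (fun a => e2pi ((m - n)%:~R * a)).
  apply: (cintegrable_bounded (mI01 (R := R)) (B := 1)); first exact: finite_I01.
    exact: cmeasurable_e2piM.
  by move=> x _; rewrite cmod_e2pi.
have tE (m : int) (a : R) : theta_term N w u a c m * e2pi (- (n%:~R * a)) =
    w m * u (m%:~R + N%:~R * c) * e2pi ((m - n)%:~R * a).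
  by rewrite /theta_term -mulrA -e2piD rmorphB /=; congr (_ * e2pi _); ring.
have FE a : F_ K a = \sum_(0 <= k < K) (w k%:Z * u (k%:Z%:~R + N%:~R * c) * e2pi ((k%:Z - n)%:~R * a)
   + w (- k.+1%:Z) * u ((- k.+1%:Z)%:~R + N%:~R * c) * e2pi ((- k.+1%:Z - n)%:~R * a)).
  by rewrite /F_ psumZE mulr_suml; apply: eq_bigr => k _; rewrite mulrDl !tE.
under eq_cintegral do rewrite FE.
have dE (m : int) : (if m == n then w n * u (n%:~R + N%:~R * c) else 0) =
  cintegral mu I01 (fun a => w m * u (m%:~R + N%:~R * c) * e2pi ((m - n)%:~R * a)).
  rewrite cintegralZ// cintegral_e2pi subr_eq0.
  by have [->|] := eqVneq m n; rewrite ?mulr1 ?mulr0.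
rewrite psumZE cintegral_sum//; last by move=> k; apply: cintegrableD => //; exact: cintegrableZ.
apply: eq_bigr => k _; rewrite !dE cintegralD//; exact: cintegrableZ.
Qed.

Lemma mu_I01 : mu I01 = 1%E.
Proof. by rewrite lebesgue_measure_itv /= lte_fin ltr01 -EFinB subr0. Qed.

Lemma sigma_finite_lebesgue2 : sigma_finite [set: mR * mR] (mu \x mu)%E.
Proof.
pose F (n : nat) : set mR := `[(- n%:R)%R, n%:R[%classic.
exists (fun n => F n `*` F n).
  apply/seteqP; split=> // -[x y] _.
  exists (Num.bound (`|x| + `|y|)) => //.
  have := archi_boundP (addr_ge0 (normr_ge0 x) (normr_ge0 y)); set n := Num.bound _ => xyn.
  have xn : `|x| < n%:R by rewrite (le_lt_trans _ xyn)// lerDl.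
  have yn : `|y| < n%:R by rewrite (le_lt_trans _ xyn)// lerDr.
  by split; [move: xn|move: yn]; rewrite ltr_norml /F /= in_itv/= => /andP[/ltW -> ->].
have finF n : (mu (F n) < +oo)%E.
  by rewrite /F lebesgue_measure_itv /=; case: ifP => // _; rewrite -EFinB ltry.
have mF n : measurable (F n) by exact: measurable_itv.
move=> n; split; first exact: measurableX.
by rewrite product_measure1E//; apply: lte_mul_pinfty => //; rewrite ?ge0_fin_numE//; exact: finF.
Qed.

(** A copy of the plane measure that carries the sigma-finite structure needed to apply Fubini to
    [haar]. *)
Definition lebesgue2 : set (mR * mR)%type -> \bar R := (mu \x mu)%E.
HB.instance Definition _ := Measure.copy lebesgue2 (mu \x mu)%E.
HB.instance Definition _ := @Measure_isSigmaFinite.Build _ _ _ lebesgue2 sigma_finite_lebesgue2.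

(** The modulus of an automorphic function does not depend on z, so the integral over z in [0, 1]
    contributes the factor 1. *)
Lemma sqnorm_cube_slices N (E : heis R -> R[i]) : automorphic N E ->
  sqnorm haar cube E =
  (\int[mu]_(c in I01) \int[mu]_(a in I01) (cnorm2 (E (a, c, 0)))%:E)%E.
Proof.
move=> [mE _ zE]; rewrite sqnormE integral_mkcond.
pose h (p : mR * mR) : R := cnorm2 (E (p, 0)).
have mh : measurable_fun setT h.
  exact: measurable_cnorm2 (cmeasurable_comp measurable_pair0 mE).
pose f (x : heis R) : \bar R := ((h x.1 * \1_(I01 `*` I01) x.1) * \1_I01 x.2)%:E.
have mII : measurable (I01 `*` I01) by exact: measurableX.
have mf : measurable_fun setT f.
  apply/measurable_EFinP; apply: measurable_funM; first apply: measurable_funM.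
  - exact: measurableT_comp.
  - by apply: measurableT_comp => //; exact: measurable_indic.
  - by apply: measurableT_comp => //; exact: measurable_indic.
have f0 x : (0 <= f x)%E.
  by rewrite lee_fin !mulr_ge0// ?cnorm2_ge0.
have -> : ((fun x => (cnorm2 (E x))%:E) \_ cube)%E = f.
  apply/funext => -[[a c] z]; rewrite /patch /f /h /=.
  rewrite zE cnorm2M cnorm2_e2pi mul1r !indicE.
  case: ifPn => xc.
    have [[/= a1 c1] z1] := set_mem xc.
    by rewrite !mem_set ?mulr1//; split.
  have [p1|p1] := boolP ((a, c) \in I01 `*` I01); last by rewrite mulr0 mul0r.
  have [p2|p2] := boolP (z \in I01); last by rewrite !mulr0.
  by move: xc; rewrite mem_set//; split; [exact: set_mem p1|exact: set_mem p2].
have T1 := @fubini_tonelli1 _ _ (mR * mR)%type mR R (@lebesgue2) mu f mf f0.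
refine (etrans T1 _).
have E1 p : (\int[mu]_z f (p, z) = (h p * \1_(I01 `*` I01) p)%:E)%E.
  under eq_integral do rewrite /f /= EFinM.
  have h0 : (0 <= (h p * \1_(I01 `*` I01) p)%:E)%E by rewrite lee_fin mulr_ge0// cnorm2_ge0.
  have mi : measurable_fun setT (fun z : mR => (\1_I01 z : R)%:E).
    by apply/measurable_EFinP; exact: measurable_indic.
  rewrite ge0_integralZl//.
  rewrite integral_indic// setIT -[RHS]mule1; congr (_ * _)%E; exact: mu_I01.
rewrite /fubini_F; under eq_integral do rewrite E1.
pose g (p : mR * mR) : \bar R := (h p * \1_(I01 `*` I01) p)%:E.
have mg : measurable_fun setT g.
  by apply/measurable_EFinP; apply: measurable_funM => //; exact: measurable_indic.
have g0 p : (0 <= g p)%E by rewrite lee_fin mulr_ge0// cnorm2_ge0.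
have T2 := @fubini_tonelli2 _ _ mR mR R mu mu g mg g0.
refine (etrans T2 _); rewrite [RHS]integral_mkcond; apply: eq_integral => c _.
rewrite /fubini_G /patch; case: ifPn => cI.
  rewrite [RHS]integral_mkcond; apply: eq_integral => a _; rewrite /g /patch indicE.
  case: ifPn => aI.
    by rewrite mem_set ?mulr1//; split; exact: set_mem.
  by rewrite memNset ?mulr0// => -[/= aI' _]; move: aI; rewrite notin_setE.
rewrite integral0_eq// => a _; rewrite /g indicE memNset ?mulr0// => -[/= _ cI'].
by move: cI; rewrite notin_setE.
Qed.

End Coefficients.

(** * A lower bound for W and the closedness of its range *)

Section ClosedRange.
Context {R : realType}.
Local Notation mu := (@lebesgue_measure R).
Local Notation mR := (measurableTypeR R).
Local Notation I01 := (`[0%R, 1%R]%classic : set mR).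
Implicit Types (u : R -> R[i]) (w : int -> R[i]) (G : heis R -> R[i]).

Lemma automorphicZ N (k : R[i]) G : automorphic N G -> automorphic N (fun x => k * G x).
Proof.
move=> [mG iG zG]; split.
- by apply: cmeasurableM => //; exact: cmeasurable_cst.
- by move=> p q r g; rewrite iG.
- by move=> a c z; rewrite zG mulrCA.
Qed.

Lemma automorphicD N G H : automorphic N G -> automorphic N H ->
  automorphic N (fun x => G x + H x).
Proof.
move=> [mG iG zG] [mH iH zH]; split.
- exact: cmeasurableD.
- by move=> p q r g; rewrite iG iH.
- by move=> a c z; rewrite zG zH mulrDr.
Qed.

Lemma automorphicB N G H : automorphic N G -> automorphic N H ->
  automorphic N (fun x => G x - H x).
Proof.
move=> aG aH; have := automorphicD aG (automorphicZ (-1) aH).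
by rewrite (_ : (fun x => G x + _) = fun x => G x - H x)//; apply/funext => x; rewrite mulN1r.
Qed.

(** By [acoef_shift], the summands are squared Fourier coefficients, at the distinct frequencies n0
    + N m, of the slice of k theta - G at c = y. *)
Lemma slice_bessel N w u G (k : R[i]) (n0 : int) (K : nat) (y : R) :
  N != 0 -> periodic_mod N w -> schwartz u -> automorphic N G -> w n0 = 1 ->
  (\sum_(m <- zrange K) (cnorm2 (k * u (n0%:~R + N%:~R * (y + m%:~R)) - acoef G n0 (y + m%:~R)))%:E
   <= \int[mu]_(a in I01) (cnorm2 (k * theta N w u (a, y, 0) - G (a, y, 0)))%:E)%E.
Proof.
move=> N0 pw su aG wn0.
have at_ := theta_automorphic N0 pw su.
pose h (a : mR) : R[i] := k * theta N w u (a, y, 0) - G (a, y, 0).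
have [mt _ _] := at_; have [mG _ _] := aG.
have mts : cmeasurable (fun a : mR => theta N w u (a, y, 0)).
  exact: (cmeasurable_comp (measurable_slice y 0)).
have mGs : cmeasurable (fun a : mR => G (a, y, 0)).
  exact: (cmeasurable_comp (measurable_slice y 0)).
have mh : cmeasurable h.
  by apply: cmeasurableB => //; apply: cmeasurableM => //; exact: cmeasurable_cst.
have [hoo|] := ltP (\int[mu]_(a in I01) (cnorm2 (h a))%:E)%E +oo%E; last first.
  by rewrite leye_eq => /eqP hoo; rewrite [leRHS]hoo leey.
have [_ ih] := L2_cintegrable mh hoo.
have it := theta_slice_cintegrable y N0 pw su.
have ikt := cintegrableZ (mI01 (R := R)) k it.
have iG : cintegrable mu I01 (fun a => G (a, y, 0)).
  apply: (eq_cintegrable (mI01 (R := R)) _ (cintegrableB (mI01 (R := R)) ikt ih)) => a _.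
  by rewrite /h opprB addrC subrK.
have E (m : int) : k * u (n0%:~R + N%:~R * (y + m%:~R)) - acoef G n0 (y + m%:~R) =
    fourier_coef h (n0 + N * m).
  rewrite (acoef_shift _ _ _ aG).
  have -> : u (n0%:~R + N%:~R * (y + m%:~R)) = acoef (theta N w u) (n0 + N * m) y.
    rewrite acoef_theta// (periodic_modM pw) wn0 mul1r; congr u.
    rewrite rmorphD rmorphM /=; ring.
  rewrite /acoef /fourier_coef -cintegralZ//; last exact: cintegrable_fourierN.
  rewrite -cintegralB//; last 2 first.
  - by apply: cintegrableZ => //; exact: cintegrable_fourierN.
  - exact: cintegrable_fourierN.
  by apply: eq_cintegral => a _; rewrite /h mulrBl mulrA.
under eq_bigr do rewrite E.
rewrite sumEFin.
have := bessel (r := [seq n0 + N * m | m <- zrange K]) mh.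
rewrite map_inj_uniq ?uniq_zrange; last by move=> i j /addrI /(mulfI N0).
by move=> /(_ isT); rewrite big_map.
Qed.

Lemma measurable_ge0_slice (h : mR * mR -> R) : measurable_fun setT h ->
  (forall p, 0 <= h p) ->
  measurable_fun setT (fun c : mR => \int[mu]_(a in I01) (h (a, c))%:E)%E.
Proof.
move=> mh h0.
have m1 : measurable_fun setT (fun p : mR * mR => (\1_(I01 `*` [set: mR]) p * h p)%:E).
  apply/measurable_EFinP; apply: measurable_funM => //.
  by apply: measurable_indic; exact: measurableX.
have m2 := measurable_fun_fubini_tonelli_G (m1 := mu) _ m1.
rewrite (_ : (fun c => _) =
    fubini_G mu (fun p : mR * mR => (\1_(I01 `*` [set: mR]) p * h p)%:E)).
  by apply: m2 => p; rewrite lee_fin mulr_ge0.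
apply/funext => c; rewrite integral_mkcond; apply: eq_integral => a _.
rewrite /patch indicE; case: ifPn => aI; [rewrite mem_set ?mul1r//|rewrite memNset ?mul0r//].
  by split=> //=; rewrite inE in aI.
by move=> [/= aI' _]; move: aI; rewrite notin_setE.
Qed.

(** The lower bound for W. Substituting x = n0 + N c produces the factor |N|; the integral over c in
    R folds to [0, 1], where the sum over m is bounded by Bessel on each slice. *)
Lemma coefficient_bound N w u G (k : R[i]) (n0 : int) :
  N != 0 -> periodic_mod N w -> schwartz u -> automorphic N G -> w n0 = 1 ->
  (sqnorm mu setT (fun x : mR => (k * u x - acoef G n0 ((x - n0%:~R) / N%:~R))%R) <=
   `|N%:~R|%:E * sqnorm haar cube (fun x => (k * theta N w u x - G x)%R))%E.
Proof.
move=> N0 pw su aG wn0.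
have n_neq0 : N%:~R != 0 :> R by rewrite intr_eq0.
have aE : automorphic N (fun x => k * theta N w u x - G x).
  by apply: automorphicB => //; apply: automorphicZ; exact: theta_automorphic.
rewrite (sqnorm_cube_slices aE) sqnormE.
have [mG _ _] := aG; have mc := acoef_cmeasurable n0 mG.
pose phi (x : mR) : \bar R := (cnorm2 (k * u x - acoef G n0 ((x - n0%:~R) / N%:~R)))%:E.
have msub (a b : R) : measurable_fun setT (fun x : mR => (x - a) / b : mR).
  by apply: measurable_funM => //; exact: measurable_funB.
have mphi : measurable_fun setT phi.
  apply: measurable_cnorm2E; apply: cmeasurableB.
    by apply: cmeasurableM; [exact: cmeasurable_cst|exact: schwartz_cmeasurable].
  exact: (cmeasurable_comp (msub n0%:~R N%:~R)).
have phi0 x : (0 <= phi x)%E by rewrite lee_fin cnorm2_ge0.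
have mphis : measurable_fun setT (fun x : mR => phi (x + n0%:~R)).
  by apply: (measurableT_comp mphi); exact: measurable_shift.
have := mpres_ge0_integral (mpres_shift (n0%:~R : R)) measurableT mphi phi0.
rewrite preimage_setT => phiE; apply: (@le_trans _ _ (\int[mu]_x phi (x + n0%:~R)%R)%E); first by rewrite phiE.
rewrite (ge0_integral_scale n_neq0 mphis (fun x => phi0 _)).
apply: lee_wpmul2l; first by rewrite lee_fin.
have mE2 : measurable_fun setT (fun p : mR * mR => cnorm2 (k * theta N w u (p, 0) - G (p, 0))).
  by case: aE => mE _ _; exact: measurable_cnorm2 (cmeasurable_comp measurable_pair0 mE).
apply: ge0_unfold_le.
- by apply: (measurableT_comp mphis); exact: measurable_funM.
- by move=> x; exact: phi0.
- exact: (measurable_ge0_slice mE2 (fun=> cnorm2_ge0 _)).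
- by move=> y; apply: integral_ge0 => a _; rewrite lee_fin cnorm2_ge0.
- move=> K y; apply: le_trans (slice_bessel k K y N0 pw su aG wn0).
  rewrite le_eqVlt; apply/orP; left; apply/eqP; apply: eq_bigr => m _.
  rewrite /phi addrK mulrAC mulfV// mul1r.
  by rewrite [n0%:~R + _]addrC.
Qed.

Definition ratio_char (N : int) (d : nat) (chi : int -> R[i]) (n : int) : R[i] :=
  ratchar chi (n%:~R * d%:R / N%:~R).

Lemma W_schwartzE N d chi u x :
  W_schwartz N d chi u x = sqrtc (CNd N d) * theta N (ratio_char N d chi) u x.
Proof. by case: x => [[a c] z]; rewrite /W_schwartz /theta mulrA. Qed.

Lemma schwartzc0 : schwartz (fun=> 0 : R[i]).
Proof. by split; exact: schwartz0. Qed.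

Lemma theta0 N w x : theta N w (fun=> 0) x = 0.
Proof.
case: x => [[a c] z]; rewrite /theta (_ : theta_term _ _ _ _ _ = fun=> 0).
  by rewrite csumZ0 mulr0.
by apply/funext => n; rewrite /theta_term mulr0 mul0r.
Qed.

Lemma sqnormZ d (T : measurableType d) (m : {measure set T -> \bar R}) D (k : R[i])
    (F : T -> R[i]) : measurable D -> cmeasurable F ->
  sqnorm m D (fun x => k * F x) = ((cnorm2 k)%:E * sqnorm m D F)%E.
Proof.
move=> mD mF; rewrite !sqnormE; under eq_integral do rewrite cnorm2M EFinM.
rewrite ge0_integralZl//.
- exact: measurable_funTS (measurable_cnorm2E mF).
- by move=> x _; rewrite lee_fin cnorm2_ge0.
- by rewrite lee_fin cnorm2_ge0.
Qed.

Lemma sqnormD_le d (T : measurableType d) (m : {measure set T -> \bar R}) D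
    (F G : T -> R[i]) : measurable D -> cmeasurable F -> cmeasurable G ->
  (sqnorm m D (fun x => F x + G x)%R <= 2%:E * sqnorm m D F + 2%:E * sqnorm m D G)%E.
Proof.
move=> mD mF mG; rewrite !sqnormE.
have m1 := measurable_funTS (D := D) (measurable_cnorm2E mF).
have m2 := measurable_funTS (D := D) (measurable_cnorm2E mG).
have m3 := measurable_funTS (D := D) (measurable_cnorm2E (cmeasurableD mF mG)).
have p H x : (0 <= (cnorm2 (H x : R[i]))%:E)%E by rewrite lee_fin cnorm2_ge0.
rewrite -!ge0_integralZl//; try (by move=> x _; exact: p).
rewrite -ge0_integralD//; try (by move=> x _; rewrite mule_ge0// p);
  try (by apply: measurable_funeM).
apply: ge0_le_integral => //; try (by move=> x _; exact: p).
- by apply: emeasurable_funD; exact: measurable_funeM.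
- by move=> x _; rewrite -!EFinM -EFinD lee_fin cnorm2D_le.
Qed.

(* The function f is recovered from F = W(f) as a Fourier coefficient in the
   variable a, and this recovery is bounded for the L^2 norms, so that the images
   W(v k) can only converge if the v k do. *)
Lemma HNd_closed N d (chi : int -> R[i]) (v : nat -> R -> R[i]) F :
  N != 0 -> periodic_mod N (ratio_char N d chi) ->
  (exists n0, ratio_char N d chi n0 = 1) -> sqrtc (CNd N d) != 0 :> R[i] ->
  (forall k, schwartz (v k)) -> HN N F ->
  sqnorm haar cube (fun x => W_schwartz N d chi (v k) x - F x) @[k --> \oo] --> 0%E ->
  HNd N d chi F.
Proof.
move=> N0 pw [n0 wn0] k0 sv hF vF.
have [G [aG FG finG]] := HN_automorphic hF.
have [mF _] := hF; have [mG _ _] := aG.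
set kap := sqrtc (CNd N d) in k0 *.
(* When [G] is kap times the theta function of u, this is u itself, because the weight at n0 is
   1. *)
pose f (x : mR) : R[i] := kap^-1 * acoef G n0 ((x - n0%:~R) / N%:~R).
have msub (a b : R) : measurable_fun setT (fun x : mR => (x - a) / b : mR).
  by apply: measurable_funM => //; exact: measurable_funB.
have mc : cmeasurable (fun x : mR => acoef G n0 ((x - n0%:~R) / N%:~R)).
  exact: (cmeasurable_comp (msub n0%:~R N%:~R) (acoef_cmeasurable n0 mG)).
have mf : cmeasurable f by apply: cmeasurableM => //; exact: cmeasurable_cst.
have bound u : schwartz u -> (sqnorm mu setT (fun x : mR => u x - f x)%R <=
    (cnorm2 kap^-1)%:E * (`|N%:~R|%:E *
      sqnorm haar cube (fun x => (W_schwartz N d chi u x - F x)%R)))%E.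
  move=> su.
  have mW : cmeasurable (W_schwartz N d chi u).
    rewrite (_ : W_schwartz _ _ _ _ = fun x => kap * theta N (ratio_char N d chi) u x).
      by case: (automorphicZ kap (theta_automorphic N0 pw su)).
    by apply/funext => x; rewrite W_schwartzE.
  rewrite (sqnorm_ae (G := fun x => W_schwartz N d chi u x - G x) measurable_cube); last 3 first.
  - exact: cmeasurableB.
  - exact: cmeasurableB.
  - by move: FG; apply: filterS => x E /E ->.
  have -> : (fun x : mR => u x - f x) =
      fun x => kap^-1 * (kap * u x - acoef G n0 ((x - n0%:~R) / N%:~R)).
    by apply/funext => x; rewrite mulrBr mulKf.
  rewrite sqnormZ//; last first.
    apply: cmeasurableB => //; apply: cmeasurableM; first exact: cmeasurable_cst.
    exact: schwartz_cmeasurable.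
  apply: lee_wpmul2l; first by rewrite lee_fin cnorm2_ge0.
  apply: (le_trans (coefficient_bound kap N0 pw su aG wn0)).
  rewrite (_ : (fun x => _ - G x) = fun x => W_schwartz N d chi u x - G x)//.
  by apply/funext => x; rewrite W_schwartzE.
exists f; split=> //.
- split=> //.
  (* The bound applied to u = 0 says that [f] is square-integrable. *)
  have := bound _ schwartzc0.
  have E1 : sqnorm mu setT (fun x : mR => 0 - f x) = sqnorm mu setT f.
    by rewrite !sqnormE; apply: eq_integral => x _; rewrite sub0r cnorm2N.
  have E2 : sqnorm haar cube (fun x => W_schwartz N d chi (fun=> 0) x - F x) =
      sqnorm haar cube G.
    rewrite -(sqnorm_ae measurable_cube mF mG FG) !sqnormE.
    by apply: eq_integral => x _; rewrite W_schwartzE theta0 mulr0 sub0r cnorm2N.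
  rewrite E1 E2 => /le_lt_trans; apply.
  by do 2 (apply: lte_mul_pinfty => //; rewrite ?lee_fin ?cnorm2_ge0//).
- exists v; split=> //.
  apply: (@squeeze_cvge _ _ _ _ (cst 0%E) _
    (fun k => (cnorm2 kap^-1)%:E * (`|N%:~R|%:E *
      sqnorm haar cube (fun x => (W_schwartz N d chi (v k) x - F x)%R)))%E).
  + apply: nearW => k; rewrite bound// andbT sqnormE.
    by apply: integral_ge0 => x _; rewrite lee_fin cnorm2_ge0.
  + exact: cvg_cst.
  + rewrite -[X in _ --> X](mule0 (cnorm2 kap^-1)%:E); apply: cvgeZl => //.
    by rewrite -[X in _ --> X](mule0 (`|N%:~R : R|)%:E); apply: cvgeZl.
Qed.

Lemma HNdD N d (chi : int -> R[i]) F G :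
  N != 0 -> periodic_mod N (ratio_char N d chi) ->
  (exists n0, ratio_char N d chi n0 = 1) -> sqrtc (CNd N d) != 0 :> R[i] ->
  HNd N d chi F -> HNd N d chi G -> HNd N d chi (fun x => F x + G x).
Proof.
move=> N0 pw wn0 k0 [f [_ hF [u [su _ uF]]]] [g [_ hG [v [sv _ vG]]]].
have [mF _] := hF; have [mG _] := hG.
apply: (HNd_closed (v := fun k x => u k x + v k x)) => //.
- by move=> k; exact: cschwartzD.
- have [F' [aF FF finF]] := HN_automorphic hF; have [G' [aG GG finG]] := HN_automorphic hG.
  have [mF' _ _] := aF; have [mG' _ _] := aG.
  apply: (HN_of_automorphic _ (automorphicD aF aG)); first exact: cmeasurableD.
  + by move: FF GG; apply: filterS2 => x + + xT => /(_ xT) -> /(_ xT) ->.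
  + apply: (le_lt_trans (sqnormD_le _ measurable_cube mF' mG')).
    by apply: lte_add_pinfty; apply: lte_mul_pinfty.
- have mW t : schwartz t -> cmeasurable (W_schwartz N d chi t).
    move=> st; rewrite (_ : W_schwartz _ _ _ _ = fun x => sqrtc (CNd N d) * theta N (ratio_char N d chi) t x).
      by case: (automorphicZ (sqrtc (CNd N d)) (theta_automorphic N0 pw st)).
    by apply/funext => x; rewrite W_schwartzE.
  have WD k x : W_schwartz N d chi (fun x => u k x + v k x) x =
      W_schwartz N d chi (u k) x + W_schwartz N d chi (v k) x.
    rewrite !W_schwartzE -mulrDr; congr (_ * _); case: x => [[a c] z]; rewrite /theta.
    rewrite -mulrDr -csumZD; [|exact: theta_term_qdecay..].
    congr (_ * csumZ _); apply/funext => n; rewrite /theta_term mulrDr mulrDl//.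
  apply: (@squeeze_cvge _ _ _ _ (cst 0%E) _ (fun k =>
    2%:E * sqnorm haar cube (fun x => (W_schwartz N d chi (u k) x - F x)%R) +
    2%:E * sqnorm haar cube (fun x => (W_schwartz N d chi (v k) x - G x)%R))%E).
  + apply: nearW => k; apply/andP; split.
      by rewrite sqnormE; apply: integral_ge0 => x _; rewrite lee_fin cnorm2_ge0.
    rewrite (_ : (fun x => _) = (fun x => (W_schwartz N d chi (u k) x - F x) +
       (W_schwartz N d chi (v k) x - G x))).
      by apply: sqnormD_le; [exact: measurable_cube|apply: cmeasurableB => //; exact: mW..].
    by apply/funext => x; rewrite WD addrACA opprD.
  + exact: cvg_cst.
  + rewrite -[X in _ --> X]adde0; apply: cvgeD => //.
      by rewrite -[X in _ --> X](mule0 (2 : R)%:E); apply: cvgeZl.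
    by rewrite -[X in _ --> X](mule0 (2 : R)%:E); apply: cvgeZl.
Qed.

End ClosedRange.

(** * Projections onto the orbits of units *)

Section Projections.
Context {R : realType}.
Local Notation mu := (@lebesgue_measure R).
Local Notation mR := (measurableTypeR R).
Local Notation I01 := (`[0%R, 1%R]%classic : set mR).
Local Notation I01o := (`[0%R, 1%R[%classic : set mR).
Implicit Types (F G : heis R -> R[i]).

Definition translate (t : R) F : heis R -> R[i] := fun x => F (heis_mul (t, 0, 0) x).

(** The elements (t, 0, 0) and (p, q, r) commute up to the central element (0, 0, q t), which acts
    by e(N q t) = 1 since N t is an integer. *)
Lemma translate_automorphic (N k : int) (t : R) F : N%:~R * t = k%:~R ->
  automorphic N F -> automorphic N (translate t F).
Proof.
move=> Nt [mF iF zF]; split.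
- exact: (cmeasurable_comp (proj1 (mpres_heis_mul _))).
- move=> p q r [[a c] z]; rewrite /translate /heis_mul zF [in RHS]zF.
  have -> : F (t + a, 0 + c, 0) = e2pi (N%:~R * (q%:~R * (t + a))) *
      F (t + (p%:~R + a), 0 + (q%:~R + c), 0).
    rewrite -(iF p q 0) /heis_mul -zF; congr (F (_, _, _)); ring.
  rewrite mulrA -e2piD -[in RHS](e2piDint _ (N * r - q * k)); congr (e2pi _ * _).
  by rewrite rmorphB !rmorphM /= -Nt; ring.
- by move=> a c z; rewrite /translate /heis_mul zF [in RHS]zF mulrA -e2piD; congr (e2pi _ * _); ring.
Qed.

Lemma integral_I01o (h : mR -> \bar R) : measurable_fun setT h ->
  (\int[mu]_(x in I01) h x = \int[mu]_(x in I01o) h x)%E.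
Proof.
by move=> mh; rewrite integral_itv_bndo_bndc//; exact: measurable_funTS.
Qed.

(** The translated interval [t, t + 1[ lies in [0, 2[, that is, in two periods; the crude constant 2
    serves the boundedness of the multipliers. *)
Lemma integral_shift_periodic_le (h : mR -> \bar R) (t : R) : 0 <= t <= 1 ->
  measurable_fun setT h -> (forall x, 0 <= h x)%E -> (forall x, h (x + 1)%R = h x) ->
  (\int[mu]_(x in I01) h (t + x)%R <= 2%:E * \int[mu]_(x in I01) h x)%E.
Proof.
move=> /andP[t0 t1] mh h0 ph.
have mht : measurable_fun setT (fun x : mR => h (t + x)).
  by apply: (measurableT_comp mh); exact: measurable_funD.
rewrite !integral_I01o//.
have -> : (\int[mu]_(x in I01o) h (t + x)%R = \int[mu]_(x in `[t, (t + 1)%R[) h x)%E.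
  by rewrite ge0_integral_itv1//; apply: eq_integral => x _; rewrite addrC.
have I2 : (\int[mu]_(x in `[1%R, (1 + 1)%R[) h x = \int[mu]_(x in I01o) h x)%E.
  by rewrite ge0_integral_itv1//; apply: eq_integral => x _; rewrite ph.
have mI2 : measurable (I01o `|` `[1, 1 + 1[ : set mR) by exact: measurableU.
have dI : [disjoint I01o & (`[1, 1 + 1[%classic : set mR)].
  rewrite disj_set2E; apply/eqP; rewrite -subset0 => x [] /=; rewrite !in_itv/=.
  by move=> /andP[_ x1] /andP[]; rewrite leNgt x1.
have U := ge0_integral_setU mu (measurable_itv _) (measurable_itv _) (measurable_funTS mh)
  (fun x _ => h0 x) dI.
apply: (@le_trans _ _ (\int[mu]_(x in I01o `|` `[1%R, (1 + 1)%R[) h x)%E).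
  apply: ge0_subset_integral => //; first exact: measurable_funTS.
  move=> x /=; rewrite !in_itv/= => /andP[tx xt].
  by have [x1|x1] := ltP x 1; [left|right]; apply/andP; split; lra.
have -> : (2%:E = 1%:E + 1%:E :> \bar R)%E by rewrite -EFinD; congr EFin; ring.
rewrite ge0_muleDl// !mul1e.
move: U => /eqP; rewrite eq_le => /andP[U' _]; refine (le_trans U' _).
by rewrite leeD2l// le_eqVlt; apply/orP; left; apply/eqP; exact: I2.
Qed.

Lemma sqnorm_translate_le N F (t : R) (k : int) : N%:~R * t = k%:~R -> 0 <= t <= 1 ->
  automorphic N F ->
  (sqnorm haar cube (translate t F) <= 2%:E * sqnorm haar cube F)%E.
Proof.
move=> Nt t01 aF; rewrite (sqnorm_cube_slices (translate_automorphic Nt aF)).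
rewrite (sqnorm_cube_slices aF).
have [mF iF zF] := aF.
have mE : measurable_fun setT (fun p : mR * mR => cnorm2 (F (p, 0))).
  exact: measurable_cnorm2 (cmeasurable_comp measurable_pair0 mF).
have mE' : measurable_fun setT (fun p : mR * mR => cnorm2 (translate t F (p, 0))).
  have [mF' _ _] := translate_automorphic Nt aF.
  exact: measurable_cnorm2 (cmeasurable_comp measurable_pair0 mF').
have ms := measurable_ge0_slice mE (fun=> cnorm2_ge0 _).
have ms' := measurable_ge0_slice mE' (fun=> cnorm2_ge0 _).
have i0 (h : mR -> R[i]) : (0 <= \int[mu]_(a in I01) (cnorm2 (h a))%:E)%E.
  by apply: integral_ge0 => a _; rewrite lee_fin cnorm2_ge0.
rewrite -ge0_integralZl//; last exact: measurable_funTS.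
apply: ge0_le_integral => //.
- exact: measurable_funTS.
- by apply: measurable_funeM; exact: measurable_funTS.
- move=> c _.
  apply: le_trans (integral_shift_periodic_le t01 (h := fun a => (cnorm2 (F (a, c, 0)))%:E) _ _ _).
  + rewrite le_eqVlt; apply/orP; left; apply/eqP; apply: eq_integral => a _.
    rewrite /translate /heis_mul mul0r !addr0 add0r//.
  + exact: measurable_cnorm2E (cmeasurable_comp (measurable_slice c 0) mF).
  + by move=> a; rewrite lee_fin cnorm2_ge0.
  + move=> a; congr (cnorm2 _)%:E; rewrite -[RHS](iF 1 0 0) /heis_mul.
    congr (F (_, _, _)); rewrite ?mulr1z; ring.
Qed.

(* On theta functions, the translation of a by k / M multiplies the n-th term by
   e(n k / M), so the combinations realize all multipliers of period M in n. *)
Definition combine (M : nat) (p : nat -> R[i]) F : heis R -> R[i] :=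
  fun x => \sum_(k < M) p k * translate (k%:R / M%:R) F x.

Section Combine.
Variables (N : int) (N0 : N != 0).
Local Notation M := `|N|%N.

Let M0 : M%:R != 0 :> R. Proof. by rewrite pnatr_eq0 absz_eq0. Qed.

Let translate_int (k : nat) : exists j : int, N%:~R * (k%:R / M%:R) = j%:~R :> R.
Proof.
have [Np|Nn] := leP 0 N.
  exists k%:Z; rewrite -[in X in X%:~R * _](gez0_abs Np) -pmulrn.
  by rewrite mulrCA mulfV// mulr1.
exists (- k%:Z); have -> : N = - M%:Z by rewrite ltz0_abs// opprK.
rewrite !rmorphN /= abszN absz_nat -!pmulrn mulNr mulrCA mulfV ?mulr1//.
Qed.

Lemma combine_automorphic p F : automorphic N F -> automorphic N (combine M p F).
Proof.
move=> aF; rewrite /combine; elim: (index_enum _) => [|k r ih].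
  rewrite (_ : (fun x => _) = fun x => 0 * F x); first exact: automorphicZ.
  by apply/funext => x; rewrite big_nil mul0r.
rewrite (_ : (fun x => _) = fun x => p k * translate (k%:R / M%:R) F x +
  \sum_(j <- r) p j * translate (j%:R / M%:R) F x).
  apply: automorphicD => //; apply: automorphicZ.
  by have [j kj] := translate_int k; exact: translate_automorphic kj aF.
by apply/funext => x; rewrite big_cons.
Qed.

Lemma sqnorm_combine_le p : exists2 C : R, 0 <= C & forall F, automorphic N F ->
  (sqnorm haar cube (combine M p F) <= C%:E * sqnorm haar cube F)%E.
Proof.
have s0 F : (0 <= sqnorm haar cube F)%E.
  by rewrite sqnormE; apply: integral_ge0 => x _; rewrite lee_fin cnorm2_ge0.
rewrite /combine; elim: (index_enum _) => [|k r [C C0 ih]].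
  exists 0 => // F aF; rewrite mul0e sqnormE integral0_eq// => x _.
  by rewrite big_nil cnorm2_0.
exists (2 * (cnorm2 (p k) * 2) + 2 * C).
  by rewrite addr_ge0 ?mulr_ge0 ?cnorm2_ge0.
move=> F aF.
have [j kj] := translate_int k.
have at_ := translate_automorphic kj aF.
have [m1 _ _] := automorphicZ (p k) at_.
have m2 : cmeasurable (fun x => \sum_(j <- r) p j * translate (j%:R / M%:R) F x).
  apply: cmeasurable_sum => i _; apply: cmeasurableM; first exact: cmeasurable_cst.
  by have [i' ki] := translate_int i; case: (translate_automorphic ki aF).
rewrite (_ : (fun x => _) = fun x => p k * translate (k%:R / M%:R) F x +
  \sum_(j <- r) p j * translate (j%:R / M%:R) F x); last first.
  by apply/funext => x; rewrite big_cons.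
apply: (le_trans (sqnormD_le _ measurable_cube m1 m2)).
have q1 : (0 <= (2 * (cnorm2 (p k) * 2))%:E)%E by rewrite lee_fin !mulr_ge0// cnorm2_ge0.
have q2 : (0 <= (2 * C)%:E)%E by rewrite lee_fin mulr_ge0.
have -> : ((2 * (cnorm2 (p k) * 2) + 2 * C)%:E * sqnorm haar cube F =
    (2 * (cnorm2 (p k) * 2))%:E * sqnorm haar cube F + (2 * C)%:E * sqnorm haar cube F)%E.
  by rewrite -ge0_muleDl// -EFinD.
apply: leeD.
  rewrite EFinM -muleA; apply: lee_wpmul2l; first by rewrite lee_fin.
  have [mt _ _] := at_; rewrite sqnormZ//; last exact: measurable_cube.
  rewrite EFinM -muleA; apply: lee_wpmul2l; first by rewrite lee_fin cnorm2_ge0.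
  apply: (sqnorm_translate_le kj _ aF).
  rewrite divr_ge0//= ler_pdivrMr ?mul1r ?ler_nat; first exact: ltnW.
  by rewrite ltr0n absz_gt0.
by rewrite EFinM -muleA; apply: lee_wpmul2l; [rewrite lee_fin|exact: ih].
Qed.

Lemma combine_theta p w u x : periodic_mod N w -> schwartz u ->
  combine M p (theta N w u) x =
  theta N (fun n => (\sum_(k < M) p k * e2pi (n%:~R * (k%:R / M%:R))) * w n) u x.
Proof.
move=> pw su; case: x => [[a c] z]; rewrite /combine /translate /heis_mul /theta.
transitivity (e2pi (N%:~R * z) *
    \sum_(k < M) p k * csumZ (theta_term N w u (k%:R / M%:R + a) c)).
  rewrite mulr_sumr; apply: eq_bigr => k _; by rewrite mul0r !add0r addr0 mulrCA.
congr (_ * _).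
have -> : \sum_(k < M) p k * csumZ (theta_term N w u (k%:R / M%:R + a) c) =
    \sum_(k < M) csumZ (fun n => p k * theta_term N w u (k%:R / M%:R + a) c n).
  by apply: eq_bigr => k _; rewrite csumZZ//; exact: theta_term_qdecay.
rewrite -csumZ_sum; last by move=> k; apply: qdecayZ; exact: theta_term_qdecay.
congr csumZ; apply/funext => n; rewrite /theta_term !mulr_suml.
apply: eq_bigr => k _; rewrite mulrDr e2piD; ring.
Qed.

Lemma sum_e2pi (m : int) :
  \sum_(k < M) e2pi (m%:~R * (k%:R / M%:R) : R) = if (N %| m)%Z then M%:R else 0.
Proof.
set q := e2pi (m%:~R / M%:R : R).
have qk (k : nat) : e2pi (m%:~R * (k%:R / M%:R)) = q ^+ k.
  elim: k => [|k ih]; first by rewrite mul0r mulr0 e2pi0.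
  rewrite exprSr -ih -e2piD; congr e2pi; rewrite -natr1; ring.
under eq_bigr do rewrite qk.
have qM : q ^+ M = 1.
  by rewrite -qk mulfV// mulr1 e2pi_int.
have [dm|ndm] := boolP (N %| m)%Z.
  have -> : q = 1.
    have /dvdzP[j mj] : (M%:Z %| m)%Z by rewrite dvdzE absz_nat -dvdzE.
    by rewrite /q mj rmorphM /= -pmulrn mulfK// e2pi_int.
  by under eq_bigr do rewrite expr1n; rewrite sumr_const card_ord.
(* Reducing m modulo |N| gives q = e(x) with 0 < x < 1; then cos(2 pi x) = 1 would force sin(pi x) =
   0. *)
have q1 : q != 1.
  pose r := `|(m %% M)%Z|%N.
  have MZ : M%:Z != 0 by rewrite eqz_nat absz_eq0.
  have rE : (m %% M)%Z = r by rewrite /r [RHS]gez0_abs ?modz_ge0.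
  have r0 : (0 < r)%N.
    rewrite absz_gt0; apply: contra ndm => /eqP rm.
    by rewrite -[(_ %| _)%Z]/((`|N| %| `|m|)%N) -[(_ %| _)%N]/((M%:Z %| m)%Z); apply/dvdz_mod0P.
  have rM : (r < M)%N by rewrite -ltz_nat -rE ltz_pmod// ltz_nat absz_gt0.
  have MR : (0 : R) < M%:R by rewrite ltr0n absz_gt0.
  have -> : q = e2pi (r%:R / M%:R).
    rewrite /q {1}(divz_eq m M) rE rmorphD rmorphM /= -!pmulrn mulrDl mulfK//.
    by rewrite addrC e2piDint.
  set x : R := r%:R / M%:R.
  have x01 : 0 < x < 1.
    apply/andP; split; first by rewrite /x divr_gt0// ltr0n.
    by rewrite /x ltr_pdivrMr// mul1r ltr_nat.
  apply/eqP => /(congr1 (@complex.Re R)); rewrite /e2pi /=.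
  have -> : 2 * pi * x = (pi * x) *+ 2 by rewrite mulr2n; ring.
  rewrite cos_mulr2n => c1.
  have := cos2Dsin2 (pi * x); have : 0 < sin (pi * x).
    apply: sin_gt0_pi; have p0 := pi_gt0 R; case/andP: x01 => x0 x1.
    by rewrite mulr_gt0//= gtr_pMr.
  move=> s0; have := exprn_gt0 2 s0; move: c1; rewrite mulr2n; lra.
have := subrX1 q M; rewrite qM subrr => /esym/eqP; rewrite mulf_eq0 subr_eq0 (negbTE q1) /=.
by move=> /eqP.
Qed.

(** The discrete Fourier coefficients of [psi] on Z / |N|, chosen so that [combine] multiplies the
    n-th term of a theta series by psi n. *)
Definition proj_coef (psi : int -> R[i]) (k : nat) : R[i] :=
  M%:R^-1 * \sum_(j < M) psi j%:Z * e2pi (- (j%:R * (k%:R / M%:R))).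

Let cM0 : M%:R != 0 :> R[i]. Proof. by rewrite pnatr_eq0 absz_eq0. Qed.

Lemma proj_coefE psi n : periodic_mod N psi ->
  \sum_(k < M) proj_coef psi k * e2pi (n%:~R * (k%:R / M%:R)) = psi n.
Proof.
move=> ppsi; rewrite /proj_coef.
transitivity (M%:R^-1 * \sum_(j < M) psi j%:Z *
    \sum_(k < M) e2pi ((n - j%:Z)%:~R * (k%:R / M%:R))).
  under [in RHS]eq_bigr => j _ do rewrite mulr_sumr.
  rewrite [in RHS]exchange_big [RHS]mulr_sumr /=; apply: eq_bigr => k _.
  rewrite -mulrA mulr_suml; congr (_ * _); apply: eq_bigr => j _.
  rewrite -mulrA -e2piD; congr (_ * e2pi _); rewrite rmorphB /=; ring.
under eq_bigr do rewrite sum_e2pi.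
have nN : (n %% N)%Z = `|(n %% N)%Z|%N by rewrite gez0_abs// modz_ge0.
have lt : (`|(n %% N)%Z| < M)%N by rewrite -ltz_nat -nN ltz_mod.
rewrite (bigD1 (Ordinal lt))//= big1 ?addr0.
  rewrite -nN -eqz_mod_dvd modz_mod eqxx mulrC -mulrA mulfV// mulr1.
  by rewrite [in RHS](divz_eq n N) addrC mulrC (periodic_modM ppsi).
move=> j jn; case: ifP => [|_]; last by rewrite mulr0.
rewrite -eqz_mod_dvd => /eqP nj; case/negP: jn; apply/eqP/val_inj => /=.
apply/eqP; rewrite -eqz_nat -nN nj -modz_abs modz_small//.
by have := ltn_ord j; lia.
Qed.

Definition project psi F := combine M (proj_coef psi) F.

Lemma project_theta psi w u x : periodic_mod N psi -> periodic_mod N w -> schwartz u ->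
  project psi (theta N w u) x = theta N (fun n => psi n * w n) u x.
Proof.
move=> ppsi pw su; rewrite /project combine_theta//.
rewrite (_ : (fun n => _ * w n) = fun n => psi n * w n)//.
by apply/funext => n; rewrite proj_coefE.
Qed.

Lemma proj_coef_sum I (r : seq I) (P : pred I) (psi : I -> int -> R[i]) k :
  \sum_(i <- r | P i) proj_coef (psi i) k =
  proj_coef (fun n => \sum_(i <- r | P i) psi i n) k.
Proof.
rewrite /proj_coef -mulr_sumr exchange_big /=; congr (_ * _); apply: eq_bigr => j _.
by rewrite mulr_suml.
Qed.

Lemma project_sum I (r : seq I) (P : pred I) (psi : I -> int -> R[i]) F x :
  \sum_(i <- r | P i) project (psi i) F x =
  project (fun n => \sum_(i <- r | P i) psi i n) F x.
Proof.
rewrite /project /combine exchange_big /=; apply: eq_bigr => k _.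
by rewrite -mulr_suml proj_coef_sum.
Qed.

(** Only the coefficient at k = 0 survives, so this holds pointwise for every function. With
    [project_sum] it decomposes any function along multipliers that sum to 1. *)
Lemma project1 F x : project (fun=> 1) F x = F x.
Proof.
have pE (k : nat) : (k < M)%N -> proj_coef (fun=> 1) k = (k == 0%N)%:R.
  move=> kM; rewrite /proj_coef.
  have -> : \sum_(j < M) 1 * e2pi (- (j%:R * (k%:R / M%:R)) : R) =
      \sum_(j < M) e2pi ((- k%:Z)%:~R * (j%:R / M%:R)).
    apply: eq_bigr => j _; rewrite mul1r; congr e2pi; rewrite rmorphN /= -pmulrn; ring.
  rewrite sum_e2pi dvdzE abszN absz_nat.
  have [->|k0] := eqVneq k 0%N; first by rewrite dvdn0 mulVf.
  by rewrite gtnNdvd ?mulr0// lt0n.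
have M0n : (0 < M)%N by rewrite absz_gt0.
rewrite /project /combine (bigD1 (Ordinal M0n))//= big1 ?addr0.
  rewrite pE// mul1r /translate; case: x => [[a c] z]; rewrite /heis_mul.
  by congr (F (_, _, _)); ring.
by move=> k k0; rewrite pE// (_ : (k == 0%N :> nat) = false) ?mul0r//; apply/negbTE.
Qed.

End Combine.
End Projections.

(** * Characters and isotypic sequences *)

Section Lifting.

Lemma coprimez_absP (m n : int) :
  (forall p : nat, prime p -> (p%:Z %| m)%Z -> (p%:Z %| n)%Z -> False) -> coprimez m n.
Proof.
move=> H; rewrite coprimezE; apply/negPn/negP => ncop.
have g1 : (1 < gcdn `|m| `|n|)%N \/ gcdn `|m| `|n| = 0%N.
  by move: ncop; rewrite /coprime; case: (gcdn _ _) => [|[|k]] //; [right|left].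
have [p pp pg] : exists2 p, prime p & (p %| gcdn `|m| `|n|)%N.
  case: g1 => [g1|->]; first by exists (pdiv (gcdn `|m| `|n|)); [exact: pdiv_prime|exact: pdiv_dvd].
  by exists 2%N.
by move: pg; rewrite dvdn_gcd => /andP[pm pn]; apply: (H p pp).
Qed.

(** For m != 0, t is the part of K prime to m. A prime divisor of K that divides m divides neither t
    nor d; one that does not divide m divides t. In both cases it does not divide m + d t. *)
Lemma coprimez_lift (m d : int) (K : nat) : (0 < K)%N -> coprimez m d ->
  exists t : int, coprimez (m + d * t) K%:Z.
Proof.
move=> K0 cmd; have [m0|m0] := eqVneq m 0.
  exists d; move: cmd; rewrite m0 add0r !coprimezE abszM absz0 /coprime gcd0n => /eqP -> /=.
  by rewrite gcd1n.
have am0 : (0 < `|m|)%N by rewrite absz_gt0.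
exists (partn K (negn \pi(`|m|%N)))%:Z; apply: coprimez_absP => p pp ps pK.
have part (q : nat) : prime q -> (q %| (partn K (negn \pi(`|m|%N))))%N = (q %| K)%N && ~~ (q %| `|m|)%N.
  move=> pq; have := primes_part (negn \pi(`|m|%N)) K => /(congr1 (fun s => q \in s)).
  by rewrite mem_filter !mem_primes part_gt0 K0 pq /= inE /= => ->; rewrite !inE /= mem_primes pq am0 /= andbC.
have [pm|pm] := boolP (p %| `|m|)%N.
  have pm' : (p%:Z %| m)%Z by rewrite dvdzE.
  have : (p%:Z %| d * (partn K (negn \pi(`|m|%N)))%:Z)%Z.
    have -> : d * (partn K (negn \pi(`|m|%N)))%:Z = m + d * (partn K (negn \pi(`|m|%N)))%:Z - m by rewrite addrAC subrr add0r.
    exact: rpredB.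
  rewrite dvdzE abszM /= Euclid_dvdM// part// pm andbF orbF => pd.
  have : (p %| gcdn `|m| `|d|)%N by rewrite dvdn_gcd pm.
  by move: cmd; rewrite coprimezE /coprime => /eqP ->; rewrite dvdn1 => /eqP p1; rewrite p1 in pp.
have : (p%:Z %| m)%Z.
  have -> : m = m + d * (partn K (negn \pi(`|m|%N)))%:Z - d * (partn K (negn \pi(`|m|%N)))%:Z by rewrite addrK.
  apply: rpredB => //.
  by rewrite dvdzE abszM dvdn_mull// part// pm andbT.
by rewrite dvdzE /= (negbTE pm).
Qed.

Lemma coprimez_modP (m n d : int) : (d %| m - n)%Z -> coprimez m d = coprimez n d.
Proof.
move=> /dvdzP[q mn]; rewrite /coprimez gcdzC [in RHS]gcdzC.
have -> : m = q * d + n by rewrite -mn subrK.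
by rewrite gcdzMDl.
Qed.

Lemma coprimez_dvdrz (m n d : int) : (d %| n)%Z -> coprimez m n -> coprimez m d.
Proof. by rewrite dvdzE => dn; apply: coprimez_dvdr. Qed.

End Lifting.

(** * Dirichlet characters and conductors *)

Section Characters.
Context {R : realType}.
Implicit Types chi psi : int -> R[i].

Lemma dirichlet_mod d chi : dirichlet_character d chi ->
  forall m n, (d%:Z %| m - n)%Z -> chi m = chi n.
Proof.
move=> [_ p _ _].
have H m (j : nat) : chi (m + d%:Z * j%:Z) = chi m.
  elim: j => [|j ih]; first by rewrite mulr0 addr0.
  by rewrite -addn1 PoszD mulrDr mulr1 addrA p.
move=> m n /dvdzP[[j|j] mn].
  have -> : m = n + d%:Z * j%:Z by rewrite [d%:Z * _]mulrC -mn addrC subrK.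
  by rewrite H.
have -> : n = m + d%:Z * j.+1%:Z.
  by apply/eqP; rewrite addrC -subr_eq -opprB mn NegzE mulNr opprK mulrC.
by rewrite H.
Qed.

Lemma dirichlet1 d chi : dirichlet_character d chi -> chi 1 = 1.
Proof.
move=> [_ _ m nz]; have c0 : chi 1 != 0 by rewrite nz /gcdz gcd1n.
by apply: (mulfI c0); rewrite -m mulr1 mulr1.
Qed.

Lemma dirichlet_neq0 d chi n : dirichlet_character d chi -> coprimez n d -> chi n != 0.
Proof. by move=> [_ _ _ ->]. Qed.

Lemma dirichlet_eq0 d chi n : dirichlet_character d chi -> ~~ coprimez n d -> chi n = 0.
Proof.
move=> [_ _ _ nz] nc; apply/eqP; rewrite -[_ == _]negbK nz.
by move: nc; rewrite /coprimez.
Qed.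

Lemma dirichletX d chi (n : int) (k : nat) : dirichlet_character d chi ->
  chi (n ^+ k) = chi n ^+ k.
Proof.
move=> hc; have [_ _ m _] := hc; elim: k => [|k ih]; first by rewrite !expr0 (dirichlet1 hc).
by rewrite !exprS m ih.
Qed.

(** By Euler's theorem chi n is a root of unity, hence of modulus 1. *)
Lemma dirichlet_conjM d chi n : dirichlet_character d chi -> coprimez n d ->
  chi n * conj_character chi n = 1.
Proof.
move=> hc cn; have [d0 _ _ _] := hc.
rewrite /conj_character mulcJ.
pose a := `|(n %% d%:Z)%Z|%N.
have dZ : d%:Z != 0 by rewrite eqz_nat -lt0n.
have aE : a%:Z = (n %% d%:Z)%Z by rewrite /a gez0_abs ?modz_ge0.
have na : (d%:Z %| n - a%:Z)%Z by rewrite aE -eqz_mod_dvd modz_mod.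
have ca : coprime a d by move: cn; rewrite (coprimez_modP na) coprimezE.
have cnE : chi n = chi a%:Z := dirichlet_mod hc na.
have ak : chi a%:Z ^+ totient d = 1.
  rewrite -(dirichletX _ _ hc) -(dirichlet1 hc); apply: (dirichlet_mod hc).
  rewrite -eqz_mod_dvd -[a%:Z]natz -natrX natz !modz_nat.
  by rewrite eqz_nat; apply/eqP/Euler_exp_totient.
have t0 : (0 < totient d)%N by rewrite totient_gt0.
have : cnorm2 (chi a%:Z) ^+ totient d = 1.
  have E k (z : R[i]) : cnorm2 (z ^+ k) = cnorm2 z ^+ k.
    elim: k => [|k ih]; last by rewrite !exprS cnorm2M ih.
    by rewrite !expr0 /cnorm2 /= expr1n expr0n addr0.
  by rewrite -E ak /cnorm2 /= expr1n expr0n addr0.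
move/eqP; rewrite pexpr_eq1 ?cnorm2_ge0// => /eqP c1.
by rewrite cnE c1.
Qed.

Lemma dirichlet_conj d chi : dirichlet_character d chi ->
  dirichlet_character d (conj_character chi).
Proof.
move=> [d0 p m nz]; split=> //.
- by move=> n; rewrite /conj_character p.
- by move=> a b; rewrite /conj_character m conjcM.
- by move=> n; rewrite /conj_character conjc_eq0 nz.
Qed.

Lemma conj_characterK chi : conj_character (conj_character chi) = chi.
Proof. by apply/funext => n; rewrite /conj_character conjcK. Qed.

Lemma primitive_conj f chi : primitive_character f chi ->
  primitive_character f (conj_character chi).
Proof.
move=> [hc prim]; split; first exact: dirichlet_conj.
move=> d psi df hpsi cE; apply: (prim d (conj_character psi)) => //.
  exact: dirichlet_conj.
move=> n; have := cE n; rewrite /conj_character /Defs.induced => /(congr1 (@conjc R)).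
by rewrite conjcK => ->; case: (_ == _) => //; rewrite conjc0.
Qed.

Lemma inverse_mod (u : int) (f : nat) : coprimez u f -> exists v : int,
  coprimez v f /\ (f%:Z %| u * v - 1)%Z.
Proof.
move=> /coprimezP[w]; move: w.1 w.2 => a b ab; exists a.
have E : u * a - 1 = - b * f%:Z by rewrite -ab; ring.
split; last by rewrite E dvdz_mull.
apply/coprimezP; exists (u, b) => /=.
by rewrite -ab; ring.
Qed.

(* A primitive character mod f that is trivial on the units mod N congruent to 1
   mod d is induced from a character mod gcd(d, f). *)
Lemma conductor_dvd (N : nat) (f d : nat) psi : (0 < N)%N -> (f %| N)%N -> (d %| N)%N ->
  primitive_character f psi ->
  (forall v : int, coprimez v N -> (d%:Z %| v - 1)%Z -> psi v = 1) -> (f %| d)%N.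
Proof.
move=> N0 fN dN [hc prim] triv.
have [f0 _ mul nz] := hc.
have d0 : (0 < d)%N := dvdn_gt0 N0 dN.
pose g := gcdn d f.
have g0 : (0 < g)%N by rewrite gcdn_gt0 d0.
have gf : (g%:Z %| f%:Z)%Z by rewrite dvdzE dvdn_gcdr.
have gd : (g%:Z %| d%:Z)%Z by rewrite dvdzE dvdn_gcdl.
(* With g = a d + b f and u = 1 + s g, the number x = 1 + a d s is 1 mod d and u mod f. Lifting it
   within its class mod d f to a unit mod N keeps both congruences, so the triviality assumption
   applies. *)
have i1 u : coprimez u f -> (g%:Z %| u - 1)%Z -> psi u = 1.
  move=> cu /dvdzP[s us].
  have [a [b ab]] := Bezoutz d f.
  have gE : gcdz d f = g by [].
  rewrite gE in ab.
  pose x := 1 + a * d%:Z * s.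
  have xd : (d%:Z %| x - 1)%Z by rewrite /x addrC addKr mulrAC dvdz_mull.
  have ux : u - x = b * s * f%:Z.
    have -> : u = s * g%:Z + 1 by rewrite -us subrK.
    by rewrite -ab /x; ring.
  have xf : (f%:Z %| u - x)%Z by rewrite ux dvdz_mull.
  have cxd : coprimez x d by rewrite (coprimez_modP xd) /coprimez /gcdz gcd1n.
  have cxf : coprimez x f by rewrite -(coprimez_modP xf).
  have [t ct] := coprimez_lift N0 (m := x) (d := d%:Z * f%:Z) ltac:(by rewrite coprimezMr cxd).
  have vf : (f%:Z %| x + d%:Z * f%:Z * t - u)%Z.
    have -> : x + d%:Z * f%:Z * t - u = f%:Z * (d%:Z * t - b * s).
      by rewrite -[u](subrK x) ux; ring.
    exact: dvdz_mulr.
  rewrite -(dirichlet_mod hc vf); apply: triv => //.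
  have -> : x + d%:Z * f%:Z * t - 1 = d%:Z * (a * s + f%:Z * t) by rewrite /x; ring.
  exact: dvdz_mulr.
have i3 u u' : coprimez u f -> coprimez u' f -> (g%:Z %| u - u')%Z -> psi u = psi u'.
  move=> cu cu' uu'; have [v [cv u'v]] := inverse_mod cu'.
  have v0 := dirichlet_neq0 hc cv.
  apply: (mulIf v0); rewrite -!mul.
  rewrite (dirichlet_mod hc u'v) (dirichlet1 hc); apply: i1.
    by rewrite coprimezMl cu cv.
  have -> : u * v - 1 = (u - u') * v + (u' * v - 1) by ring.
  by rewrite rpredD ?dvdz_mulr//; exact: dvdz_trans gf u'v.
(* A character mod g is obtained by evaluating [psi] at a lift to a unit mod f; [i3] makes the value
   independent of the lift. *)
have lift n : exists l : int, coprimez n g -> coprimez l f /\ (g%:Z %| l - n)%Z.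
  have [cn|] := boolP (coprimez n g); last by exists 0.
  have [t ct] := coprimez_lift f0 cn; exists (n + g%:Z * t) => _; split=> //.
  by rewrite addrC addKr dvdz_mulr.
have [L LP] := choice lift.
pose psi' n := if coprimez n g then psi (L n) else 0.
have hpsi' : dirichlet_character g psi'.
  split=> //.
  - move=> n; rewrite /psi'.
    have ng : (g%:Z %| n + g%:Z - n)%Z by rewrite addrC addKr dvdzz.
    rewrite (coprimez_modP ng); case: ifP => // cn.
    have [c1 e1] := LP _ cn; have [|c2 e2] := LP (n + g%:Z); first by rewrite (coprimez_modP ng).
    apply: i3 => //; have -> : L (n + g%:Z) - L n = (L (n + g%:Z) - (n + g%:Z)) - (L n - n) + g%:Z by ring.
    by rewrite rpredD ?dvdzz// rpredB.
  - move=> m n; rewrite /psi' coprimezMl.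
    case cm: (coprimez m g); case cn: (coprimez n g); rewrite /= ?mulr0 ?mul0r//.
    have [c1 e1] := LP _ cm; have [c2 e2] := LP _ cn.
    have [|c3 e3] := LP (m * n); first by rewrite coprimezMl cm cn.
    rewrite -mul; apply: i3 => //; first by rewrite coprimezMl c1 c2.
    have -> : L (m * n) - L m * L n = (L (m * n) - m * n) - ((L m - m) * L n + (L n - n) * m) by ring.
    by rewrite rpredB// rpredD// dvdz_mulr.
  - move=> n; rewrite /psi' -/(coprimez n g); case: ifP => [cn|]; last by rewrite eqxx.
    by have [c1 _] := LP _ cn; rewrite (dirichlet_neq0 hc c1).
have gE : g = f.
  apply: (prim g psi') => //.
  move=> n; rewrite /Defs.induced -/(coprimez n f); case: ifP => [cn|/negbT ncn].
    have cng : coprimez n g := coprimez_dvdrz gf cn.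
    by rewrite /psi' cng; have [c1 e1] := LP _ cng; apply: i3 => //; rewrite -opprB rpredN.
  exact: (dirichlet_eq0 hc ncn).
by rewrite -gE dvdn_gcdl.
Qed.

End Characters.

(** * Sequences that transform by a character under the units mod N *)

Section Isotypic.
Context {R : realType}.
Implicit Types (chi psi w : int -> R[i]).

Lemma ratio_charE (N e : int) (d : nat) chi n : N = e * d%:Z -> N != 0 ->
  ratio_char N d chi n = if (e %| n)%Z then chi (n %/ e)%Z else 0.
Proof.
move=> NE N0; have [e0 d0] : e != 0 /\ d%:Z != 0.
  by move: N0; rewrite NE mulf_eq0 negb_or => /andP[].
rewrite /ratio_char /ratchar.
have -> : n%:~R * d%:R / N%:~R = n%:~R / e%:~R :> rat.
  rewrite NE intrM -[d%:R]/(d%:Z%:~R) -mulf_div divff ?mulr1//.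
  by rewrite intr_eq0.
have e0Q : e%:~R != 0 :> rat by rewrite intr_eq0.
have [/dvdzP[q ->]|ne] := boolP (e %| n)%Z.
  by rewrite intrM mulfK// intr_int numq_int mulzK.
case: ifP => // /intrP[q qE].
move: ne; suff -> : n = q * e by rewrite dvdz_mull// dvdzz.
by apply/eqP; rewrite -(eqr_int rat) intrM -qE divfK.
Qed.

Definition isotypic (N : int) chi w := periodic_mod N w /\
  forall v n, coprimez v N -> w (v * n) = chi v * w n.

Lemma sum_mod_unit (N v : int) (h : int -> R[i]) : N != 0 -> periodic_mod N h ->
  coprimez v N -> \sum_(j < `|N|%N) h (v * j%:Z) = \sum_(j < `|N|%N) h j%:Z.
Proof.
move=> N0 ph cv; have K0 : (0 < `|N|)%N by rewrite absz_gt0.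
have lt (j : int) : (`|(j %% N)%Z| < `|N|)%N by rewrite -ltz_nat gez0_abs ?modz_ge0// abszE ltz_mod.
pose s (j : 'I_`|N|%N) := Ordinal (lt (v * j%:Z)).
have sE j : (s j)%:Z = (v * j%:Z %% N)%Z by rewrite /= gez0_abs ?modz_ge0.
have sI : injective s.
  move=> i j /(congr1 (fun k : 'I__ => k%:Z)); rewrite !sE => /eqP.
  rewrite eqz_mod_dvd -mulrBr Gauss_dvdzr; last by rewrite coprimez_sym.
  rewrite -eqz_mod_dvd => /eqP; rewrite -(modz_abs i) -(modz_abs j) !modz_nat !modn_small// => -[ij].
  exact: val_inj.
rewrite [RHS](reindex_inj sI); apply: eq_bigr => j _; rewrite sE.
by rewrite {1}(divz_eq (v * j%:Z) N) addrC [_ * N]mulrC periodic_modM.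
Qed.

(** Substituting v j for j in the finite Fourier sum gives w^(l) = chi(v) w^(v l), and the inverse
    of chi(v) is its conjugate. *)
Lemma isotypic_finite_fourier (N : int) (f : nat) chi w : N != 0 -> (f%:Z %| N)%Z ->
  dirichlet_character f chi -> isotypic N chi w ->
  isotypic N (conj_character chi) (finite_fourier N w).
Proof.
move=> N0 fN hc [pw iw]; have NR : N%:~R != 0 :> R by rewrite intr_eq0.
have per (l n k : int) : e2pi (l%:~R * (n + N * k)%:~R / N%:~R) = e2pi (l%:~R * n%:~R / N%:~R) :> R[i].
  rewrite intrD intrM (_ : _ * _ / _ = l%:~R * n%:~R / N%:~R + (l * k)%:~R) ?e2piDint//.
  by rewrite intrM; field.
split=> [l|v l cv].
  rewrite /finite_fourier; apply: eq_bigr => j _; congr (_ * _).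
  by have := per j l 1; rewrite mulr1 ![_ * j%:R]mulrC => ->.
have cf : coprimez v f := coprimez_dvdrz fN cv.
pose h j := w j * e2pi (l%:~R * j%:~R / N%:~R).
have hE : finite_fourier N w l = chi v * finite_fourier N w (v * l).
  rewrite /finite_fourier big_distrr /=.
  transitivity (\sum_(j < `|N|%N) h j%:Z); first by [].
  rewrite -(sum_mod_unit (h := h) N0 _ cv); last first.
    by move=> n; rewrite /h pw; congr (_ * _); rewrite -[N in n + N]mulr1 per.
  apply: eq_bigr => j _; rewrite /h iw// -[LHS]mulrA.
  by rewrite (_ : l%:~R * (v * j)%:~R = (v * l)%:~R * j%:R)// !intrM mulrCA mulrA.
by rewrite hE mulrA [_ * chi v]mulrC (dirichlet_conjM hc cf) mul1r.
Qed.

Lemma isotypic_ratio_char (N e : int) (d f : nat) psi : N != 0 -> N = e * d%:Z -> (f %| d)%N ->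
  dirichlet_character f psi -> isotypic N psi (ratio_char N d (Defs.induced d psi)).
Proof.
move=> N0 NE fd hc; have [e0 d0] : e != 0 /\ d%:Z != 0.
  by move: (N0); rewrite NE mulf_eq0 negb_or => /andP[].
have [_ _ mul _] := hc.
split=> [n|v n cv]; rewrite !(ratio_charE _ _ NE N0).
  rewrite NE [e * _]mulrC rpredDr ?dvdz_mull// [n + _]addrC divzMDl// [d%:Z + _]addrC.
  case: ifP => // _; rewrite /Defs.induced.
  have dd : (d%:Z %| (n %/ e)%Z + d%:Z - (n %/ e)%Z)%Z by rewrite addrAC subrr add0r dvdzz.
  have := coprimez_modP dd; rewrite /coprimez => ->; case: ifP => // _.
  by apply: (dirichlet_mod hc); apply: dvdz_trans dd; rewrite dvdzE.
have eN : (e %| N)%Z by rewrite NE dvdz_mulr.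
have dN : (d%:Z %| N)%Z by rewrite NE dvdz_mull.
rewrite Gauss_dvdzr; last by rewrite coprimez_sym (coprimez_dvdrz eN).
case: ifP => en; last by rewrite mulr0.
rewrite -mulz_divA// /Defs.induced.
have := coprimezMl d%:Z v (n %/ e)%Z; rewrite (coprimez_dvdrz dN cv) /= /coprimez => ->.
by case: ifP => _; rewrite ?mulr0 ?mul.
Qed.

Lemma ratio_char_eq1 (N e : int) (d f : nat) psi : N != 0 -> N = e * d%:Z ->
  dirichlet_character f psi -> ratio_char N d (Defs.induced d psi) e = 1.
Proof.
move=> N0 NE hc; have e0 : e != 0 by move: (N0); rewrite NE mulf_eq0 negb_or => /andP[].
rewrite (ratio_charE _ _ NE N0) dvdzz divzz e0 /Defs.induced /= (dirichlet1 hc).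
by rewrite /gcdz gcd1n.
Qed.

(* The indicator of the integers n with |N| / gcd(n, N) = d; these classes are the
   orbits of the units mod N acting on Z / N. *)
Definition gcd_class (N : int) (d : nat) (n : int) : R[i] :=
  ((d * gcdn `|n| `|N|)%N == `|N|%N)%:R.

Lemma gcd_class_periodic N d : periodic_mod N (gcd_class N d).
Proof.
move=> n; rewrite /gcd_class; suff -> : gcdn `|n + N| `|N| = gcdn `|n| `|N| by [].
by have := gcdzDr N n; rewrite gcdzC [in RHS]gcdzC => -[].
Qed.

(** On the class of d one has n = q e with q prime to d. Lifting q to a unit v = q + d t mod N gives
    v e = n mod N, so w(n) = psi(v) w(e). If w(e) != 0, any unit v that is 1 mod d fixes e mod N,
    which forces psi(v) = 1; by [conductor_dvd], f then divides d. *)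
Lemma gcd_classM (N e : int) (d f : nat) psi w n : N != 0 -> N = e * d%:Z -> (f%:Z %| N)%Z ->
  primitive_character f psi -> isotypic N psi w ->
  gcd_class N d n * w n = if (f %| d)%N then w e * ratio_char N d (Defs.induced d psi) n else 0.
Proof.
move=> N0 NE fN pp [pw iw]; have [hc prim] := pp.
have [e0 d0] : e != 0 /\ d%:Z != 0 by move: (N0); rewrite NE mulf_eq0 negb_or => /andP[].
have K0 : (0 < `|N|)%N by rewrite absz_gt0.
have NKabs (v : int) : coprimez v `|N|%N = coprimez v N by rewrite !coprimezE.
have KE : `|N|%N = (`|e| * d)%N by rewrite NE abszM.
have dK : (d %| `|N|)%N by rewrite KE dvdn_mull.
have ae0 : (0 < `|e|)%N by rewrite absz_gt0.
have ad0 : (0 < d)%N by rewrite lt0n.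
have classE q : gcd_class N d (q * e) = (coprimez q d)%:R.
  rewrite /gcd_class /= coprimezE /coprime KE abszM [(`|q| * _)%N]mulnC -muln_gcdr.
  by rewrite mulnCA -[X in _ == X]muln1 -mulnA !eqn_pmul2l.
have [/dvdzP[q ->]|ne] := boolP (e %| n)%Z; last first.
  rewrite (ratio_charE _ _ NE N0) (negbTE ne) mulr0 if_same /gcd_class.
  rewrite [_ == _]negbTE ?mul0r//; apply: contra ne => /eqP; rewrite KE mulnC => /eqP.
  by rewrite eqn_pmul2r// => /eqP gE; rewrite dvdzE -gE dvdn_gcdl.
rewrite classE (ratio_charE _ _ NE N0) dvdz_mull ?dvdzz// mulzK// /Defs.induced -/(coprimez q d).
have [cq|_] := boolP (coprimez q d); last by rewrite mul0r mulr0 if_same.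
rewrite mul1r.
have [t ct] := coprimez_lift K0 cq; rewrite NKabs in ct.
have -> : w (q * e) = psi (q + d%:Z * t) * w e.
  rewrite -iw// mulrDl (_ : d%:Z * t * e = N * t) ?periodic_modM//.
  by rewrite NE; ring.
case: ifPn => fd.
  rewrite mulrC; congr (_ * _); apply: (dirichlet_mod hc).
  by rewrite addrAC subrr add0r dvdz_mulr// dvdzE.
have [->|we] := eqVneq (w e) 0; first by rewrite mulr0.
case/negP: fd; apply: (conductor_dvd K0 _ dK pp) => // v; rewrite NKabs => cv /dvdzP[s vs].
apply: (mulIf we); rewrite mul1r -iw//.
have -> : v * e = e + N * s by rewrite -[v](subrK 1) vs NE; ring.
by rewrite periodic_modM.
Qed.

Lemma sum_gcd_class N n : N != 0 -> \sum_(d <- divisors `|N|%N) gcd_class N d n = 1.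
Proof.
move=> N0; have K0 : (0 < `|N|)%N by rewrite absz_gt0.
pose g := gcdn `|n| `|N|; have g0 : (0 < g)%N by rewrite gcdn_gt0 K0 orbT.
have gN : (g %| `|N|)%N := dvdn_gcdr _ _.
rewrite (bigD1_seq (`|N| %/ g)%N) ?divisors_uniq//=; last by rewrite -dvdn_divisors// dvdn_div.
rewrite /gcd_class -/g divnK// eqxx big1 ?addr0// => d dn.
by rewrite [_ == _]negbTE//; apply: contra dn => /eqP <-; rewrite mulnK.
Qed.

(* [class_mult N f d] multiplies a [psi]-isotypic sequence ([psi] primitive mod [f]) like the
   indicator of the class of [d]; the classes outside the support of all such sequences are
   thrown in with [d = |N|] so that these multipliers sum up to [1]. *)
Definition class_mult (N : int) (f d : nat) (n : int) : R[i] :=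
  gcd_class N d n + (d == `|N|%N)%:R *
    (1 - \sum_(d' <- divisors `|N|%N | (f %| d')%N) gcd_class N d' n).

Lemma class_mult_periodic N f d : periodic_mod N (class_mult N f d).
Proof.
move=> n; rewrite /class_mult gcd_class_periodic; congr (_ + _ * (_ - _)).
by apply: eq_bigr => d' _; rewrite gcd_class_periodic.
Qed.

Lemma sum_class_mult N f n : N != 0 -> (f%:Z %| N)%Z ->
  \sum_(d <- divisors `|N|%N | (f %| d)%N) class_mult N f d n = 1.
Proof.
move=> N0 fN; have K0 : (0 < `|N|)%N by rewrite absz_gt0.
rewrite big_split/= -big_distrl/= (_ : \sum_(i <- _ | _) (i == _)%:R = 1) ?mul1r ?subrKC//.
rewrite -big_filter (bigD1_seq `|N|%N) ?filter_uniq ?divisors_uniq//=; last first.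
  by rewrite mem_filter -dvdn_divisors// dvdnn andbT.
by rewrite eqxx big1 ?mul1r ?addr0// => d /negbTE ->.
Qed.

Lemma class_multM (N : int) (d f : nat) psi w n : N != 0 -> (d%:Z %| N)%Z -> (f %| d)%N ->
  primitive_character f psi -> isotypic N psi w ->
  class_mult N f d n * w n = w (N %/ d%:Z)%Z * ratio_char N d (Defs.induced d psi) n.
Proof.
move=> N0 dN fd pp iw; have K0 : (0 < `|N|)%N by rewrite absz_gt0.
have fN : (f%:Z %| N)%Z by apply: dvdz_trans dN; rewrite dvdzE.
have NE d' : (d' %| `|N|)%N -> N = (N %/ d'%:Z)%Z * d'%:Z.
  by move=> d'N; rewrite divzK// dvdzE.
have ME d' : (d' %| `|N|)%N -> _ := fun h => gcd_classM n N0 (NE d' h) fN pp iw.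
(* The correction term is the sum of the classes of d' with f not dividing d', on which w
   vanishes. *)
have rest : (1 - \sum_(d' <- divisors `|N|%N | (f %| d')%N) gcd_class N d' n) * w n = 0.
  rewrite mulrBl mul1r big_distrl/=; apply/eqP; rewrite subr_eq0; apply/eqP.
  rewrite -[LHS]mul1r -(sum_gcd_class n N0) big_distrl [RHS]big_mkcond/=.
  apply: eq_big_seq => d'; rewrite -dvdn_divisors// => d'N.
  by case: ifPn => // /negbTE fd'; rewrite ME// fd'.
rewrite /class_mult mulrDl -mulrA rest mulr0 addr0 ME ?fd//.
Qed.

End Isotypic.

(** * The action on the coarse components *)

Section Components.
Context {R : realType}.
Local Notation mu := (@lebesgue_measure R).
Local Notation mR := (measurableTypeR R).
Implicit Types (chi w : int -> R[i]) (F G : heis R -> R[i]).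

Lemma sqrtc_CNd_neq0 (N : int) (d : nat) : N != 0 -> (0 < d)%N -> sqrtc (CNd N d) != 0 :> R[i].
Proof.
move=> N0 d0; apply/eqP => s0; have : CNd N d = 0 :> R[i] by rewrite -[LHS]sqr_sqrtc s0 expr0n.
move=> /eqP; rewrite /CNd mulf_eq0 invr_eq0 intr_eq0 (negbTE N0) pnatr_eq0 /=.
by rewrite -leqn0 leqNgt totient_gt0 d0.
Qed.

Lemma HNd_admissible (N : int) (d f : nat) chi : N != 0 -> (d%:Z %| N)%Z -> (f %| d)%N ->
  dirichlet_character f chi ->
  [/\ periodic_mod N (ratio_char N d (Defs.induced d chi)),
      (exists n0, ratio_char N d (Defs.induced d chi) n0 = 1) &
      sqrtc (CNd N d) != 0 :> R[i]].
Proof.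
move=> N0 dN fd hc; have NE : N = (N %/ d%:Z)%Z * d%:Z by rewrite divzK.
split.
- by case: (isotypic_ratio_char N0 NE fd hc).
- by exists (N %/ d%:Z)%Z; exact: ratio_char_eq1 NE hc.
- by apply: sqrtc_CNd_neq0 => //; move: N0; rewrite NE mulf_eq0 negb_or lt0n => /andP[].
Qed.

Lemma HNd0 (N : int) (d f : nat) chi : N != 0 -> (d%:Z %| N)%Z -> (f %| d)%N ->
  dirichlet_character f chi -> HNd N d (Defs.induced d chi) (fun=> 0 : R[i]).
Proof.
move=> N0 dN fd hc; have [pw n0 k0] := HNd_admissible N0 dN fd hc.
have s0 : sqnorm haar cube (fun=> 0 : R[i]) = 0%E :> \bar R.
  by rewrite sqnormE integral0_eq// => x _; rewrite cnorm2_0.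
have c0 : cmeasurable (fun _ : heis R => 0 : R[i]) by exact: cmeasurable_cst.
apply: (HNd_closed (v := fun _ => fun=> 0)) => //.
- by move=> k; exact: schwartzc0.
- apply: (HN_of_automorphic (G := fun=> 0)) => //; [|exact/aeW|by rewrite s0].
  by split=> // a c z; rewrite mulr0.
- set s := sqnorm _ _ _; suff -> : s = 0%E by exact: cvg_cst.
  rewrite -s0 /s; congr sqnorm; apply/funext => x.
  by rewrite W_schwartzE theta0 mulr0 subr0.
Qed.

Lemma HNd_sum (N : int) (d f : nat) chi (I : Type) (r : seq I) (P : pred I)
    (F : I -> heis R -> R[i]) : N != 0 -> (d%:Z %| N)%Z -> (f %| d)%N ->
  dirichlet_character f chi -> (forall i, P i -> HNd N d (Defs.induced d chi) (F i)) ->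
  HNd N d (Defs.induced d chi) (fun x => \sum_(i <- r | P i) F i x).
Proof.
move=> N0 dN fd hc hF; have [pw n0 k0] := HNd_admissible N0 dN fd hc.
elim: r => [|i r ih].
  rewrite (_ : (fun x => _) = fun=> 0); first exact: HNd0 hc.
  by apply/funext => x; rewrite big_nil.
case Pi: (P i); last first.
  rewrite (_ : (fun x => _) = fun x => \sum_(i <- r | P i) F i x)//.
  by apply/funext => x; rewrite big_cons Pi.
rewrite (_ : (fun x => _) = fun x => F i x + \sum_(i <- r | P i) F i x).
  by apply: HNdD => //; exact: hF.
by apply/funext => x; rewrite big_cons Pi.
Qed.

Lemma thetaZ (N : int) w (u : R -> R[i]) (k : R[i]) x : N != 0 -> periodic_mod N w -> schwartz u ->
  theta N w (fun y => k * u y) x = k * theta N w u x.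
Proof.
move=> N0 pw su; case: x => [[a c] z]; rewrite /theta mulrCA.
rewrite -(csumZZ k (theta_term_qdecay a c N0 pw su)).
by congr (_ * csumZ _); apply/funext => n; rewrite /theta_term; ring.
Qed.

Lemma theta_scale_weight (N : int) w (u : R -> R[i]) (k : R[i]) x :
  theta N (fun n => k * w n) u x = theta N w (fun y => k * u y) x.
Proof.
case: x => [[a c] z]; congr (_ * csumZ _); apply/funext => n; rewrite /theta_term; ring.
Qed.

Lemma projectB (N : int) (psi : int -> R[i]) F G x :
  project N psi (fun y => F y - G y) x = project N psi F x - project N psi G x.
Proof.
rewrite /project /combine -sumrB; apply: eq_bigr => k _.
by rewrite /translate mulrBr.
Qed.

Lemma projectZ (N : int) (psi : int -> R[i]) (k : R[i]) F x :
  project N psi (fun y => k * F y) x = k * project N psi F x.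
Proof.
rewrite /project /combine mulr_sumr; apply: eq_bigr => j _.
by rewrite /translate mulrCA.
Qed.

(** On Schwartz approximants everything is explicit: R produces a theta function whose weight is
    isotypic for conj chi, and the multiplier for d' reduces this weight to a multiple of that of W
    for d'. Boundedness of R and of the multiplier carries the convergence over, and closedness of
    the range concludes. *)
Lemma HNd_project (N : int) (d d' f : nat) chi F G : N != 0 ->
  (d%:Z %| N)%Z -> (f %| d)%N -> (d'%:Z %| N)%Z -> (f %| d')%N ->
  primitive_character f chi -> HNd N d (Defs.induced d chi) F ->
  automorphic N G -> F = G %[ae haar] -> (sqnorm haar cube G < +oo)%E ->
  HNd N d' (Defs.induced d' (conj_character chi))
    (project N (class_mult N f d') (heis_fourier G)).
Proof.
move=> N0 dN fd d'N fd' pc [f0 [_ hF [u [su _ uF]]]] aG FG finG.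
have [hc _] := pc; have pc' := primitive_conj pc; have [hc' _] := pc'.
have fN : (f%:Z %| N)%Z by apply: dvdz_trans dN; rewrite dvdzE.
have [pw n0 k0] := HNd_admissible N0 dN fd hc.
have [pw' n0' k0'] := HNd_admissible N0 d'N fd' hc'.
have NE : N = (N %/ d%:Z)%Z * d%:Z by rewrite divzK.
have iw := isotypic_finite_fourier N0 fN hc (isotypic_ratio_char N0 NE fd hc).
have ppsi := class_mult_periodic (R := R) N f d'.
set w := ratio_char N d _ in pw iw; set w' := ratio_char N d' _ in pw'.
set psi := class_mult N f d' in ppsi *.
set kap := sqrtc (CNd N d) in k0; set kap' := sqrtc (CNd N d') in k0'.
set c := finite_fourier N w (N %/ d'%:Z)%Z.
pose W k := W_schwartz N d (Defs.induced d chi) (u k).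
have WE k : W k = fun x => kap * theta N w (u k) x.
  by apply/funext => x; rewrite /W W_schwartzE.
have aW k : automorphic N (W k).
  by rewrite WE; apply: automorphicZ; exact: theta_automorphic.
have aRG := automorphic_heis_fourier aG.
have apr H : automorphic N H -> automorphic N (project N psi H).
  by move=> aH; exact: combine_automorphic.
have [C C0 leC] := sqnorm_combine_le N0 (proj_coef N psi).
have mF := proj1 hF; have [mG _ _] := aG.
(* The factor [c] is the value of the transformed weight at the base point N / d' of the class;
   [kap] and [kap'] exchange the normalizations of W for d and d'. *)
pose v k x := (kap'^-1 * (kap * c)) * schwartz_fourier N (u k) x.
have sv k : schwartz (v k) by apply: cschwartzZ; exact: schwartz_fourierP.
have WvE k x : W_schwartz N d' (Defs.induced d' (conj_character chi)) (v k) x =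
    project N psi (heis_fourier (W k)) x.
  rewrite W_schwartzE -/w' -/kap' thetaZ//; last exact: schwartz_fourierP.
  rewrite (_ : heis_fourier (W k) = fun y => kap * heis_fourier (theta N w (u k)) y); last first.
    by rewrite WE; apply/funext => -[[? ?] ?].
  rewrite projectZ heis_fourier_theta// project_theta//; last 2 first.
  - by case: iw.
  - exact: schwartz_fourierP.
  rewrite (_ : (fun n => psi n * _) = fun n => c * w' n); last first.
    by apply/funext => n; exact: class_multM d'N fd' pc' iw.
  rewrite theta_scale_weight thetaZ//; last exact: schwartz_fourierP.
  by rewrite !mulrA divff// mul1r.
apply: (HNd_closed (v := v)) => //.
  apply: (HN_of_automorphic (G := project N psi (heis_fourier G))) => //.
  - by case: (apr _ aRG).
  - exact: apr.
  - exact/aeW.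
  - apply: (le_lt_trans (leC _ aRG)); rewrite (sqnorm_heis_fourier aG).
    by apply: lte_mul_pinfty.
apply: (@squeeze_cvge _ _ _ _ (cst 0%E) _
    (fun k => C%:E * sqnorm haar cube (fun x => (W k x - F x)%R))%E).
- apply: nearW => k; apply/andP; split.
    by rewrite sqnormE; apply: integral_ge0 => x _; rewrite lee_fin cnorm2_ge0.
  have aD := automorphicB (aW k) aG.
  rewrite (_ : (fun x => _ - _) = project N psi (heis_fourier (fun y => W k y - G y))); last first.
    apply/funext => x; rewrite WvE -projectB; congr (project N psi _ x).
    by apply/funext => -[[? ?] ?].
  apply: (le_trans (leC _ (automorphic_heis_fourier aD))).
  rewrite (sqnorm_heis_fourier aD) (sqnorm_ae (F := fun x => W k x - F x)
    (G := fun y => W k y - G y) measurable_cube)//.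
  + by case: (aW k) => mW _ _; exact: cmeasurableB.
  + by case: aD.
  + by move: FG; apply: filterS => x E /E ->.
- exact: cvg_cst.
- by rewrite -[X in _ --> X](mule0 C%:E); apply: cvgeZl.
Qed.

(** Each summand of [F] is sent by R into several spaces at once. Its image is cut by the
    multipliers, the pieces are regrouped by their target d', and they add up to R F because the
    multipliers sum to 1. *)
Lemma HNchi_heis_fourier (N : int) (f : nat) chi F : N != 0 -> (f%:Z %| N)%Z ->
  primitive_character f chi -> HNchi N chi f F ->
  HNchi N (conj_character chi) f (heis_fourier F).
Proof.
move=> N0 fN pc [hF [G [hG FG]]]; split; first exact: HN_heis_fourier.
have [hc' _] := primitive_conj pc.
(* Projections evaluate a function at translated points, so exact representatives of all summands
   are fixed beforehand. *)
have /choice[G' G'P] : forall d, exists G' : heis R -> R[i], (f %| d)%N -> (d%:Z %| N)%Z ->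
    [/\ automorphic N G', G d = G' %[ae haar] & (sqnorm haar cube G' < +oo)%E].
  move=> d; have [/andP[fd dN]|nd] := boolP ((f %| d)%N && (d%:Z %| N)%Z).
    have [? [_ hGd _]] := hG d fd dN.
    by have [G' ?] := HN_automorphic hGd; exists G'.
  by exists (G d) => fd dN; case/negP: nd; rewrite fd dN.
have K0 : (0 < `|N|)%N by rewrite absz_gt0.
have dP d : d \in divisors `|N| -> (d%:Z %| N)%Z by rewrite -dvdn_divisors// dvdzE.
pose s := [seq d <- divisors `|N|%N | (f %| d)%N].
have sP d : d \in s -> (f %| d)%N /\ (d%:Z %| N)%Z.
  by rewrite mem_filter => /andP[fd /dP].
exists (fun d' x => \sum_(d <- divisors `|N|%N | (f %| d)%N && (d%:Z %| N)%Z)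
  project N (class_mult N f d') (heis_fourier (G' d)) x); split.
  move=> d' fd' d'N; apply: (HNd_sum (f := f)) => // d /andP[fd dN].
  by have [aG GG finG] := G'P d fd dN; apply: HNd_project (hG d fd dN) aG GG finG.
have aeG : {ae haar, forall x, forall d, (f %| d)%N -> (d%:Z %| N)%Z -> G d x = G' d x}.
  apply: ae_foralln => d.
  have [/andP[fd dN]|nd] := boolP ((f %| d)%N && (d%:Z %| N)%Z).
    by have [_ GG _] := G'P d fd dN; apply: filterS GG => x E _ _; exact: E.
  by apply/aeW => x fd dN; case/negP: nd; rewrite fd dN.
have {}FG : F = (fun x => \sum_(d <- divisors `|N|%N | (f %| d)%N && (d%:Z %| N)%Z) G' d x)
    %[ae haar].
  move: FG aeG; apply: filterS2 => x + Gx xT => /(_ xT) ->.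
  rewrite big_seq_cond [RHS]big_seq_cond; apply: eq_big => [d|d /andP[/dP dN fd]].
    by case E: (d \in _) => //=; rewrite (dP _ E) andbT.
  exact: Gx.
apply: filterS (heis_fourier_ae FG) => x + xT => /(_ xT) ->.
rewrite exchange_big/= heis_fourierE; apply: eq_bigr => d _.
rewrite project_sum -heis_fourierE -[LHS](project1 N0).
by congr (project N _ _ x); apply/funext => n; rewrite sum_class_mult.
Qed.

Lemma heis_fourier_inj : injective (@heis_fourier R).
Proof. by move=> F G E; rewrite -(heis_fourier4 F) E heis_fourier4. Qed.

Lemma heis_fourier_HNchi (N : int) (f : nat) chi : N != 0 -> (f%:Z %| N)%Z ->
  primitive_character f chi ->
  heis_fourier @` HNchi N chi f = HNchi N (conj_character chi) f.
Proof.
move=> N0 fN pc; apply/seteqP; split=> [_ [F hF <-]|G hG]; first exact: HNchi_heis_fourier.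
exists (heis_fourier (heis_fourier (heis_fourier G))); last exact: heis_fourier4.
have pc' := primitive_conj pc.
have h2 := HNchi_heis_fourier N0 fN pc' hG; rewrite conj_characterK in h2.
have h4 := HNchi_heis_fourier N0 fN pc' (HNchi_heis_fourier N0 fN pc h2).
by rewrite conj_characterK in h4.
Qed.

Lemma coarse_components_heis_fourier (N : int) : N != 0 ->
  set_bij (coarse_components (R := R) N) (coarse_components N) (fun V => heis_fourier @` V).
Proof.
move=> N0; split.
- move=> _ [f [chi [fN pc] ->]]; exists f; exists (conj_character chi).
    by split=> //; exact: primitive_conj.
  exact: heis_fourier_HNchi.
- move=> V W _ _ VW; apply/seteqP; split=> F hF.
    have : (heis_fourier @` W) (heis_fourier F) by rewrite -VW; exists F.
    by case=> G hG /heis_fourier_inj <-.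
  have : (heis_fourier @` V) (heis_fourier F) by rewrite VW; exists F.
  by case=> G hG /heis_fourier_inj <-.
- move=> _ [f [chi [fN pc] ->]]; exists (HNchi N (conj_character chi) f).
    exists f; exists (conj_character chi) => //; split=> //; exact: primitive_conj.
  rewrite heis_fourier_HNchi ?conj_characterK//; exact: primitive_conj.
Qed.

End Components.

Unset Implicit Arguments.
Set Strict Implicit.
Set Printing Implicit Defensive.
Local Close Scope complex_scope.

Theorem theorem8p3 (R : realType) (N : int) (N_neq0 : N != 0) :
  [/\ unitary_on (HN (R := R) N) heis_fourier,
      set_bij (coarse_components (R := R) N) (coarse_components N)
        (fun V => heis_fourier @` V) &
      forall (f : nat) (chi : int -> R[i]),
        (f%:Z %| N)%Z -> primitive_character f chi ->
        heis_fourier @` HNchi N chi f = HNchi N (conj_character chi) f].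
Proof.
split.
- exact: unitary_heis_fourier.
- exact: coarse_components_heis_fourier.
- by move=> f chi; exact: heis_fourier_HNchi.
Qed.
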